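(* Let $X$ be a separable Banach space. Then $\mathcal{K}(X)$ is an $M$-ideal in $\mathcal{L}(X)$ if and only if the following three conditions hold: $X$ does not contain a copy of $\ell_1$, $X$ has property $(M)$, and $X$ has the metric compact approximation property.
   Context: $\mathcal{L}(X)$ is the Banach space of bounded linear operators on $X$ with the operator norm, $\mathcal{K}(X)$ its closed subspace of compact operators. A closed subspace $J$ of a Banach space $E$ is an $M$-ideal in $E$ if there is a subspace $V\subset E^*$ with $E^*=J^\perp\oplus_1 V$, i.e. every $e^*\in E^*$ is uniquely $e^*=j+v$ with $j\in J^\perp$ (annihilator of $J$), $v\in V$, and $\|e^*\|=\|j\|+\|v\|$. A separable Banach space $X$ has property $(M)$ if $\limsup_n\|u+x_n\|=\limsup_n\|v+x_n\|$ whenever $u,v\in X$, $\|u\|=\|v\|$, and $x_n\to0$ weakly in $X$. ''$X$ contains a copy of $\ell_1$'' means that $X$ has a closed subspace isomorphic to $\ell_1$. $X$ has the metric compact approximation property if there is a net of compact operators on $X$ of norm at most $1$ converging strongly (pointwise in norm) to the identity. *)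

(* Defs.v *)
From HB Require Import structures.
From mathcomp Require Import all_boot all_order all_algebra.
From mathcomp Require Import complex.
From mathcomp Require Import all_classical all_reals all_analysis.
Set Implicit Arguments.
Unset Strict Implicit.
Unset Printing Implicit Defensive.
Import Order.TTheory GRing.Theory Num.Theory.
Import numFieldNormedType.Exports.
Local Open Scope classical_set_scope.
Local Open Scope ring_scope.

(** Banach spaces are taken over either the real or the complex numbers.  In
    MathComp-Analysis the norm of a [normedModType K] has its values in [K];
    [rnorm] is the same norm seen in the real field [R]. *)

Variant scalar_kind := RealScalars | ComplexScalars.

Definition scalars (R : realType) (k : scalar_kind) : numFieldType :=
  match k with
  | RealScalars => R
  | ComplexScalars => R[i]
  end.

Definition of_real (R : realType) (k : scalar_kind) : R -> scalars R k :=
  match k with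
  | RealScalars => fun r => r
  | ComplexScalars => fun r => r%:C%C
  end.

Definition real_part (R : realType) (k : scalar_kind) : scalars R k -> R :=
  match k with
  | RealScalars => fun z => z
  | ComplexScalars => fun z => complex.Re z
  end.

Definition rnorm (R : realType) (k : scalar_kind)
    (V : normedZmodType (scalars R k)) (x : V) : R := real_part `|x|.

Section scalars_theory.
Context {R : realType} {k : scalar_kind}.
Local Notation K := (scalars R k).

Lemma of_realK : cancel (@of_real R k) (@real_part R k).
Proof. by case: k. Qed.

Lemma of_realD (r s : R) : of_real k (r + s) = of_real k r + of_real k s.
Proof. by case: k => //=; rewrite rmorphD. Qed.

Lemma of_realM (r s : R) : of_real k (r * s) = of_real k r * of_real k s.
Proof. by case: k => //=; rewrite rmorphM. Qed.

Lemma of_real0 : of_real k (0 : R) = 0.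
Proof. by case: k => //=; rewrite rmorph0. Qed.

Lemma of_real1 : of_real k (1 : R) = 1.
Proof. by case: k => //=; rewrite rmorph1. Qed.

Lemma ler_of_real (r s : R) : (of_real k r <= of_real k s) = (r <= s).
Proof. by case: k => //=; rewrite lecR. Qed.

Lemma ltr_of_real (r s : R) : (of_real k r < of_real k s) = (r < s).
Proof. by case: k => //=; rewrite ltcR. Qed.

Lemma ge0_real_partK (x : K) : 0 <= x -> of_real k (real_part x) = x.
Proof.
case: k x => //= -[a b]; rewrite lecE/= => /andP[/eqP b0 _].
by rewrite b0.
Qed.

Lemma rnormE (V : normedZmodType K) (x : V) : of_real k (rnorm x) = `|x|.
Proof. exact: ge0_real_partK. Qed.

Lemma rnorm_ge0 (V : normedZmodType K) (x : V) : 0 <= rnorm x.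
Proof. by rewrite -ler_of_real of_real0 rnormE. Qed.

Lemma rnorm0 (V : normedZmodType K) : rnorm (0 : V) = 0.
Proof. by apply: (can_inj of_realK); rewrite rnormE of_real0 normr0. Qed.

Lemma rnorm0_eq0 (V : normedZmodType K) (x : V) : rnorm x = 0 -> x = 0.
Proof. by move=> x0; apply/normr0_eq0; rewrite -rnormE x0 of_real0. Qed.

Lemma ler_rnormD (V : normedZmodType K) (x y : V) :
  rnorm (x + y) <= rnorm x + rnorm y.
Proof. by rewrite -ler_of_real of_realD !rnormE ler_normD. Qed.

Lemma rnormZ (V : normedModType K) (a : K) (x : V) :
  rnorm (a *: x) = rnorm a * rnorm x.
Proof. by apply: (can_inj of_realK); rewrite of_realM !rnormE normrZ. Qed.

Lemma rnormM (a b : K) : rnorm (a * b) = rnorm a * rnorm b.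
Proof. by apply: (can_inj of_realK); rewrite of_realM !rnormE normrM. Qed.

End scalars_theory.

Section bounded_operator.
Context {R : realType} {k : scalar_kind}.
Local Notation K := (scalars R k).
Variables X Y : normedModType K.

(* A linear map between normed spaces is bounded iff it is continuous
   ([linear_bounded_continuous]). *)
Definition bounded_linear : {pred X -> Y} :=
  mem [set f : X -> Y | linear f /\ continuous f].

Record bop := Bop { bop_fun :> X -> Y; _ : bop_fun \in bounded_linear }.

HB.instance Definition _ := [isSub for bop_fun].
HB.instance Definition _ := [Choice of bop by <:].

Fact bounded_linear_submod : submod_closed bounded_linear.
Proof.
split=> [|a f g].
  apply/mem_set; split; last exact: cst_continuous.
  by move=> a x y; rewrite -[RHS]/(a *: 0 + 0) scaler0 addr0.
move=> /set_mem[lf cf] /set_mem[lg cg]; apply/mem_set; split; last first.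
  by move=> x; apply: cvgD; [apply: cvgZr; exact: cf|exact: cg].
move=> b x y.
have lfE := lf b x y; have lgE := lg b x y.
rewrite -[LHS]/(a *: f (b *: x + y) + g (b *: x + y)).
rewrite -[RHS]/(b *: (a *: f x + g x) + (a *: f y + g y)).
by rewrite lfE lgE !scalerDr !scalerA (mulrC a b) addrACA.
Qed.

HB.instance Definition _ :=
  GRing.isSubmodClosed.Build K (X -> Y) bounded_linear bounded_linear_submod.
HB.instance Definition _ := [SubChoice_isSubLmodule of bop by <:].

Fact bop_linear (f : bop) : linear f.
Proof. by case: f => f /= /set_mem[]. Qed.

HB.instance Definition _ (f : bop) :=
  GRing.isLinear.Build K X Y *:%R f (bop_linear f).

Lemma bop_continuous (f : bop) : continuous f.
Proof. by case: f => f /= /set_mem[]. Qed.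

Lemma bopP (f g : bop) : f =1 g <-> f = g.
Proof. by split=> [fg|->//]; apply/val_inj/funext. Qed.

Lemma bop_addE (f g : bop) x : (f + g) x = f x + g x. Proof. by []. Qed.

Lemma bop_scaleE a (f : bop) x : (a *: f) x = a *: f x. Proof. by []. Qed.

Definition opnorm (f : bop) : R :=
  sup [set rnorm (f x) | x in [set x | rnorm x <= 1]].

Lemma bop_bounded (f : bop) :
  exists2 M : R, 0 <= M & forall x, rnorm (f x) <= M * rnorm x.
Proof.
have /linear_bounded_continuous/linear_boundedP := @bop_continuous f.
move=> /pinfty_ex_gt0[M M0 Mf]; exists (real_part M).
  by rewrite -(ler_of_real (k := k)) of_real0 ge0_real_partK ltW.
move=> x; rewrite -(ler_of_real (k := k)) of_realM !rnormE.
by rewrite ge0_real_partK; [exact: Mf|exact: ltW].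
Qed.

Lemma opnorm_has_sup (f : bop) :
  has_sup [set rnorm (f x) | x in [set x | rnorm x <= 1]].
Proof.
split; first by exists (rnorm (f 0)), 0 => //=; rewrite rnorm0 ler01.
have [M M0 Mf] := bop_bounded f; exists M => _ [x /= x1 <-].
by rewrite (le_trans (Mf x))// ler_piMr.
Qed.

Lemma opnorm_ge0 (f : bop) : 0 <= opnorm f.
Proof.
apply: (le_trans (rnorm_ge0 (f 0))).
apply: sup_upper_bound (opnorm_has_sup f) _ _.
by exists 0 => //=; rewrite rnorm0 ler01.
Qed.

Lemma rnorm_bop_le (f : bop) x : rnorm (f x) <= opnorm f * rnorm x.
Proof.
have [->|x0] := eqVneq x 0; first by rewrite linear0 !rnorm0 mulr0.
have nx0 : 0 < rnorm x.
  rewrite lt_neqAle rnorm_ge0 andbT eq_sym.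
  by apply: contra x0 => /eqP/rnorm0_eq0 ->.
have rV : rnorm (of_real k (rnorm x)^-1) = (rnorm x)^-1.
  apply: (can_inj (of_realK (k := k))); rewrite rnormE ger0_norm//.
  by rewrite -(of_real0 (k := k)) ler_of_real invr_ge0 ltW.
rewrite -ler_pdivrMr// mulrC -{1}rV -rnormZ -linearZ.
apply: sup_upper_bound (opnorm_has_sup f) _ _.
by exists (of_real k (rnorm x)^-1 *: x) => //=; rewrite rnormZ rV mulVf ?gt_eqF.
Qed.

Lemma opnorm_le (f : bop) M :
  (forall x, rnorm x <= 1 -> rnorm (f x) <= M) -> opnorm f <= M.
Proof.
move=> fM; apply: ge_sup; first by have [] := opnorm_has_sup f.
by move=> _ [x /= x1 <-]; exact: fM.
Qed.

Let norm (f : bop) : K := of_real k (opnorm f).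

Fact ler_opnormD f g : norm (f + g) <= norm f + norm g.
Proof.
rewrite -of_realD ler_of_real; apply: opnorm_le => x x1.
rewrite bop_addE (le_trans (ler_rnormD _ _))// lerD//.
- by rewrite (le_trans (rnorm_bop_le f x))// ler_piMr// opnorm_ge0.
- by rewrite (le_trans (rnorm_bop_le g x))// ler_piMr// opnorm_ge0.
Qed.

Fact opnormZ (a : K) f : norm (a *: f) = `|a| * norm f.
Proof.
have le_opnormZ b g : opnorm (b *: g) <= rnorm b * opnorm g.
  apply: opnorm_le => x x1; rewrite bop_scaleE rnormZ ler_wpM2l ?rnorm_ge0//.
  by rewrite (le_trans (rnorm_bop_le g x))// ler_piMr// opnorm_ge0.
rewrite -rnormE -of_realM; congr of_real; apply/eqP; rewrite eq_le.
rewrite le_opnormZ/=; have [->|a0] := eqVneq a 0.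
  by rewrite rnorm0 mul0r opnorm_ge0.
have na0 : 0 < rnorm a.
  rewrite lt_neqAle rnorm_ge0 andbT eq_sym.
  by apply: contra a0 => /eqP/rnorm0_eq0 ->.
have := le_opnormZ a^-1 (a *: f); rewrite scalerA mulVf// scale1r.
rewrite -(ler_pM2l na0) mulrA -rnormM divff//.
suff -> : rnorm (1 : K) = 1 by rewrite mul1r.
by apply: (can_inj (of_realK (k := k))); rewrite rnormE normr1 of_real1.
Qed.

Fact opnorm0_eq0 f : norm f = 0 -> f = 0.
Proof.
rewrite /norm -of_real0 => /(can_inj of_realK) f0; apply/bopP => x.
apply/rnorm0_eq0/eqP; rewrite eq_le rnorm_ge0 andbT.
by rewrite (le_trans (rnorm_bop_le f x))// f0 mul0r.
Qed.

HB.instance Definition _ :=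
  Lmodule_isNormed.Build K bop ler_opnormD opnormZ opnorm0_eq0.

Lemma bop_normE (f : bop) : `|f| = of_real k (opnorm f).
Proof. by []. Qed.

End bounded_operator.

Definition dual (R : realType) (k : scalar_kind)
    (E : normedModType (scalars R k)) : normedModType (scalars R k) :=
  bop E (scalars R k)^o.

Section M_ideal.
Context {R : realType} {k : scalar_kind}.
Local Notation K := (scalars R k).

Definition linear_subspace (E : lmodType K) (J : set E) :=
  J 0 /\ forall (a : K) (u v : E), J u -> J v -> J (a *: u + v).

Definition annihilator (E : normedModType K) (J : set E) : set (dual E) :=
  [set f : bop E K^o | forall x, J x -> f x = 0].

Definition l1_direct_sum (E : normedModType K) (V W : set E) :=
  (forall e : E, exists! vw : E * E, [/\ V vw.1, W vw.2 & e = vw.1 + vw.2]) /\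
  (forall v w : E, V v -> W w -> `|v + w| = `|v| + `|w|).

Definition M_ideal (E : normedModType K) (J : set E) :=
  [/\ closed J, linear_subspace J &
      exists V : set (dual E),
        linear_subspace V /\ l1_direct_sum (annihilator J) V].

End M_ideal.

Section operators.
Context {R : realType} {k : scalar_kind}.
Local Notation K := (scalars R k).

Definition compact_operators (X Y : normedModType K) : set (bop X Y) :=
  [set T : bop X Y | forall A : set X, bounded_set A -> precompact (T @` A)].

Definition separable (T : topologicalType) :=
  exists2 A : set T, countable A & dense A.

Definition weakly_null (X : normedModType K) (x : nat -> X) :=
  forall f : bop X K^o, f (x n) @[n --> \oo] --> (0 : K^o).

Definition property_M (X : normedModType K) :=
  forall (u v : X) (x : nat -> X), `|u| = `|v| -> weakly_null x ->
    limn_esup (fun n => (rnorm (u + x n))%:E) =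
    limn_esup (fun n => (rnorm (v + x n))%:E).

Definition directed (I : Type) (le : I -> I -> Prop) :=
  [/\ exists i : I, True,
      forall i, le i i,
      forall i j l, le i j -> le j l -> le i l &
      forall i j, exists l, le i l /\ le j l].

Definition net_cvg (I : Type) (le : I -> I -> Prop) (T : topologicalType)
    (x : I -> T) (l : T) :=
  forall U : set T, nbhs l U -> exists i0, forall i, le i0 i -> U (x i).

Definition metric_compact_approximation_property (X : normedModType K) :=
  exists (I : Type) (le : I -> I -> Prop) (T : I -> bop X X),
    [/\ directed le,
        forall i, compact_operators (T i),
        forall i, `|T i| <= 1 &
        forall x : X, net_cvg le (fun i => T i x) x].

End operators.

Section ell1.
Context {R : realType} {k : scalar_kind}.
Local Notation K := (scalars R k).

Definition abs_summable : {pred nat -> K^o} :=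
  mem [set a : nat -> K^o | cvgn (series (fun n => rnorm (a n)))].

Fact abs_summable_submod : submod_closed abs_summable.
Proof.
split=> [|c a b].
  apply/mem_set => /=.
  have -> : series (fun n => rnorm ((0 : nat -> K^o) n)) = cst (0 : R).
    by apply/funext => n; rewrite /series/= big1// => i _; exact: rnorm0.
  exact: is_cvg_cst.
move=> /set_mem/= ca /set_mem/= cb; apply/mem_set => /=.
apply: (@series_le_cvg _ _ (fun n => rnorm c * rnorm (a n) + rnorm (b n))).
- by move=> n; exact: rnorm_ge0.
- by move=> n; rewrite addr_ge0 ?mulr_ge0 ?rnorm_ge0.
- by move=> n; rewrite (le_trans (ler_rnormD _ _))// lerD2r -rnormM.
- have -> : series (fun n => rnorm c * rnorm (a n) + rnorm (b n)) =
      rnorm c \*: series (fun n => rnorm (a n)) + series (fun n => rnorm (b n)).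
    apply/funext => n; rewrite /series/= big_split/=; congr (_ + _).
    by rewrite -mulr_sumr.
  by apply: is_cvgD => //; exact: is_cvgZr.
Qed.

Record ell1 := Ell1 { ell1_seq :> nat -> K^o; _ : ell1_seq \in abs_summable }.

HB.instance Definition _ := [isSub for ell1_seq].
HB.instance Definition _ := [Choice of ell1 by <:].
HB.instance Definition _ :=
  GRing.isSubmodClosed.Build K (nat -> K^o) abs_summable abs_summable_submod.
HB.instance Definition _ := [SubChoice_isSubLmodule of ell1 by <:].

Lemma ell1_summable (a : ell1) : cvgn (series (fun n => rnorm (a n))).
Proof. by case: a => a /= /set_mem. Qed.

Definition ell1_norm (a : ell1) : R := limn (series (fun n => rnorm (a n))).

Let norm (a : ell1) : K := of_real k (ell1_norm a).

Fact ler_ell1_normD a b : norm (a + b) <= norm a + norm b.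
Proof.
rewrite -of_realD ler_of_real /ell1_norm -limD; [|exact: ell1_summable..].
apply: ler_lim; first exact: ell1_summable.
  by apply: is_cvgD; exact: ell1_summable.
apply: nearW => n; rewrite /series/= -[leRHS]big_split/=.
by apply: ler_sum => i _; exact: ler_rnormD.
Qed.

Fact ell1_normZ (c : K) a : norm (c *: a) = `|c| * norm a.
Proof.
rewrite -rnormE -of_realM; congr of_real; rewrite /ell1_norm.
have -> : series (fun n => rnorm ((c *: a) n)) =
    (fun n => rnorm c * series (fun n => rnorm (a n)) n).
  apply/funext => n; rewrite /series/= mulr_sumr.
  by apply: eq_bigr => i _; exact: rnormM.
by apply: limZr; exact: ell1_summable.
Qed.

Fact ell1_norm0_eq0 a : norm a = 0 -> a = 0.
Proof.
rewrite /norm -of_real0 => /(can_inj of_realK) a0.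
apply/val_inj/funext => n; apply/rnorm0_eq0/eqP.
rewrite eq_le rnorm_ge0 andbT.
suff : rnorm (a n) <= ell1_norm a by rewrite a0.
have nd : nondecreasing_seq (series (fun n => rnorm (a n))).
  by apply: nondecreasing_series => i _ _; exact: rnorm_ge0.
apply: le_trans (nondecreasing_cvgn_le nd (@ell1_summable a) n.+1).
rewrite /series/= big_nat_recr//= lerDr sumr_ge0// => i _.
exact: rnorm_ge0.
Qed.

HB.instance Definition _ :=
  Lmodule_isNormed.Build K ell1 ler_ell1_normD ell1_normZ ell1_norm0_eq0.

Lemma ell1_normE (a : ell1) : `|a| = of_real k (ell1_norm a).
Proof. by []. Qed.

End ell1.

Arguments ell1 R k : clear implicits.

Section contains_copy.
Context {R : realType} {k : scalar_kind}.
Local Notation K := (scalars R k).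

(* [T] is a linear homeomorphism of [E] onto the closed subspace [Y]; outside
   [Y] the values of the inverse [S] are irrelevant. *)
Definition contains_copy (X E : normedModType K) :=
  exists (Y : set X) (T : bop E X) (S : X -> E),
    [/\ closed Y /\ linear_subspace Y, range T = Y,
        cancel T S & {within Y, continuous S}].

End contains_copy.

(* Main.v *)
(** If K(X) is an M-ideal, Hahn-Banach yields compact operators K with
    |S + I - K| <= 1 + e, for S a compact contraction, that are close to the identity at
    prescribed points (or functionals).  This gives the metric compact approximation
    property, (M) by letting S be of rank one, and in the same way its dual version (M* ).
    By (M* ), a weak* null sequence w n with |f + w n| <= |f| is weakly null, so that X* is
    separable, which excludes l1.

    Conversely, by Rosenthal's theorem bounded sequences have weakly Cauchy subsequences,
    and then (M) implies (M* ).  Let K n be compact contractions converging strongly to I;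
    by (M* ) the K n^* f converge weakly to f.  If |S + T - L| > 1 with S, L compact and
    S, T contractions, the adjoint of S + T - L attains its norm, again by (M* ); Simons'
    inequality turns this into convex combinations A of the K n with
    |S + T - A T| <= 1 + e.  This makes phi |-> (T |-> lim phi (K n T)) an L-projection of
    the dual of L(X) with kernel the annihilator of K(X). *)

From HB Require Import structures.
Require Import Defs.
From mathcomp Require Import all_boot all_order all_algebra.
From mathcomp Require Import complex ring lra.
From mathcomp Require Import all_classical all_reals all_analysis.
Set Implicit Arguments.
Unset Strict Implicit.
Unset Printing Implicit Defensive.
Import Order.TTheory GRing.Theory Num.Theory.
Import numFieldNormedType.Exports.
Local Open Scope classical_set_scope.
Local Open Scope ring_scope.

(** * Real-valued norms *)

Section scalars.
Context {R : realType} {k : scalar_kind}.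
Local Notation K := (scalars R k).

(** Two obstacles shape the converse. A weakly Cauchy sequence need not have a weak limit in [X], so
    (M) cannot be applied to [x n] minus its limit. Convex combinations [c j] of late terms replace
    the limit: differences [x (n j) - c j] are weakly null, and the asymptotically least norm [rho]
    of such combinations stands for the norm of the missing limit.

    Secondly, weak convergence of the adjoints controls [S + T - K n T] only on functionals of the
    form [A |-> F (A^* f)], which do not exhaust the dual of L(X), so Mazur's theorem gives no
    convex combinations of small norm. Simons' inequality asks for control only at functionals where
    a norm is attained, and norms above 1 suffice: there the part coming from the contraction [T]
    cannot account for the whole norm.

    The compact operator [S] is carried along because additivity of the norm must be tested on one
    operator: [T] nearly norms the annihilating part of a functional and [S] the other part. Limits
    are taken along an ultrafilter wherever they have to exist for every functional. *)

Lemma of_realN (r : R) : of_real k (- r) = - of_real k r.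
Proof. by case: k => //=; rewrite rmorphN. Qed.

Lemma real_partD (z w : K) : real_part (z + w) = real_part z + real_part w.
Proof. by case: k z w => //= -[a b] [c d]. Qed.

Lemma real_partN (z : K) : real_part (- z) = - real_part z.
Proof. by case: k z => //= -[a b]. Qed.

Lemma real_partB (z w : K) : real_part (z - w) = real_part z - real_part w.
Proof. by rewrite real_partD real_partN. Qed.

Lemma real_partM (r : R) (z : K) : real_part (of_real k r * z) = r * real_part z.
Proof. by case: k z => //= -[a b] /=; rewrite mul0r subr0. Qed.

End scalars.

Lemma rnorm_complexE (R : realType) (a b : R) :
  @rnorm R ComplexScalars (scalars R ComplexScalars) (a +i* b)%C =
  Num.sqrt (a ^+ 2 + b ^+ 2).
Proof. by have := congr1 (@complex.Re R) (normc_def (a +i* b)%C). Qed.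

Section scalars_norm.
Context {R : realType} {k : scalar_kind}.
Local Notation K := (scalars R k).

Lemma rnorm_of_real (r : R) : rnorm (of_real k r) = `|r|.
Proof.
case: k => //; apply: (etrans (rnorm_complexE r 0)).
by rewrite expr0n addr0 sqrtr_sqr.
Qed.

Lemma real_part_le (z : K) : real_part z <= rnorm z.
Proof.
case: k z => /= [z|[a b]]; first exact: ler_norm.
rewrite [leRHS](rnorm_complexE a b); apply: (le_trans (ler_norm a)).
by rewrite -sqrtr_sqr ler_wsqrtr// lerDl sqr_ge0.
Qed.

Lemma phase (z : K) : exists u : K, rnorm u = 1 /\ u * z = of_real k (rnorm z).
Proof.
have [->|z0] := eqVneq z 0.
  by exists 1; rewrite mulr0 rnorm0 of_real0 -of_real1 rnorm_of_real normr1.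
have nz0 : of_real k (rnorm z) != 0 by rewrite rnormE normr_eq0.
exists (of_real k (rnorm z) / z); split; last by rewrite divfK.
apply: (can_inj (@of_realK R k)); rewrite rnormE of_real1 rnormE normrM normfV normr_id.
by rewrite divff// normr_eq0.
Qed.

Lemma rnorm_eq_of_real (z : K) (r : R) :
  real_part z = r -> rnorm z <= r -> z = of_real k r.
Proof.
move: z; case: k => [z <- _//|[a b]] /= -> {a}.
rewrite [X in X <= _ -> _](rnorm_complexE r b) => h.
have r0 : 0 <= r by apply: le_trans h; exact: sqrtr_ge0.
have : r ^+ 2 + b ^+ 2 <= r ^+ 2.
  by rewrite -(sqr_sqrtr (addr_ge0 (sqr_ge0 r) (sqr_ge0 b))) lerXn2r ?nnegrE ?sqrtr_ge0.
rewrite gerDl => b0; have /eqP : b ^+ 2 = 0 by apply/eqP; rewrite eq_le b0 sqr_ge0.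
by rewrite sqrf_eq0 => /eqP ->.
Qed.

End scalars_norm.

Section norm.
Context {R : realType} {k : scalar_kind}.
Local Notation K := (scalars R k).

Lemma rnorm1 : rnorm (1 : K) = 1.
Proof. by rewrite -of_real1 rnorm_of_real normr1. Qed.

Lemma rnorm_gt0 (V : normedZmodType K) (x : V) : (0 < rnorm x) = (x != 0).
Proof.
rewrite lt_neqAle rnorm_ge0 andbT eq_sym; congr negb; apply/eqP/eqP.
  exact: rnorm0_eq0.
by move=> ->; rewrite rnorm0.
Qed.

Lemma rnormN (V : normedZmodType K) (x : V) : rnorm (- x) = rnorm x.
Proof. by rewrite /rnorm normrN. Qed.

Lemma rnorm_distC (V : normedZmodType K) (x y : V) : rnorm (x - y) = rnorm (y - x).
Proof. by rewrite -rnormN opprB. Qed.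

Lemma ler_rnormB (V : normedZmodType K) (x y : V) :
  rnorm (x - y) <= rnorm x + rnorm y.
Proof. by rewrite -(rnormN y) ler_rnormD. Qed.

Lemma lerB_rnorm (V : normedZmodType K) (x y : V) :
  rnorm x - rnorm y <= rnorm (x - y).
Proof. by rewrite lerBlDr -{1}(subrK y x) ler_rnormD. Qed.

Lemma lerB_rnormD (V : normedZmodType K) (x y : V) :
  rnorm x - rnorm y <= rnorm (x + y).
Proof. by have := lerB_rnorm x (- y); rewrite rnormN opprK. Qed.

Lemma rnorm_sum (V : normedZmodType K) I (r : seq I) (P : pred I) (F : I -> V) :
  rnorm (\sum_(i <- r | P i) F i) <= \sum_(i <- r | P i) rnorm (F i).
Proof.
elim/big_ind2 : _ => [|x a y b xa yb|//]; first by rewrite rnorm0.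
by rewrite (le_trans (ler_rnormD _ _))// lerD.
Qed.

Lemma rnorm_scale (V : normedModType K) (r : R) (x : V) :
  rnorm (of_real k r *: x) = `|r| * rnorm x.
Proof. by rewrite rnormZ rnorm_of_real. Qed.

Lemma eq_rnorm (V W : normedZmodType K) (x : V) (y : W) :
  (`|x| = `|y| :> K) <-> (rnorm x = rnorm y).
Proof. by rewrite -!rnormE; split=> [/(can_inj (@of_realK R k))|->]. Qed.

End norm.

(** * The Hahn-Banach theorem *)

Section Hahn_Banach.
Context {R : realType} {k : scalar_kind}.
Local Notation K := (scalars R k).

Definition sublinear (V : lmodType K) (p : V -> R) :=
  (forall x y, p (x + y) <= p x + p y) /\
  (forall r x, 0 <= r -> p (of_real k r *: x) = r * p x).

Definition seminorm (V : lmodType K) (p : V -> R) :=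
  (forall x y, p (x + y) <= p x + p y) /\
  (forall (a : K) x, p (a *: x) = rnorm a * p x).

Lemma seminorm_sublinear (V : lmodType K) (p : V -> R) : seminorm p -> sublinear p.
Proof. by move=> [pD pZ]; split=> // r x r0; rewrite pZ rnorm_of_real ger0_norm. Qed.

Section minimal.
Variable V : lmodType K.
Implicit Types p q : V -> R.

Lemma sublinear0 p : sublinear p -> p 0 = 0.
Proof. by move=> [_ pZ]; rewrite -(scaler0 _ (of_real k 0)) pZ// mul0r. Qed.

Lemma sublinear_ge p x : sublinear p -> - p (- x) <= p x.
Proof.
move=> ps; have [pD _] := ps; have := pD x (- x).
by rewrite subrr sublinear0// -lerBlDr sub0r.
Qed.

(** A sublinear minorant of [p] whose value at [- y] is at most [- p y]. Minimality of [p] therefore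
    forces [p (- y) = - p y] for every [y], and an odd sublinear functional is linear. *)
Definition slant p (y : V) : V -> R :=
  fun x => inf [set p (x + of_real k t *: y) - t * p y | t in [set t | 0 <= t]].

Section slant.
Variables (p : V -> R) (y : V) (ps : sublinear p).

Lemma slant_has_inf x :
  has_inf [set p (x + of_real k t *: y) - t * p y | t in [set t | 0 <= t]].
Proof.
split; first by exists (p (x + of_real k 0 *: y) - 0 * p y), 0 => /=.
exists (- p (- x)) => _ [t /= t0 <-]; have [pD pZ] := ps.
rewrite lerBrDr -pZ// addrC -lerBrDr opprK.
by have := pD (x + of_real k t *: y) (- x); rewrite addrC addKr.
Qed.

Lemma slant_le x t : 0 <= t -> slant p y x <= p (x + of_real k t *: y) - t * p y.
Proof. by move=> t0; apply: ge_inf; [have [] := slant_has_inf x|exists t]. Qed.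

Lemma slant_leP x a : (forall t, 0 <= t -> a <= p (x + of_real k t *: y) - t * p y) ->
  a <= slant p y x.
Proof.
move=> ha; apply: lb_le_inf; first by have [] := slant_has_inf x.
by move=> _ [t /= t0 <-]; exact: ha.
Qed.

Lemma slant_le_id x : slant p y x <= p x.
Proof.
by have := slant_le x (lexx 0); rewrite of_real0 scale0r addr0 mul0r subr0.
Qed.

Lemma slantN : slant p y (- y) <= - p y.
Proof.
have := slant_le (- y) (ler01); rewrite of_real1 scale1r addNr sublinear0//.
by rewrite mul1r sub0r.
Qed.

Lemma slant_sublinear : sublinear (slant p y).
Proof.
have [pD pZ] := ps; split=> [x z|r x].
  rewrite -lerBlDr; apply: slant_leP => t t0.
  rewrite lerBlDr -lerBlDl; apply: slant_leP => s s0.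
  rewrite lerBlDr; apply: (le_trans (slant_le _ (addr_ge0 t0 s0))).
  rewrite of_realD scalerDl addrACA mulrDl.
  by have := pD (x + of_real k t *: y) (z + of_real k s *: y); lra.
rewrite le_eqVlt => /predU1P[<-|r0].
  rewrite of_real0 scale0r mul0r; apply/eqP; rewrite eq_le.
  rewrite (le_trans (slant_le_id _)) ?(sublinear0 ps)//=.
  by apply: slant_leP => t t0; rewrite add0r pZ// subrr.
apply/eqP; rewrite eq_le; apply/andP; split.
  rewrite -ler_pdivrMl//; apply: slant_leP => t t0.
  rewrite ler_pdivrMl//; apply: (le_trans (slant_le _ (mulr_ge0 (ltW r0) t0))).
  by rewrite of_realM -scalerA -scalerDr pZ ?(ltW r0)//; lra.
apply: slant_leP => t t0; rewrite -ler_pdivlMl//.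
have tr : 0 <= r^-1 * t by rewrite mulr_ge0// invr_ge0 ltW.
apply: (le_trans (slant_le _ tr)).
have -> : of_real k r *: x + of_real k t *: y =
          of_real k r *: (x + of_real k (r^-1 * t) *: y).
  by rewrite scalerDr scalerA -of_realM mulrA divff ?gt_eqF// mul1r.
rewrite pZ ?(ltW r0)//.
by rewrite mulrBr mulrA mulVf ?gt_eqF// mul1r -mulrA.
Qed.

End slant.

(** Zorn's lemma for the reversed pointwise order. A chain is bounded by its pointwise infimum,
    which is finite because every sublinear [p <= q] satisfies [- q (- x) <= p x], and sublinear
    because any two members of the chain are comparable. *)
Lemma minimal_sublinear q : sublinear q ->
  exists p, [/\ sublinear p, forall x, p x <= q x &
    forall p', sublinear p' -> (forall x, p' x <= p x) -> p' = p].
Proof.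
move=> qs; pose T := {p : V -> R | sublinear p /\ forall x, p x <= q x}.
pose Rl (p p' : T) := `[< forall x, sval p' x <= sval p x >].
have [| | | |[p [ps pq]] pmin] := @Zorn T Rl.
- by move=> t; apply/asboolP.
- move=> r s t /asboolP rs /asboolP st; apply/asboolP => x.
  exact: le_trans (st x) (rs x).
- move=> [s sP] [t tP] /asboolP st /asboolP ts; apply: eq_exist; apply/funext => x.
  by apply/eqP; rewrite eq_le; apply/andP; split; [exact: ts|exact: st].
- move=> A totA; have [[a Aa]|A0] := pselect (exists a, A a); last first.
    exists (exist _ q (conj qs (fun=> lexx _))) => s As.
    by exfalso; apply: A0; exists s.
  pose m x := inf [set sval p x | p in A].
  have hm x : has_inf [set sval p x | p in A].
    split; first by exists (sval a x), a.
    exists (- q (- x)) => _ [[p [ps pq]] _ <-] /=.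
    by apply: le_trans (sublinear_ge x ps); rewrite lerN2.
  have mle (p : T) x : A p -> m x <= sval p x.
    by move=> Ap; apply: ge_inf; [have [] := hm x|exists p].
  have lem x b : (forall p : T, A p -> b <= sval p x) -> b <= m x.
    move=> h; apply: lb_le_inf; first by have [] := hm x.
    by move=> _ [p Ap <-]; exact: h.
  have ms : sublinear m.
    split=> [x y|r x r0].
      rewrite -lerBlDr; apply: (lem _ _) => p Ap; rewrite lerBlDr -lerBlDl.
      apply: (lem _ _) => p' Ap'; rewrite lerBlDl.
      have [/asboolP h|/asboolP h] := totA _ _ Ap Ap'.
        apply: (le_trans (mle _ _ Ap')); have [[pD _] _] := svalP p'.
        by apply: (le_trans (pD _ _)); apply: lerD => //; exact: h.
      apply: (le_trans (mle _ _ Ap)); have [[pD _] _] := svalP p.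
      by apply: (le_trans (pD _ _)); apply: lerD => //; exact: h.
    apply/eqP; rewrite eq_le; apply/andP; split.
      have [r0'|rn] := eqVneq r 0.
        rewrite r0' mul0r (le_trans (mle _ _ Aa))//.
        by have [[_ aZ] _] := svalP a; rewrite aZ// mul0r.
      have rp : 0 < r by rewrite lt_neqAle eq_sym rn.
      rewrite -ler_pdivrMl//; apply: (lem _ _) => p Ap; rewrite ler_pdivrMl//.
      by apply: (le_trans (mle _ _ Ap)); have [[_ pZ] _] := svalP p; rewrite pZ.
    apply: (lem _ _) => p Ap; have [[_ ->//] _] := svalP p.
    by rewrite ler_wpM2l// mle.
  have mq x : m x <= q x by apply: (le_trans (mle _ _ Aa)); have [_] := svalP a; exact.
  by exists (exist _ m (conj ms mq)) => p Ap; apply/asboolP => x; exact: mle.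
exists p; split=> // p' p's p'p.
have p'q x : p' x <= q x by exact: le_trans (p'p x) (pq x).
have := pmin (exist _ p' (conj p's p'q)).
by move=> /(_ (introT (asboolP _) p'p)) [].
Qed.

(** Minimality is used below [slant x0 q] rather than below [q]: then [p (- x0) <= - q x0], and
    oddness of [p] gives equality at [x0]. *)
Lemma sublinear_minorant q x0 : sublinear q ->
  exists l : V -> R, [/\ forall x y, l (x + y) = l x + l y,
    forall r x, l (of_real k r *: x) = r * l x,
    forall x, l x <= q x & l x0 = q x0].
Proof.
move=> qs; have [p [ps pq pmin]] := minimal_sublinear (slant_sublinear x0 qs).
have [pD pZ] := ps.
have pN x : p (- x) = - p x.
  apply/eqP; rewrite eq_le; apply/andP; split; last first.
    by have := sublinear_ge (- x) ps; rewrite opprK.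
  rewrite -{1}(pmin _ (slant_sublinear x ps) (slant_le_id x ps)).
  exact: slantN.
have pq' x : p x <= q x by apply: le_trans (pq x) (slant_le_id _ _ _).
exists p; split=> // [x y|r x|].
- apply/eqP; rewrite eq_le pD/= -lerN2 opprD -!pN opprD; exact: pD.
- have [r0|r0] := leP 0 r; first exact: pZ.
  have rn : 0 <= - r by rewrite oppr_ge0 ltW.
  rewrite -{1}(opprK r) of_realN scaleNr pN (pZ _ _ rn).
  by rewrite mulNr opprK.
- apply/eqP; rewrite eq_le pq'/= -lerN2 -pN.
  exact: le_trans (pq _) (slantN _ _).
Qed.

End minimal.

Lemma complexify (V : lmodType K) (l : V -> R) :
  (forall x y, l (x + y) = l x + l y) ->
  (forall r x, l (of_real k r *: x) = r * l x) ->
  exists psi : V -> K^o, linear psi /\ forall x, real_part (psi x) = l x.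
Proof.
case: k V l => V l lD lZ.
  by exists l; split=> // a x y; rewrite lD lZ.
exists (fun x => (l x) +i* (- l ('i%C *: x)))%C; split=> // a x y.
case: a => a b.
have lZ' (u v : R) z : l ((u +i* v)%C *: z) = u * l z + v * l ('i%C *: z).
  have -> : ((u +i* v) = u%:C + v%:C * 'i)%C 
    by apply/eqP; rewrite eq_complex /=; apply/andP; split; apply/eqP; ring.
  by rewrite scalerDl lD lZ -scalerA lZ.
rewrite scalerDr scalerA !lD (lZ' a b).
have -> : ('i * (a +i* b) = (- b) +i* a)%C.
  by apply/eqP; rewrite eq_complex /=; apply/andP; split; apply/eqP; ring.
rewrite (lZ' (- b) a); apply/eqP; rewrite eq_complex /=; apply/andP; split; apply/eqP.
  by rewrite mulrN opprK.
by ring.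
Qed.

(** Multiplying by a phase turns [rnorm (psi x)] into a real part, which [l <= q] bounds. At [x0]
    the real part already equals the bound on the modulus, so the value is real. *)
Lemma norming (V : lmodType K) (q : V -> R) x0 : seminorm q ->
  exists psi : V -> K^o,
    [/\ linear psi, forall x, rnorm (psi x) <= q x & psi x0 = of_real k (q x0)].
Proof.
move=> qs; have [l [lD lZ lq lx0]] := sublinear_minorant x0 (seminorm_sublinear qs).
have [psi [psil psiE]] := complexify lD lZ.
have psiZ a x : psi (a *: x) = a * psi x.
  have p0 : psi 0 = 0.
    by have := psil 1 0 0; rewrite scale1r addr0 -[1 *: _]/(1 * psi 0) mul1r => /eqP;
       rewrite -subr_eq subrr eq_sym => /eqP.
  by rewrite -[LHS]/(psi (a *: x)) -(addr0 (a *: x)) psil p0 addr0.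
have pq x : rnorm (psi x) <= q x.
  have [u [u1 ux]] := phase (psi x).
  rewrite -(@of_realK R k (rnorm (psi x))) -ux -psiZ psiE (le_trans (lq _))//.
  by have [_ ->] := qs; rewrite u1 mul1r.
exists psi; split=> //; apply: rnorm_eq_of_real; last exact: pq.
by rewrite psiE.
Qed.

End Hahn_Banach.

(** * Null families along filters and limits along ultrafilters *)

Section filters.
Context {R : realType} {k : scalar_kind}.
Local Notation K := (scalars R k).

Lemma posK (e : K) : 0 < e -> exists2 r : R, 0 < r & e = of_real k r.
Proof.
move=> e0; exists (real_part e); last by rewrite ge0_real_partK// ltW.
by rewrite -(ltr_of_real (k := k)) of_real0 ge0_real_partK// ltW.
Qed.

Lemma of_real_gt0 (r : R) : (0 < of_real k r) = (0 < r).
Proof. by rewrite -(of_real0 (k := k)) ltr_of_real. Qed.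

Lemma nbhs_rnormP (V : normedModType K) (x : V) (P : set V) :
  nbhs x P <-> exists2 r : R, 0 < r & forall y, rnorm (x - y) < r -> P y.
Proof.
split=> [/nbhs_ballP[e /= e0 eP]|[r r0 rP]]; last apply/nbhs_ballP.
  have [r r0 er] := posK e0; exists r => // y yr; apply: eP.
  by rewrite -ball_normE /= er -rnormE ltr_of_real.
exists (of_real k r); first by rewrite /= of_real_gt0.
by move=> y; rewrite -ball_normE /= -rnormE ltr_of_real; exact: rP.
Qed.

Lemma filter_meet {T : Type} (F : set_system T) {FF : ProperFilter F} (P Q : set T) :
  F P -> F Q -> exists n, P n /\ Q n.
Proof. by move=> FP FQ; apply: (@filter_ex _ F FF (P `&` Q)); exact: filterI. Qed.

(** Convergence to zero phrased with the norm in [R], so that the same lemmas serve sequences and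
    ultrafilters over both scalar fields. *)
Definition to0 {T : Type} (F : set_system T) (V : normedZmodType K) (z : T -> V) :=
  forall e : R, 0 < e -> F (fun n => rnorm (z n) <= e).

Section to0.
Context {T : Type} {F : set_system T} {FF : Filter F}.

Lemma to0_le (V W : normedZmodType K) (z : T -> V) (w : T -> W) (M : R) :
  (forall n, rnorm (w n) <= M * rnorm (z n)) -> to0 F z -> to0 F w.
Proof.
move=> wz z0 e e0; have M0 : 0 < Num.max M 1 by rewrite lt_max ltr01 orbT.
have := z0 (e / Num.max M 1) (divr_gt0 e0 M0); apply: filterS => n.
rewrite ler_pdivlMr// => zn; apply: le_trans (wz n) _; apply: le_trans zn.
by rewrite mulrC ler_wpM2l ?rnorm_ge0// le_max lexx.
Qed.

Lemma to0D (V : normedZmodType K) (z w : T -> V) :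
  to0 F z -> to0 F w -> to0 F (fun n => z n + w n).
Proof.
move=> z0 w0 e e0; have e2 : 0 < e / 2 by rewrite divr_gt0.
apply: filterS2 (z0 _ e2) (w0 _ e2) => n zn wn.
by rewrite (le_trans (ler_rnormD _ _))// (splitr e) lerD.
Qed.

Lemma to0Z (V : normedModType K) (a : K) (z : T -> V) :
  to0 F z -> to0 F (fun n => a *: z n).
Proof. by apply: (@to0_le _ _ _ _ (rnorm a)) => n; rewrite rnormZ. Qed.

Lemma to0_eq (V : normedZmodType K) (z w : T -> V) :
  to0 F z -> z =1 w -> to0 F w.
Proof. by move=> z0 zw e e0; apply: filterS (z0 e e0) => n; rewrite zw. Qed.

End to0.

Lemma to0_unique {T : Type} {F : set_system T} {FF : ProperFilter F}
    (V : normedZmodType K) (z : T -> V) l l' :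
  to0 F (fun n => z n - l) -> to0 F (fun n => z n - l') -> l = l'.
Proof.
move=> zl zl'; apply/eqP; rewrite -subr_eq0; apply/eqP/rnorm0_eq0.
apply/eqP; rewrite eq_le rnorm_ge0 andbT; apply/ler_addgt0Pr => e e0.
have e2 : 0 < e / 2 by rewrite divr_gt0.
have [n [h1 h2]] := filter_meet (zl _ e2) (zl' _ e2).
have -> : l - l' = (z n - l') - (z n - l) by rewrite opprB [RHS]addrC addrA subrK.
by rewrite add0r (le_trans (ler_rnormB _ _))// (splitr e) lerD.
Qed.

Lemma to0_cvg {T : Type} {F : set_system T} {FF : Filter F}
    (V : normedModType K) (z : T -> V) l :
  to0 F (fun n => z n - l) <-> z n @[n --> F] --> l.
Proof.
split=> [zl|/cvgrPdist_le zl e e0].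
  apply/cvgrPdist_le => e /posK[r r0 ->]; apply: filterS (zl r r0) => n.
  by rewrite -rnormE ler_of_real rnorm_distC.
have := zl (of_real k e); rewrite of_real_gt0 => /(_ e0); apply: filterS => n.
by rewrite -rnormE ler_of_real rnorm_distC.
Qed.

Lemma to0_subseq (V : normedZmodType K) (z : nat -> V) (phi : nat -> nat) :
  (forall n, (n <= phi n)%N) -> to0 \oo z -> to0 \oo (z \o phi).
Proof.
move=> phin z0 e e0; have [N _ NP] := z0 e e0; exists N => // n Nn.
by apply: NP; exact: leq_trans Nn (phin n).
Qed.

End filters.

Lemma real_ultra_limit {R : realType} {T : Type} (U : set_system T) {UU : UltraFilter U}
    (z : T -> R) (M : R) : (forall n, `|z n| <= M) ->
  exists l : R, forall e, 0 < e -> U (fun n => `|z n - l| <= e).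
Proof.
move=> zM; have /(_ (z @ U) _)[|l [_ ll]] := @segment_compact R (- M) M.
  by apply: (@filterE _ U) => n; rewrite /= in_itv /= -ler_norml; exact: zM.
exists l => e e0; have [//|Uc] := in_ultra_setVsetC [set n | `|z n - l| <= e] UU.
have [||x [/= h1 h2]] := ll (~` [set x | `|x - l| <= e]) (ball l e).
- exact: Uc.
- exact: nbhsx_ballx.
by exfalso; apply: h1; move: h2; rewrite -ball_normE /= distrC => /ltW.
Qed.

Section ultra_limit.
Context {R : realType} {k : scalar_kind}.
Local Notation K := (scalars R k).

Lemma ultra_limit {T : Type} (U : set_system T) {UU : UltraFilter U}
    (z : T -> K^o) (M : R) : (forall n, rnorm (z n) <= M) ->
  exists l : K^o, to0 U (fun n => z n - l).
Proof.
rewrite /to0; case: k z => z zM.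
  by have [l h] := real_ultra_limit zM; exists l => e e0; apply: filterS (h e e0).
have zE n : rnorm (z n) =
    Num.sqrt (complex.Re (z n) ^+ 2 + complex.Im (z n) ^+ 2).
  by case: (z n) => a b; exact: rnorm_complexE.
have [|l hl] := @real_ultra_limit R T U _ (fun n => complex.Re (z n)) M.
  move=> n; apply: le_trans (zM n); rewrite zE -sqrtr_sqr ler_wsqrtr//.
  by rewrite lerDl sqr_ge0.
have [|m hm] := @real_ultra_limit R T U _ (fun n => complex.Im (z n)) M.
  move=> n; apply: le_trans (zM n); rewrite zE -sqrtr_sqr ler_wsqrtr//.
  by rewrite lerDr sqr_ge0.
exists (l +i* m)%C => e e0; have e2 : 0 < e / 2 by rewrite divr_gt0.
apply: filterS2 (hl _ e2) (hm _ e2) => n h1 h2.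
have -> : rnorm (z n - (l +i* m)%C) =
    Num.sqrt ((complex.Re (z n) - l) ^+ 2 + (complex.Im (z n) - m) ^+ 2).
  by case: (z n) => a b; exact: rnorm_complexE.
move: h1 h2; set a := complex.Re _; set b := complex.Im _ => h1 h2.
rewrite -(ger0_norm (ltW e0)) -sqrtr_sqr ler_wsqrtr//.
rewrite -(real_normK (num_real (a - l))) -(real_normK (num_real (b - m))).
by have := normr_ge0 (a - l); have := normr_ge0 (b - m); nra.
Qed.

Lemma compact_scalar_ball (M : R) : compact [set z : K^o | rnorm z <= M].
Proof.
rewrite compact_ultra => F FU FM.
(* Truncation makes the identity bounded everywhere, as [ultra_limit] requires, and changes nothing
   on the ball. *)
pose t (z : K^o) : K^o := if rnorm z <= M then z else 0.
have M0 : 0 <= M by have /filter_ex[z /(le_trans (rnorm_ge0 _))] := FM.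
have tM z : rnorm (t z) <= M by rewrite /t; case: ifPn => // _; rewrite rnorm0.
have [l hl] := ultra_limit (U := F) tM.
have Fl : to0 F (fun z : K^o => z - l).
  move=> e e0; apply: filterS2 FM (hl e e0) => z /= zM.
  by rewrite /t zM.
exists l; split=> /=; last exact/(to0_cvg id).
apply/ler_addgt0Pr => e e0.
have [z []/= h1 h2] := filter_meet FM (Fl e e0).
have -> : l = z - (z - l) by rewrite opprB addrC subrK.
by rewrite (le_trans (ler_rnormB _ _))// lerD.
Qed.

End ultra_limit.

(** * Separation and extension of functionals *)

Section Hahn_Banach_consequences.
Context {R : realType} {k : scalar_kind}.
Local Notation K := (scalars R k).

Lemma seminorm0 (V : lmodType K) (N : V -> R) : seminorm N -> N 0 = 0.
Proof. by move=> [_ NZ]; rewrite -(scale0r 0) NZ rnorm0 mul0r. Qed.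

Lemma seminormN (V : lmodType K) (N : V -> R) x : seminorm N -> N (- x) = N x.
Proof. by move=> [_ NZ]; rewrite -scaleN1r NZ rnormN rnorm1 mul1r. Qed.

Lemma seminorm_ge0 (V : lmodType K) (N : V -> R) x : seminorm N -> 0 <= N x.
Proof.
move=> Ns; have [ND _] := Ns; have := ND x (- x).
by rewrite subrr seminorm0// seminormN// -mulr2n pmulrn_lge0.
Qed.

Lemma linear_subspaceZ (V : lmodType K) (W : set V) a u :
  linear_subspace W -> W u -> W (a *: u).
Proof. by move=> [W0 WP] Wu; rewrite -(addr0 (a *: u)); exact: WP. Qed.

Lemma linear_subspaceD (V : lmodType K) (W : set V) u v :
  linear_subspace W -> W u -> W v -> W (u + v).
Proof. by move=> [W0 WP] Wu Wv; rewrite -(scale1r u); exact: WP. Qed.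

Lemma linear_subspaceN (V : lmodType K) (W : set V) u :
  linear_subspace W -> W u -> W (- u).
Proof. by move=> WW Wu; rewrite -scaleN1r; exact: linear_subspaceZ. Qed.

(** Hahn-Banach for the quotient seminorm, the distance [q] to [W], which vanishes on [W] and is at
    least [d] at [x0]. *)
Lemma separate_subspace (V : lmodType K) (N : V -> R) (W : set V) x0 (d : R) :
  seminorm N -> linear_subspace W -> (forall w, W w -> d <= N (x0 - w)) ->
  exists psi : V -> K^o, [/\ linear psi, forall x, rnorm (psi x) <= N x,
    forall w, W w -> psi w = 0 & d <= real_part (psi x0)].
Proof.
move=> Ns WW dN; have [ND NZ] := Ns; have [W0 WP] := WW.
pose q x := inf [set N (x - w) | w in W].
have hq x : has_inf [set N (x - w) | w in W].
  split; first by exists (N (x - 0)), 0.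
  by exists 0 => _ [w _ <-]; exact: seminorm_ge0.
have qle x w : W w -> q x <= N (x - w).
  by move=> Ww; apply: ge_inf; [have [] := hq x|exists w].
have leq x b : (forall w, W w -> b <= N (x - w)) -> b <= q x.
  move=> h; apply: lb_le_inf; first by have [] := hq x.
  by move=> _ [w Ww <-]; exact: h.
have qs : seminorm q.
  have qZ a x : q (a *: x) <= rnorm a * q x.
    have [->|a0] := eqVneq a 0.
      rewrite scale0r rnorm0 mul0r; apply: (le_trans (qle _ _ W0)).
      by rewrite subr0 seminorm0.
    have na : 0 < rnorm a by rewrite rnorm_gt0.
    rewrite -ler_pdivrMl//; apply: (leq _ _) => w Ww; rewrite ler_pdivrMl// -NZ.
    by rewrite scalerBr; apply: qle; exact: linear_subspaceZ.
  split=> [x y|a x].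
    rewrite -lerBlDr; apply: (leq _ _) => w Ww; rewrite lerBlDr -lerBlDl.
    apply: (leq _ _) => w' Ww'; rewrite lerBlDl.
    apply: (le_trans (qle _ _ (linear_subspaceD WW Ww Ww'))).
    by rewrite opprD addrACA.
  apply/eqP; rewrite eq_le qZ/=; have [->|a0] := eqVneq a 0.
    by rewrite rnorm0 mul0r; apply: (leq _ _) => w _; exact: seminorm_ge0.
  have na : 0 < rnorm a by rewrite rnorm_gt0.
  rewrite -ler_pdivlMl//; have := qZ a^-1 (a *: x).
  rewrite scalerA mulVf// scale1r => /le_trans; apply.
  suff -> : rnorm a^-1 = (rnorm a)^-1 by [].
  apply: (mulfI (lt0r_neq0 na)); rewrite divff ?(lt0r_neq0 na)//.
  by rewrite -rnormM divff// rnorm1.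
have [psi [pl pq px0]] := norming x0 qs.
exists psi; split=> // [x|w Ww|].
- by apply: (le_trans (pq x)); have := qle x _ W0; rewrite subr0.
- apply/rnorm0_eq0/eqP; rewrite eq_le rnorm_ge0 andbT.
  apply: (le_trans (pq w)); apply: (le_trans (qle _ _ Ww)).
  by rewrite subrr seminorm0.
- by rewrite px0 of_realK; exact: leq.
Qed.

Lemma linear_zero (V W : lmodType K) (f : V -> W) : linear f -> f 0 = 0.
Proof. by move=> lf; have := lf (-1) 0 0; rewrite scaler0 addr0 scaleN1r addNr. Qed.

Lemma linear_scale (V W : lmodType K) (f : V -> W) a x :
  linear f -> f (a *: x) = a *: f x.
Proof. by move=> lf; have := lf a x 0; rewrite (linear_zero lf) !addr0. Qed.

Lemma linear_add (V W : lmodType K) (f : V -> W) x y :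
  linear f -> f (x + y) = f x + f y.
Proof. by move=> lf; have := lf 1 x y; rewrite !scale1r. Qed.

Lemma extend_functional (W V : lmodType K) (T : W -> V) (g : W -> K^o) (N : V -> R) :
  linear T -> linear g -> seminorm N -> (forall w, rnorm (g w) <= N (T w)) ->
  exists psi : V -> K^o, [/\ linear psi, forall x, rnorm (psi x) <= N x &
    forall w, psi (T w) = g w].
Proof.
move=> lT lg Ns gN; have [ND NZ] := Ns.
(* A functional on [V * K] separating [(0, 1)] from the graph [(T w, g w)]. *)
pose N' (x : V * K^o) := N x.1 + rnorm x.2.
have N's : seminorm N'.
  split=> [x y|a x]; rewrite /N' /=.
    by have := ND x.1 y.1; have := ler_rnormD x.2 y.2; lra.
  by rewrite NZ rnormZ mulrDr.
pose G := [set (T w, g w) | w in [set: W]].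
have GS : linear_subspace G.
  split; first by exists 0 => //; rewrite (linear_zero lT) (linear_zero lg).
  move=> a _ _ [u _ <-] [v _ <-]; exists (a *: u + v) => //.
  by rewrite lT lg.
have [|psi [pl pN pG p1]] := @separate_subspace _ N' G (0, 1) 1 N's GS.
  move=> _ [w _ <-]; rewrite /N' /= sub0r seminormN//.
  rewrite (le_trans _ (lerD (gN w) (lexx _)))//.
  have := ler_rnormD (g w) (1 - g w); rewrite addrC subrK.
  by rewrite rnorm1.
have psi01 : psi (0, 1) = 1.
  rewrite -[RHS]of_real1; apply: rnorm_eq_of_real.
    apply/eqP; rewrite eq_le p1 andbT; apply: (le_trans (real_part_le _)).
    by apply: (le_trans (pN _)); rewrite /N' /= seminorm0// add0r rnorm1.
  by apply: (le_trans (pN _)); rewrite /N' /= seminorm0// add0r rnorm1.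
exists (fun x => - psi (x, 0)); split=> [a x y|x|w].
- have -> : (a *: x + y, 0) = a *: (x, 0 : K^o) + (y, 0).
    by congr pair; rewrite /= scaler0 addr0.
  by rewrite pl opprD scalerN.
- by rewrite rnormN (le_trans (pN _))// /N' /= rnorm0 addr0.
- have -> : (T w, 0) = (T w, g w) - g w *: (0, 1 : K^o).
    by congr pair; rewrite /= ?scaler0 ?subr0// -[_ *: 1]/(_ * 1) mulr1 subrr.
  rewrite -scaleNr linear_add// linear_scale// pG; last by exists w.
  by rewrite psi01 add0r -[_ *: 1]/(_ * 1) mulr1 opprK.
Qed.

End Hahn_Banach_consequences.

(** * Bounded operators and functionals *)

Section bounded_operators.
Context {R : realType} {k : scalar_kind}.
Local Notation K := (scalars R k).

Section basic.
Context {X Y : normedModType K}.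
Implicit Type f : bop X Y.

Lemma bopD f x y : f (x + y) = f x + f y. Proof. exact: linearD. Qed.
Lemma bopB f x y : f (x - y) = f x - f y. Proof. exact: linearB. Qed.
Lemma bopN f x : f (- x) = - f x. Proof. exact: linearN. Qed.
Lemma bop0 f : f 0 = 0. Proof. exact: linear0. Qed.
Lemma bopZ f a x : f (a *: x) = a *: f x. Proof. exact: linearZ. Qed.

Lemma bop_subE f g x : (f - g) x = f x - g x. Proof. by []. Qed.

Lemma rnorm_bop f : rnorm f = opnorm f.
Proof. by rewrite /rnorm bop_normE of_realK. Qed.

Lemma bop_le f x : rnorm (f x) <= rnorm f * rnorm x.
Proof. by rewrite rnorm_bop rnorm_bop_le. Qed.

Lemma bop_le_bound f x a b : rnorm f <= a -> rnorm x <= b -> rnorm (f x) <= a * b.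
Proof. by move=> fa xb; apply: (le_trans (bop_le f x)); rewrite ler_pM ?rnorm_ge0. Qed.

Lemma bop_norm_le f M : 0 <= M -> (forall x, rnorm (f x) <= M * rnorm x) -> rnorm f <= M.
Proof.
move=> M0 fM; rewrite rnorm_bop; apply: opnorm_le => x x1.
by rewrite (le_trans (fM x))// ler_piMr.
Qed.

Lemma bop_norm_le1 f M : (forall x, rnorm x <= 1 -> rnorm (f x) <= M) -> rnorm f <= M.
Proof. by move=> fM; rewrite rnorm_bop; exact: opnorm_le. Qed.

Lemma bop_norm_near f e : 0 < e -> exists x, rnorm x <= 1 /\ rnorm f - e < rnorm (f x).
Proof.
move=> e0; rewrite rnorm_bop.
have [_ [x /= x1 <-] h] := sup_adherent e0 (opnorm_has_sup f).
by exists x.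
Qed.

Definition mk_bop (f : X -> Y) (M : R) (lf : linear f)
    (fM : forall x, rnorm (f x) <= M * rnorm x) : bop X Y.
Proof.
apply: (@Bop _ _ _ _ f); apply/mem_set; split=> //.
pose F : {linear X -> Y} := HB.pack f (GRing.isLinear.Build K X Y *:%R f lf).
apply/(linear_bounded_continuous F)/linear_boundedP.
exists (of_real k M); split.
  by rewrite realE -(of_real0 (k := k)) !ler_of_real; exact: num_real.
move=> r Mr x; apply: (@le_trans _ _ (of_real k M * `|x|)).
  by rewrite -!rnormE -of_realM ler_of_real.
by rewrite ler_wpM2r// ltW.
Defined.

Lemma mk_bopE f M (lf : linear f) (fM : forall x, rnorm (f x) <= M * rnorm x) x :
  mk_bop lf fM x = f x.
Proof. by []. Qed.

End basic.

Lemma functionalZ {X : normedModType K} (f : bop X K^o) a x : f (a *: x) = a * f x.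
Proof. by rewrite bopZ. Qed.

Lemma functional_near {X : normedModType K} (f : bop X K^o) e : 0 < e ->
  exists x, [/\ rnorm x <= 1, rnorm f - e < rnorm (f x) & f x = of_real k (rnorm (f x))].
Proof.
move=> e0; have [x [x1 fx]] := bop_norm_near f e0.
have [u [u1 ux]] := phase (f x); exists (u *: x); rewrite functionalZ ux rnorm_of_real.
by rewrite rnormZ u1 mul1r ger0_norm ?rnorm_ge0.
Qed.

Lemma of_realZ {V : lmodType K} (r s : R) (x : V) :
  of_real k r *: (of_real k s *: x) = of_real k (r * s) *: x.
Proof. by rewrite scalerA of_realM. Qed.

Section composition.
Context {X Y Z : normedModType K}.

Definition bop_comp (S : bop Y Z) (T : bop X Y) : bop X Z.
Proof.
apply: (@mk_bop _ _ (fun x => S (T x)) (rnorm S * rnorm T)) => [a x y|x].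
  by rewrite bopD bopZ bopD bopZ.
by rewrite -mulrA (le_trans (bop_le _ _))// ler_wpM2l ?rnorm_ge0 ?bop_le.
Defined.

Lemma bop_compE S T x : bop_comp S T x = S (T x). Proof. by []. Qed.

Lemma rnorm_comp S T : rnorm (bop_comp S T) <= rnorm S * rnorm T.
Proof.
apply: bop_norm_le => [|x]; first by rewrite mulr_ge0 ?rnorm_ge0.
by rewrite bop_compE -mulrA (le_trans (bop_le _ _))// ler_wpM2l ?rnorm_ge0 ?bop_le.
Qed.

Lemma bop_compDl S S' T : bop_comp (S + S') T = bop_comp S T + bop_comp S' T.
Proof. exact/bopP. Qed.

Lemma bop_compBl S S' T : bop_comp (S - S') T = bop_comp S T - bop_comp S' T.
Proof. exact/bopP. Qed.

Lemma bop_compZl a S T : bop_comp (a *: S) T = a *: bop_comp S T.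
Proof. exact/bopP. Qed.

Lemma bop_compDr S T T' : bop_comp S (T + T') = bop_comp S T + bop_comp S T'.
Proof. by apply/bopP => x; rewrite !(bop_compE, bop_addE) bopD. Qed.

Lemma bop_compBr S T T' : bop_comp S (T - T') = bop_comp S T - bop_comp S T'.
Proof. by apply/bopP => x; rewrite !(bop_compE, bop_subE) bopB. Qed.

Lemma bop_compZr S a T : bop_comp S (a *: T) = a *: bop_comp S T.
Proof. by apply/bopP => x; rewrite !(bop_compE, bop_scaleE) bopZ. Qed.

End composition.

Definition bop_id (X : normedModType K) : bop X X.
Proof. by apply: (@mk_bop _ _ id 1) => // x; rewrite mul1r. Defined.

Lemma bop_idE (X : normedModType K) x : bop_id X x = x. Proof. by []. Qed.

Lemma rnorm_id (X : normedModType K) : rnorm (bop_id X) <= 1.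
Proof. by apply: bop_norm_le => // x; rewrite mul1r. Qed.

Lemma bop_comp_idr {X Y : normedModType K} (T : bop X Y) : bop_comp T (bop_id X) = T.
Proof. exact/bopP. Qed.

Lemma bop_comp_idl {X Y : normedModType K} (T : bop X Y) : bop_comp (bop_id Y) T = T.
Proof. exact/bopP. Qed.

Definition adjoint {X Y : normedModType K} (T : bop X Y) : bop (bop Y K^o) (bop X K^o).
Proof.
apply: (@mk_bop _ _ (fun f => bop_comp f T) (rnorm T)) => [a f g|f].
  by rewrite bop_compDl bop_compZl.
by rewrite mulrC rnorm_comp.
Defined.

Lemma adjointE {X Y : normedModType K} (T : bop X Y) f : adjoint T f = bop_comp f T.
Proof. by []. Qed.

Definition evaluation {X : normedModType K} (x : X) : bop (bop X K^o) K^o.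
Proof.
apply: (@mk_bop _ _ (fun f : bop X K^o => f x) (rnorm x)) => [a f g|f] //.
by rewrite mulrC bop_le.
Defined.

Lemma evaluationE {X : normedModType K} (x : X) f : evaluation x f = f x. Proof. by []. Qed.

Definition rank_one {X Y : normedModType K} (f : bop X K^o) (y : Y) : bop X Y.
Proof.
apply: (@mk_bop _ _ (fun x => (f x : K) *: y) (rnorm f * rnorm y)) => [a u v|u].
  by rewrite bopD functionalZ scalerDl scalerA.
by rewrite rnormZ mulrAC ler_wpM2r ?rnorm_ge0 ?bop_le.
Defined.

Lemma rank_oneE {X Y : normedModType K} (f : bop X K^o) (y : Y) x :
  rank_one f y x = (f x : K) *: y.
Proof. by []. Qed.

Lemma rnorm_rank_one {X Y : normedModType K} (f : bop X K^o) (y : Y) :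
  rnorm (rank_one f y) <= rnorm f * rnorm y.
Proof.
apply: bop_norm_le => [|x]; first by rewrite mulr_ge0 ?rnorm_ge0.
by rewrite rank_oneE rnormZ mulrAC ler_wpM2r ?rnorm_ge0 ?bop_le.
Qed.

Lemma seminorm_rnorm (X : normedModType K) (C : R) : 0 <= C ->
  seminorm (fun x : X => C * rnorm x).
Proof.
move=> C0; split=> [x y|a x]; first by rewrite -mulrDr ler_wpM2l// ler_rnormD.
by rewrite rnormZ mulrCA.
Qed.

Lemma norming_functional {X : normedModType K} (x : X) :
  exists f : bop X K^o, rnorm f <= 1 /\ f x = of_real k (rnorm x).
Proof.
have [psi [pl p1 px]] := norming x (seminorm_rnorm X ler01).
exists (mk_bop pl p1); split; last by rewrite -[LHS]/(psi x) px mul1r.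
exact: bop_norm_le.
Qed.

Lemma extend_bounded_functional {W : lmodType K} {X : normedModType K}
    (T : W -> X) (g : W -> K^o) (C : R) :
  0 <= C -> linear T -> linear g -> (forall w, rnorm (g w) <= C * rnorm (T w)) ->
  exists f : bop X K^o, rnorm f <= C /\ forall w, f (T w) = g w.
Proof.
move=> C0 lT lg gT.
have [psi [pl p1 px]] := extend_functional lT lg (seminorm_rnorm X C0) gT.
exists (mk_bop pl p1); split=> //.
by apply: bop_norm_le => // y; rewrite mk_bopE.
Qed.

Lemma distance_functional {X : normedModType K} (W : set X) x0 (d : R) :
  linear_subspace W -> (forall w, W w -> d <= rnorm (x0 - w)) ->
  exists f : bop X K^o, [/\ rnorm f <= 1, forall w, W w -> f w = 0 &
    d <= real_part (f x0)].
Proof.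
move=> WW dW.
have [|psi [pl p1 pW px]] := separate_subspace (x0 := x0) (d := d) (seminorm_rnorm X ler01) WW.
  by move=> w /dW; rewrite mul1r.
exists (mk_bop pl p1); split=> //.
by apply: bop_norm_le => // y; rewrite mk_bopE.
Qed.

(** Alaoglu's theorem in ultrafilter form: bounded scalars have limits at every point, and linearity
    and the norm bound pass to the limit. *)
Lemma weak_star_ultra_limit {X : normedModType K} {T : Type} (U : set_system T)
    {UU : UltraFilter U} (f : T -> bop X K^o) (M : R) :
  0 <= M -> (forall n, rnorm (f n) <= M) ->
  exists g : bop X K^o, rnorm g <= M /\ forall x, to0 U (fun n => f n x - g x).
Proof.
move=> M0 fM.
have fMx x n : rnorm (f n x) <= M * rnorm x by exact: bop_le_bound.
have [g gP] := choice (fun x => ultra_limit (U := U) (fMx x)).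
have gl : linear g.
  move=> a x y; apply: (to0_unique (gP _)).
  apply: (to0_eq (to0D (to0Z a (gP x)) (gP y))) => n.
  by rewrite bopD bopZ scalerBr opprD addrACA.
have gM x : rnorm (g x) <= M * rnorm x.
  apply/ler_addgt0Pr => e e0; have /filter_ex[n hn] := gP x e e0.
  rewrite -(subrK (f n x) (g x)) addrC (le_trans (ler_rnormD _ _))// lerD//.
  by rewrite rnorm_distC.
by exists (mk_bop gl gM); split=> //; apply: bop_norm_le.
Qed.

Lemma separable_sequence (X : normedModType K) : separable X ->
  exists a : nat -> X, forall x e, 0 < e -> exists i, rnorm (x - a i) < e.
Proof.
move=> [A cA dA].
have An : exists x0, A x0.
  by have [x [_ Ax]] := dA setT (ex_intro _ (0 : X) I) openT; exists x.
have [x0 Ax0] := An.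
have [f fA] : exists f : nat -> X, A `<=` range f.
  have /countable_injP[g gi] := cA.
  have [f fP] : {f : nat -> X & forall n x, A x -> g x = n -> A (f n) /\ g (f n) = n}.
    apply: (@choice nat X (fun n y => forall x, A x -> g x = n -> A y /\ g y = n)) => n.
    have [[x [Ax gx]]|h] := pselect (exists x, A x /\ g x = n); first by exists x.
    by exists x0 => x Ax gx; exfalso; apply: h; exists x.
  exists f => x Ax; exists (g x) => //; have [Af gf] := fP _ _ Ax erefl.
  by apply: gi => //; exact/mem_set.
exists f => x e e0.
have eK : 0 < of_real k e by rewrite of_real_gt0.
have ob : open (ball x (of_real k e)) by exact: ball_open.
have [y [xy /fA[n _ fn]]] := dA _ (ex_intro _ x (ballxx x eK)) ob; exists n.
have : ball x (of_real k e) y by exact: xy.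
by rewrite -ball_normE /= -rnormE ltr_of_real fn.
Qed.

Lemma dense_to0 {X Y : normedModType K} {T : Type} (F : set_system T) {FF : Filter F}
    (f : T -> bop X Y) (M : R) (a : nat -> X) :
  (forall n, rnorm (f n) <= M) -> (forall x e, 0 < e -> exists i, rnorm (x - a i) < e) ->
  (forall i, to0 F (fun n => f n (a i))) -> forall x, to0 F (fun n => f n x).
Proof.
move=> fM ad fa x e e0; have e2 : 0 < e / 2 by rewrite divr_gt0.
have M1 : 0 < Num.max M 1 by rewrite lt_max ltr01 orbT.
have [i hi] := ad x _ (divr_gt0 e2 M1).
apply: filterS (fa i _ e2) => n hn.
rewrite -(subrK (a i) x) bopD (le_trans (ler_rnormD _ _))// (splitr e) lerD//.
have fM' : rnorm (f n) <= Num.max M 1 by rewrite (le_trans (fM n))// le_max lexx.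
apply: (le_trans (bop_le_bound fM' (ltW hi))).
by rewrite mulrC divfK// gt_eqF.
Qed.

(** An ultrafilter finer than [\oo] provides the limit [g]; then [phi n] is an index beyond [n] at
    which [f] is close to [g] on the first [n] points of a dense sequence. The condition
    [n <= phi n] is all that later limits use. *)
Lemma weak_star_subsequence {X : normedModType K} (f : nat -> bop X K^o) (M : R) :
  separable X -> 0 <= M -> (forall n, rnorm (f n) <= M) ->
  exists (g : bop X K^o) (phi : nat -> nat), [/\ rnorm g <= M, forall n, (n <= phi n)%N &
    forall x, to0 \oo (fun n => f (phi n) x - g x)].
Proof.
move=> /separable_sequence[a ad] M0 fM.
have [U [UU oU]] := ultraFilterLemma eventually_filter.
have [g [gM gP]] := weak_star_ultra_limit (U := U) M0 fM.
have /choice[phi phiP] n : exists m, (n <= m)%N /\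
    forall i, (i < n)%N -> rnorm (f m (a i) - g (a i)) <= n.+1%:R^-1.
  have h p : U (fun m => forall i, (i < p)%N -> rnorm (f m (a i) - g (a i)) <= n.+1%:R^-1).
    elim: p => [|p IHp]; first exact: filterE.
    have n0 : 0 < n.+1%:R^-1 :> R by rewrite invr_gt0 ltr0n.
    apply: filterS2 IHp (gP (a p) _ n0) => m h1 h2 i.
    by rewrite ltnS leq_eqVlt => /predU1P[->//|]; exact: h1.
  have /oU h' : (\oo : set_system nat) (fun m => (n <= m)%N) by exists n.
  have [m [h1 h2]] := filter_meet h' (h n). by exists m; split; [exact: h1|exact: h2].
exists g, phi; split=> // [n|]; first by have [] := phiP n.
apply: (dense_to0 (f := fun n => f (phi n) - g) (M := M + M) _ ad) => [n|i e e0].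
  by rewrite (le_trans (ler_rnormB _ _))// lerD.
have [N hN] : exists N : nat, N.+1%:R^-1 <= e.
  by exists (Num.truncn e^-1); rewrite invf_ple ?posrE ?ltr0n// ltW// truncnS_gt.
exists (maxn i.+1 N) => // n /=; rewrite geq_max => /andP[ii Nn].
have [_ /(_ _ ii)/le_trans] := phiP n; apply; apply: le_trans hN.
by rewrite lef_pV2 ?posrE ?ltr0n// ler_nat.
Qed.

Lemma complete_sequence (Y : completeNormedModType K) (y : nat -> Y) :
  (forall e, 0 < e -> exists N, forall m n, (N <= m)%N -> (N <= n)%N -> rnorm (y m - y n) <= e) ->
  exists l, to0 \oo (fun n => y n - l).
Proof.
move=> cy; have /cauchy_cvg/cvg_ex[l yl] : cauchy (y @ \oo).
  apply: cauchy_exP => e /posK[r r0 ->].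
  have [N hN] := cy (r / 2) (divr_gt0 r0 (ltr0Sn _ 1)).
  exists (y N); exists N => // n Nn.
  rewrite /= -ball_normE /= -rnormE ltr_of_real (le_lt_trans (hN _ _ _ Nn))//.
  by rewrite ltr_pdivrMr// ltr_pMr// ltr1n.
by exists l; apply/to0_cvg.
Qed.

Lemma bop_complete (X : normedModType K) (Y : completeNormedModType K) (u : nat -> bop X Y) :
  (forall e, 0 < e -> exists N, forall m n, (N <= m)%N -> (N <= n)%N -> rnorm (u m - u n) <= e) ->
  exists L, to0 \oo (fun n => u n - L).
Proof.
move=> cu.
have cux x : exists l, to0 \oo (fun n => u n x - l).
  apply: complete_sequence => e e0.
  have x1 : 0 < rnorm x + 1 by rewrite ltr_wpDl// rnorm_ge0.
  have [N hN] := cu _ (divr_gt0 e0 x1); exists N => m n Nm Nn.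
  have xx : rnorm x <= rnorm x + 1 by rewrite lerDl.
  have := bop_le_bound (hN _ _ Nm Nn) xx.
  by rewrite divfK ?gt_eqF.
have [L LP] := choice cux.
have Ll : linear L.
  move=> a x y; apply: (to0_unique (LP _)).
  apply: (to0_eq (to0D (to0Z a (LP x)) (LP y))) => n.
  by rewrite bopD bopZ scalerBr opprD addrACA.
have close e : 0 < e -> exists N, forall n, (N <= n)%N ->
    forall x, rnorm (u n x - L x) <= e * rnorm x.
  move=> e0; have [N hN] := cu e e0; exists N => n Nn x.
  apply/ler_addgt0Pr => d d0; have [N' _ hN'] := LP x d d0.
  have -> : u n x - L x = (u n x - u (maxn N N') x) + (u (maxn N N') x - L x).
    by rewrite addrA subrK.
  rewrite (le_trans (ler_rnormD _ _))// lerD//; last by apply: hN'; exact: leq_maxr.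
  by have := bop_le_bound (hN _ _ Nn (leq_maxl N N')) (lexx (rnorm x)).
have [N hN] := close 1 ltr01.
have LM x : rnorm (L x) <= (1 + rnorm (u N)) * rnorm x.
  have -> : L x = - (u N x - L x) + u N x by rewrite opprB subrK.
  by rewrite mulrDl (le_trans (ler_rnormD _ _))// rnormN lerD ?hN ?bop_le.
exists (mk_bop Ll LM) => e e0; have [N' hN'] := close e e0.
by exists N' => // n /= N'n; apply: bop_norm_le; [exact: ltW|exact: hN'].
Qed.

End bounded_operators.

(* Functionals separate points, which reduces identities between vectors to
   identities between scalars. *)
Lemma vector_ext {R : realType} {k : scalar_kind} (X : normedModType (scalars R k)) (x y : X) :
  (forall f : X -> scalars R k, (forall a b, f (a + b) = f a + f b) ->
     (forall a, f (- a) = - f a) -> (forall c a, f (c *: a) = c * f a) -> f 0 = 0 ->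
     f x = f y) -> x = y.
Proof.
move=> h; apply/eqP; rewrite -subr_eq0; apply/eqP/(@rnorm0_eq0 R k).
have [f [_ fxy]] := norming_functional (x - y).
apply: (can_inj (@of_realK R k)); rewrite -fxy bopB of_real0 (h f) ?subrr//.
- exact: bopD.
- exact: bopN.
- exact: functionalZ.
- exact: bop0.
Qed.

Ltac vector :=
  apply: vector_ext;
  let f := fresh "f" in let fD := fresh "fD" in let fN := fresh "fN" in
  let fZ := fresh "fZ" in let f0 := fresh "f0" in
  intros f fD fN fZ f0;
  rewrite ?(fD, fN, fZ, f0, of_realD, of_realN, of_realM, of_real0, of_real1);
  clear fD fN fZ f0; ring.

(** * Compact operators *)

Section compact_operators.
Context {R : realType} {k : scalar_kind}.
Local Notation K := (scalars R k).

(** Total boundedness of the image of the unit ball. It passes to sums, compositions and norm limits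
    by elementary estimates; completeness enters only in the return to [compact_operators]. *)
Definition finite_nets {X Y : normedModType K} (T : X -> Y) :=
  forall e, 0 < e -> exists s : seq Y, forall x, rnorm x <= 1 ->
    exists2 y, y \in s & rnorm (T x - y) <= e.

Lemma compact_finite_nets {X Y : normedModType K} (T : bop X Y) :
  compact_operators T -> finite_nets T.
Proof.
move=> cT e e0.
have /cT : bounded_set [set x : X | rnorm x <= 1].
  exists 1; split; first exact: real1.
  move=> M M1 x /= x1; rewrite -rnormE (le_trans _ (ltW M1))//.
  by rewrite -(of_real1 (k := k)) ler_of_real.
rewrite precompactE compact_cover.
have eK : 0 < of_real k e by rewrite of_real_gt0.
move=> /(_ Y setT (fun y => ball y (of_real k e)))[||D _ hD].
- by move=> y _; exact: ball_open.
- by move=> y _; exists y => //; exact: ballxx.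
exists (finmap.enum_fset D) => x x1.
have [|y yD] := hD (T x); first by apply: subset_closure; exists x.
rewrite -ball_normE /= -rnormE ltr_of_real => h; exists y => //.
by rewrite rnorm_distC ltW.
Qed.

Lemma ultra_seq {T : choiceType} {Y : Type} (F : set_system Y) {UF : UltraFilter F}
    (s : seq T) (P : T -> set Y) :
  F (fun y => exists2 x, x \in s & P x y) -> exists2 x, x \in s & F (P x).
Proof.
elim: s => [|x s IHs] Fs.
  by have /filter_ex[y [x]] := Fs.
have [FP|FP] := in_ultra_setVsetC (P x) UF; first by exists x; rewrite ?mem_head.
have [|x' x's FP'] := IHs; last by exists x'; rewrite // inE x's orbT.
apply: filterS2 FP Fs => y Pxy [x']; rewrite inE => /predU1P[->//|x's Px'y].
by exists x'.
Qed.

(** An ultrafilter on the closure of the image contains one of the finitely many small balls that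
    cover it, at every scale, so it is Cauchy. *)
Lemma finite_nets_compact {X : normedModType K} {Y : completeNormedModType K} (T : bop X Y) :
  finite_nets T -> compact_operators T.
Proof.
move=> nT A [M0 [M0r MA]]; rewrite precompactE compact_ultra => F UF FA.
have [M M_gt0 AM] : exists2 M : R, 0 < M & forall x, A x -> rnorm x <= M.
  have [|M M0' hM] := @pinfty_ex_gt0 K (fun M => globally A [set x | `|x| <= M]).
    by exists M0; split=> // M; exact: MA.
  have [r r0 Mr] := posK M0'; exists r => // x Ax.
  by have := hM x Ax; rewrite /= Mr -rnormE ler_of_real.
have Fcau : cauchy F.
  apply: cauchy_exP => e /posK[r r0 ->].
  have r2 : 0 < r / 2 by rewrite divr_gt0.
  have [s hs] := nT (r / 2 / 2 / M) (divr_gt0 (divr_gt0 r2 (ltr0Sn _ 1)) M_gt0).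
  suff [y ys Fy] : exists2 y, y \in s & F (ball (of_real k M *: y) (of_real k r)).
    by exists (of_real k M *: y).
  apply: ultra_seq; apply: filterS FA => z cz.
  have [|_ [[x Ax <-] zx]] := cz (ball z (of_real k (r / 2))).
    by apply: nbhsx_ballx; rewrite of_real_gt0.
  have [|y ys hy] := hs (of_real k M^-1 *: x).
    rewrite rnorm_scale ger0_norm ?invr_ge0 ?(ltW M_gt0)// mulrC ler_pdivrMr// mul1r.
    exact: AM.
  exists y => //; move: zx; rewrite -!ball_normE /= -!rnormE !ltr_of_real => zx.
  have -> : of_real k M *: y - z =
      - (of_real k M *: (T (of_real k M^-1 *: x) - y)) + (T x - z).
    rewrite bopZ scalerBr of_realZ divff ?gt_eqF// of_real1 scale1r.
    by rewrite opprB addrA subrK.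
  rewrite (le_lt_trans (ler_rnormD _ _))// rnormN rnorm_scale gtr0_norm//.
  rewrite (rnorm_distC (T x)); have := ler_wpM2l (ltW M_gt0) hy.
  rewrite [X in _ <= X -> _](_ : _ = r / 2 / 2); first by lra.
  by rewrite mulrC divfK ?gt_eqF.
have /cauchy_cvg/cvg_ex[l Fl] : cauchy F by [].
exists l; split=> //.
suff : closure (closure (T @` A)) l by rewrite -(closure_id _).1//; exact: closed_closure.
move=> B lB; have FB : F B by exact: Fl.
exact: filter_ex (filterI FA FB).
Qed.

Lemma finite_nets_limit {X Y : normedModType K} (T : bop X Y) :
  (forall e, 0 < e -> exists2 S : bop X Y, finite_nets S & rnorm (T - S) <= e) ->
  finite_nets T.
Proof.
move=> h e e0; have e2 : 0 < e / 2 by rewrite divr_gt0.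
have [S nS TS] := h _ e2; have [s hs] := nS _ e2; exists s => x x1.
have [y ys hy] := hs x x1; exists y => //.
have -> : T x - y = (T - S) x + (S x - y) by rewrite bop_subE addrA subrK.
rewrite (le_trans (ler_rnormD _ _))// (splitr e) lerD//.
by have := bop_le_bound TS x1; rewrite mulr1.
Qed.

Lemma finite_netsD {X Y : normedModType K} (S T : bop X Y) :
  finite_nets S -> finite_nets T -> finite_nets (S + T).
Proof.
move=> nS nT e e0; have e2 : 0 < e / 2 by rewrite divr_gt0.
have [s hs] := nS _ e2; have [t ht] := nT _ e2.
exists [seq u + v | u <- s, v <- t] => x x1.
have [u us hu] := hs x x1; have [v vt hv] := ht x x1.
exists (u + v); first exact: allpairs_f.
by rewrite bop_addE opprD addrACA (le_trans (ler_rnormD _ _))// (splitr e) lerD.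
Qed.

Lemma finite_netsZ {X Y : normedModType K} a (T : bop X Y) :
  finite_nets T -> finite_nets (a *: T).
Proof.
move=> nT e e0; have a1 : 0 < rnorm a + 1 by rewrite ltr_wpDl// rnorm_ge0.
have [s hs] := nT _ (divr_gt0 e0 a1).
exists [seq a *: u | u <- s] => x x1; have [u us hu] := hs x x1.
exists (a *: u); first exact: map_f.
rewrite bop_scaleE -scalerBr rnormZ.
apply: (@le_trans _ _ ((rnorm a + 1) * (e / (rnorm a + 1)))).
  by rewrite ler_pM ?rnorm_ge0// lerDl.
by rewrite mulrC divfK ?gt_eqF.
Qed.

Lemma finite_nets0 {X Y : normedModType K} : finite_nets (0 : bop X Y).
Proof. by move=> e e0; exists [:: 0] => x _; exists 0; rewrite ?mem_head// subrr rnorm0 ltW. Qed.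

Lemma finite_nets_compr {X Y Z : normedModType K} (S : bop Y Z) (T : bop X Y) :
  finite_nets S -> finite_nets (bop_comp S T).
Proof.
move=> nS e e0; have T1 : 0 < rnorm T + 1 by rewrite ltr_wpDl// rnorm_ge0.
have [s hs] := nS _ (divr_gt0 e0 T1).
exists [seq of_real k (rnorm T + 1) *: u | u <- s] => x x1.
have [|u us hu] := hs (of_real k (rnorm T + 1)^-1 *: T x).
  rewrite rnorm_scale gtr0_norm ?invr_gt0// mulrC ler_pdivrMr// mul1r.
  have TT : rnorm T <= rnorm T + 1 by rewrite lerDl.
  by have := bop_le_bound TT x1; rewrite mulr1.
exists (of_real k (rnorm T + 1) *: u); first exact: map_f.
have -> : bop_comp S T x - of_real k (rnorm T + 1) *: u =
    of_real k (rnorm T + 1) *: (S (of_real k (rnorm T + 1)^-1 *: T x) - u).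
  by rewrite bopZ scalerBr of_realZ divff ?gt_eqF// of_real1 scale1r.
by rewrite rnorm_scale gtr0_norm// mulrC -ler_pdivlMr.
Qed.

(** A bounded set is mapped into the image of a scalar ball under the continuous map
    [z |-> z *: y]. *)
Lemma rank_one_compact {X Y : normedModType K} (f : bop X K^o) (y : Y) :
  compact_operators (rank_one f y).
Proof.
move=> A [M0 [M0r MA]].
have [M M_gt0 AM] : exists2 M : R, 0 < M & forall x, A x -> rnorm x <= M.
  have [|M M0' hM] := @pinfty_ex_gt0 K (fun M => globally A [set x | `|x| <= M]).
    by exists M0; split=> // M; exact: MA.
  have [r r0 Mr] := posK M0'; exists r => // x Ax.
  by have := hM x Ax; rewrite /= Mr -rnormE ler_of_real.
pose g (z : K^o) : Y := (z : K) *: y.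
have cg : compact (g @` [set z : K^o | rnorm z <= rnorm f * M]).
  apply: continuous_compact; last exact: compact_scalar_ball.
  have gl : linear g by move=> a u v; rewrite /g scalerDl scalerA.
  have gM z : rnorm (g z) <= rnorm y * rnorm z by rewrite /g rnormZ mulrC.
  have gc : continuous g 
    by exact: (@bop_continuous R k (K^o : normedModType K) Y
      (@mk_bop R k (K^o : normedModType K) Y g _ gl gM)).
  exact: continuous_subspaceT.
exists (g @` [set z : K^o | rnorm z <= rnorm f * M]).
  by move=> _ [x Ax <-]; exists (f x) => //=; rewrite bop_le_bound// AM.
by split=> //; apply: compact_closed => //; exact: norm_hausdorff.
Qed.

Lemma compact_operators_subspace (X : normedModType K) (Y : completeNormedModType K) :
  linear_subspace (@compact_operators R k X Y).
Proof.
split=> [|a S T cS cT]; first exact/finite_nets_compact/finite_nets0.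
apply: finite_nets_compact; apply: finite_netsD; last exact: compact_finite_nets.
by apply: finite_netsZ; exact: compact_finite_nets.
Qed.

Lemma compact_operators_closed (X : normedModType K) (Y : completeNormedModType K) :
  closed (@compact_operators R k X Y).
Proof.
move=> T clT; apply: finite_nets_compact; apply: finite_nets_limit => e e0.
have [|S [cS TS]] := clT (ball T (of_real k e)).
  by apply: nbhsx_ballx; rewrite of_real_gt0.
exists S; first exact: compact_finite_nets.
by move: TS; rewrite -ball_normE /= -rnormE ltr_of_real => /ltW.
Qed.

(** Norming functionals at the finitely many points of a net are eventually small on [T (x n)]. The
    net point near [T (x n)] then has small norm, and so does [T (x n)]. *)
Lemma finite_nets_weakly_null {X Y : normedModType K} {I : Type} (F : set_system I)
    {FF : Filter F} (T : bop X Y) (x : I -> X) (M : R) :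
  finite_nets T -> (forall n, rnorm (x n) <= M) ->
  (forall f : bop X K^o, to0 F (fun n => f (x n))) -> to0 F (fun n => T (x n)).
Proof.
move=> nT xM wx e e0; have M1 : 0 < Num.max M 1 by rewrite lt_max ltr01 orbT.
have e4 : 0 < e / 4 by rewrite divr_gt0.
have [s hs] := nT _ (divr_gt0 e4 M1).
have net n : exists2 y, y \in s & rnorm (T (x n) - of_real k (Num.max M 1) *: y) <= e / 4.
  have [|y ys hy] := hs (of_real k (Num.max M 1)^-1 *: x n).
    rewrite rnorm_scale gtr0_norm ?invr_gt0// mulrC ler_pdivrMr// mul1r.
    by rewrite (le_trans (xM n))// le_max lexx.
  exists y => //; rewrite ler_pdivlMr// mulrC in hy.
  have -> : T (x n) - of_real k (Num.max M 1) *: y =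
      of_real k (Num.max M 1) *: (T (of_real k (Num.max M 1)^-1 *: x n) - y).
    by rewrite bopZ scalerBr of_realZ divff ?gt_eqF// of_real1 scale1r.
  by rewrite rnorm_scale gtr0_norm.
have small : F (fun n => forall y, y \in s -> exists f : bop Y K^o,
    [/\ rnorm f <= 1,
      f (of_real k (Num.max M 1) *: y) = of_real k (rnorm (of_real k (Num.max M 1) *: y))
      & rnorm (f (T (x n))) <= e / 4]).
  elim: s {hs net} => [|y s IHs]; first by apply: filterE.
  have [f [f1 fy]] := norming_functional (of_real k (Num.max M 1) *: y).
  apply: filterS2 IHs (wx (bop_comp f T) _ e4) => n h1 h2 y'.
  rewrite inE => /predU1P[->|/h1//]; by exists f.
apply: filterS small => n h; have [y ys hy] := net n; have [f [f1 fy fT]] := h y ys.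
set z := of_real k (Num.max M 1) *: y in hy fy *.
have : rnorm z <= rnorm (f (T (x n))) + rnorm (f (T (x n) - z)).
  have -> : rnorm z = rnorm (f z) by rewrite fy rnorm_of_real ger0_norm ?rnorm_ge0.
  have -> : f z = f (T (x n)) - f (T (x n) - z) by rewrite bopB opprB addrC subrK.
  exact: ler_rnormB.
have := bop_le_bound f1 hy; have := ler_rnormD (T (x n) - z) z.
by rewrite subrK; lra.
Qed.

(** Pointwise convergence of a bounded family is uniform on totally bounded sets. *)
Lemma to0_comp_finite_nets {X Y Z : normedModType K} {I : Type} (F : set_system I)
    {FF : Filter F} (T : bop X Y) (f : I -> bop Y Z) (M : R) :
  finite_nets T -> (forall n, rnorm (f n) <= M) ->
  (forall y, to0 F (fun n => f n y)) -> to0 F (fun n => bop_comp (f n) T).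
Proof.
move=> nT fM wf e e0; have M1 : 0 < Num.max M 1 by rewrite lt_max ltr01 orbT.
have e2 : 0 < e / 2 by rewrite divr_gt0.
have [s hs] := nT _ (divr_gt0 e2 M1).
have small : F (fun n => forall y, y \in s -> rnorm (f n y) <= e / 2).
  elim: s {hs} => [|y s IHs]; first by apply: filterE.
  apply: filterS2 IHs (wf y _ e2) => n h1 h2 y'.
  by rewrite inE => /predU1P[->|/h1].
apply: filterS small => n h; apply: bop_norm_le1 => x x1.
have [y ys hy] := hs x x1; rewrite bop_compE -(subrK y (T x)) bopD.
rewrite (le_trans (ler_rnormD _ _))// (splitr e) lerD//; last exact: h.
have fM1 : rnorm (f n) <= Num.max M 1 by rewrite (le_trans (fM n))// le_max lexx.
by have := bop_le_bound fM1 hy; rewrite [Num.max _ _ * _]mulrC divfK ?gt_eqF.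
Qed.

End compact_operators.

(** * Property (M) and its dual *)

(** A bound on the limsup as an eventual inequality in [R]; extended reals then occur only in the
    translation of [property_M]. *)
Definition limsup_le {R : realType} (s : nat -> R) (a : R) :=
  forall e, 0 < e -> (\oo : set_system nat) (fun n => s n <= a + e).

Section limsup.
Context {R : realType}.
Local Open Scope ereal_scope.

Lemma limsup_leP (s : nat -> R) (a : R) :
  limsup_le s a <-> limn_esup (fun n => (s n)%:E) <= a%:E.
Proof.
split=> [sa|sa e e0].
  apply/lee_addgt0Pr => e e0.
  apply: (@le_trans _ _ (ereal_sup [set (s n)%:E | n in [set n | (s n <= a + e)%R]])).
    by apply: ereal_inf_lbound; exists [set n | (s n <= a + e)%R] => //; exact: sa.
  by apply: ge_ereal_sup => _ [n /= h <-]; rewrite -EFinD lee_fin.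
have : limn_esup (fun n => (s n)%:E) < (a + e)%:E.
  by rewrite (le_lt_trans sa)// lte_fin ltrDl.
rewrite /limn_esup limf_esupE => /ereal_inf_lt[_ [V VF <-]] h.
apply: filterS VF => n Vn; rewrite -lee_fin; apply: le_trans (ltW h).
by apply: ereal_sup_ubound; exists n.
Qed.

Lemma le_limn_esup (s t : nat -> R) :
  (forall a, limsup_le t a -> limsup_le s a) ->
  limn_esup (fun n => (s n)%:E) <= limn_esup (fun n => (t n)%:E).
Proof.
move=> h; case E : (limn_esup (fun n => (t n)%:E)) => [r| |].
- by apply/limsup_leP/h/limsup_leP; rewrite E.
- exact: leey.
- have sA A : limn_esup (fun n => (s n)%:E) <= A%:E.
    by apply/limsup_leP/h/limsup_leP; rewrite E leNye.
  case E' : (limn_esup (fun n => (s n)%:E)) sA => [r| |] sA //.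
    by have := sA (r - 1)%R; rewrite lee_fin lerBrDr -lerBrDl subrr ler10.
  by have := sA 0%R; rewrite leye_eq.
Qed.

End limsup.

Section property_M.
Context {R : realType} {k : scalar_kind}.
Local Notation K := (scalars R k).

Definition weak_null {X : normedModType K} (x : nat -> X) :=
  forall f : bop X K^o, to0 \oo (fun n => f (x n)).

Definition weak_star_null {X : normedModType K} (w : nat -> bop X K^o) :=
  forall x : X, to0 \oo (fun n => w n x).

Lemma weak_nullP {X : normedModType K} (x : nat -> X) : weakly_null x <-> weak_null x.
Proof.
split=> h f; last by apply/to0_cvg; apply: to0_eq (h f) _ => n; rewrite subr0.
by have /to0_cvg/to0_eq := h f; apply => n; rewrite subr0.
Qed.

Definition monotone_M (X : normedModType K) :=
  forall (u v : X) (x : nat -> X) (a : R), rnorm u <= rnorm v -> weak_null x ->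
    limsup_le (fun n => rnorm (v + x n)) a -> limsup_le (fun n => rnorm (u + x n)) a.

Definition monotone_M_star (X : normedModType K) :=
  forall (g h : bop X K^o) (w : nat -> bop X K^o) (M a : R), rnorm g <= rnorm h ->
    weak_star_null w -> (forall n, rnorm (w n) <= M) ->
    limsup_le (fun n => rnorm (h + w n)) a -> limsup_le (fun n => rnorm (g + w n)) a.

(* Convexity turns the equality for vectors of equal norm into monotonicity, since
   a contraction of [v] is a convex combination of [v] and [- v]. *)
Lemma property_M_monotone (X : normedModType K) : property_M X <-> monotone_M X.
Proof.
split=> [hM u v x a uv wx va|hM u v x uv /weak_nullP wx]; last first.
  have uv' : rnorm u = rnorm v by apply/eq_rnorm.
  by apply/eqP; rewrite eq_le; apply/andP; split; apply: le_limn_esup => a;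
    apply: hM => //; rewrite uv'.
have eqM y : rnorm y = rnorm v -> limsup_le (fun n => rnorm (y + x n)) a.
  move=> /eq_rnorm yv; apply/limsup_leP; rewrite (hM y v x yv); last exact/weak_nullP.
  exact/limsup_leP.
have [v0|v0] := eqVneq (rnorm v) 0.
  by apply: eqM; apply/eqP; rewrite eq_le uv v0 rnorm_ge0.
have vp : 0 < rnorm v by rewrite lt_neqAle eq_sym v0 rnorm_ge0.
pose t := rnorm u / rnorm v.
have t0 : 0 <= t by rewrite divr_ge0 ?rnorm_ge0.
have t1 : t <= 1 by rewrite ler_pdivrMr// mul1r.
have tv : rnorm (of_real k t *: v) = rnorm u.
  by rewrite rnorm_scale ger0_norm// divfK.
suff h : limsup_le (fun n => rnorm (of_real k t *: v + x n)) a.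
  apply/limsup_leP; rewrite (hM u (of_real k t *: v) x); last exact/weak_nullP.
    exact/limsup_leP.
  exact/eq_rnorm.
move=> e e0; have nv : rnorm (- v) = rnorm v by rewrite rnormN.
apply: filterS2 (va e e0) (eqM _ nv e e0) => n h1 h2.
have -> : of_real k t *: v + x n = of_real k ((1 + t) / 2) *: (v + x n) +
    of_real k ((1 - t) / 2) *: (- v + x n).
  rewrite !scalerDr addrACA scalerN -scalerBl -scalerDl.
  rewrite -of_realN -!of_realD (_ : (1 + t) / 2 - (1 - t) / 2 = t); last by field.
  by rewrite (_ : (1 + t) / 2 + (1 - t) / 2 = 1) ?of_real1 ?scale1r//; field.
rewrite (le_trans (ler_rnormD _ _))// !rnorm_scale !ger0_norm; [|lra..].
nra.
Qed.

(** Let [z] in the unit ball nearly norm [F]. By (M* ) the vectors [rnorm f *: z + w n] have norm at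
    most about [rnorm f], while [F] already takes almost the value [rnorm F * rnorm f] at
    [rnorm f *: z]; nothing is left for [F (w n)]. Multiples of [F] turn this one-sided bound into
    weak convergence. *)
Lemma weak_star_weak_cvg (X : normedModType K) : monotone_M_star X ->
  forall (f : bop X K^o) (w : nat -> bop X K^o) (M : R), weak_star_null w ->
  (forall n, rnorm (w n) <= M) -> limsup_le (fun n => rnorm (f + w n)) (rnorm f) ->
  forall (F : bop (bop X K^o) K^o) e, 0 < e ->
  (\oo : set_system nat) (fun n => real_part (F (w n)) <= e).
Proof.
move=> hM f w M w0 wM fw F e e0.
have f1 : 0 < rnorm f + 1 by rewrite ltr_wpDl// rnorm_ge0.
have F1 : 0 < rnorm F + 1 by rewrite ltr_wpDl// rnorm_ge0.
have [z [z1 Fz zE]] := functional_near F (divr_gt0 (divr_gt0 e0 (ltr0Sn _ 1)) f1).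
have zf : rnorm (of_real k (rnorm f) *: z) <= rnorm f.
  by rewrite rnorm_scale ger0_norm ?rnorm_ge0// ler_piMr ?rnorm_ge0.
apply: filterS (hM _ _ _ _ _ zf w0 wM fw _ (divr_gt0 (divr_gt0 e0 (ltr0Sn _ 1)) F1)) => n h.
have := le_trans (real_part_le _) (bop_le_bound (lexx (rnorm F)) h).
rewrite bopD real_partD functionalZ real_partM zE of_realK.
set d := e / 2 / (rnorm f + 1) in Fz; set d' := e / 2 / (rnorm F + 1).
have hd : d * (rnorm f + 1) = e / 2 by rewrite divfK ?gt_eqF.
have hd' : d' * (rnorm F + 1) = e / 2 by rewrite divfK ?gt_eqF.
have d0 : 0 < d by rewrite divr_gt0// divr_gt0.
have d'0 : 0 < d' by rewrite divr_gt0// divr_gt0.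
have f0 : 0 <= rnorm f by exact: rnorm_ge0.
have := ler_wpM2l f0 (ltW Fz); nra.
Qed.

Lemma finite_nets_weak_null {X Y : normedModType K} (T : bop X Y) (x : nat -> X) (M : R) :
  finite_nets T -> (\oo : set_system nat) (fun n => rnorm (x n) <= M) -> weak_null x ->
  to0 \oo (fun n => T (x n)).
Proof.
move=> nT xM wx e e0.
pose y n := if rnorm (x n) <= M then x n else 0.
have [M0|M0] := leP 0 M; last first.
  apply: filterS xM => n h; exfalso.
  by have := rnorm_ge0 (x n); lra.
have yM n : rnorm (y n) <= M by rewrite /y; case: ifPn => // _; rewrite rnorm0.
have wy (f : bop X K^o) : to0 \oo (fun n => f (y n)).
  apply: (to0_le (M := 1) _ (wx f)) => n.
  by rewrite mul1r /y; case: ifP => // _; rewrite bop0 rnorm0 rnorm_ge0.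
apply: filterS2 xM (finite_nets_weakly_null nT yM wy e0) => n h.
by rewrite /y h.
Qed.

End property_M.

(** * Consequences of the M-ideal property *)

Section M_ideal_consequences.
Context {R : realType} {k : scalar_kind}.
Local Notation K := (scalars R k).
Variable X : completeNormedModType K.
Local Notation E := (bop X X).
Variable V : set (bop E K^o).
Hypothesis V0 : V 0.
Hypothesis VP : forall (a : K) (f g : bop E K^o), V f -> V g -> V (a *: f + g).
Hypothesis Vdec : forall f : bop E K^o, exists j v : bop E K^o,
  [/\ forall S, compact_operators S -> j S = 0, V v & f = j + v].
Hypothesis Vnorm : forall j v : bop E K^o, (forall S, compact_operators S -> j S = 0) ->
  V v -> rnorm (j + v) = rnorm j + rnorm v.

Definition postcompose (f : bop X K^o) : bop E (bop X K^o).
Proof.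
apply: (@mk_bop _ _ _ _ (fun T => bop_comp f T) (rnorm f)) => [a S T|T].
  by rewrite bop_compDr bop_compZr.
exact: rnorm_comp.
Defined.

Lemma postcomposeE f T : postcompose f T = bop_comp f T. Proof. by []. Qed.

Lemma VD f g : V f -> V g -> V (f + g).
Proof. by move=> Vf Vg; rewrite -(scale1r f); exact: VP. Qed.

(* Rank-one operators already compute the norm of [T |-> F (T^* f)], so its
   component in the annihilator of the compact operators vanishes. *)
Lemma V_tensor (F : bop (bop X K^o) K^o) (f : bop X K^o) : V (bop_comp F (postcompose f)).
Proof.
set phi := bop_comp F (postcompose f).
have [j [v [j0 Vv phiE]]] := Vdec phi.
suff j_0 : j = 0 by rewrite phiE j_0 add0r.
apply/rnorm0_eq0/eqP; rewrite eq_le rnorm_ge0 andbT.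
have phile : rnorm phi <= rnorm F * rnorm f.
  apply: bop_norm_le => [|T]; first by rewrite mulr_ge0 ?rnorm_ge0.
  rewrite bop_compE -mulrA bop_le_bound// postcomposeE; exact: rnorm_comp.
have vge : rnorm F * rnorm f <= rnorm v.
  apply/ler_addgt0Pr => e e0.
  have f1 : 0 < rnorm f + 1 by rewrite ltr_wpDl// rnorm_ge0.
  have F1 : 0 < rnorm F + 1 by rewrite ltr_wpDl// rnorm_ge0.
  have [g [g1 Fg gE]] := functional_near F (divr_gt0 (divr_gt0 e0 (ltr0Sn _ 1)) f1).
  have [x [x1 fx xE]] := functional_near f (divr_gt0 (divr_gt0 e0 (ltr0Sn _ 1)) F1).
  have : rnorm (v (rank_one g x)) <= rnorm v * 1.
    apply: bop_le_bound => //; apply: (le_trans (rnorm_rank_one _ _)).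
    by rewrite mulr_ile1 ?rnorm_ge0.
  have -> : v (rank_one g x) = phi (rank_one g x).
    by rewrite phiE bop_addE (j0 _ (rank_one_compact _ _)) add0r.
  have -> : phi (rank_one g x) = f x * F g.
    rewrite /phi bop_compE postcomposeE.
    have -> : bop_comp f (rank_one g x) = (f x : K) *: g.
      by apply/bopP => y; rewrite bop_compE rank_oneE functionalZ bop_scaleE mulrC.
    by rewrite functionalZ.
  rewrite rnormM mulr1.
  set d := e / 2 / (rnorm f + 1) in Fg; set d' := e / 2 / (rnorm F + 1) in fx.
  have hd : d * (rnorm f + 1) = e / 2 by rewrite divfK ?gt_eqF.
  have hd' : d' * (rnorm F + 1) = e / 2 by rewrite divfK ?gt_eqF.
  have d0 : 0 < d by rewrite divr_gt0// divr_gt0.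
  have d'0 : 0 < d' by rewrite divr_gt0// divr_gt0.
  have : rnorm (f x) <= rnorm f * 1 by exact: bop_le_bound.
  have : rnorm (F g) <= rnorm F * 1 by exact: bop_le_bound.
  rewrite !mulr1 => h1 h2 h3.
  have : rnorm F * rnorm f - rnorm (f x) * rnorm (F g) =
    rnorm F * (rnorm f - rnorm (f x)) + rnorm (f x) * (rnorm F - rnorm (F g)) by ring.
  have := rnorm_ge0 f; have := rnorm_ge0 F; have := rnorm_ge0 (f x).
  move=> p1 p2 p3 id1.
  have q1 : rnorm F * (rnorm f - rnorm (f x)) <= rnorm F * d' by rewrite ler_wpM2l//; lra.
  have q2 : rnorm (f x) * (rnorm F - rnorm (F g)) <= rnorm f * d by rewrite ler_pM//; lra.
  lra.
have := Vnorm j0 Vv; rewrite -phiE; lra.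
Qed.

(** In the Hahn-Banach argument below such a seminorm measures how far a compact operator is from
    the identity, while it forces the second component of the separating functional into [V]. That
    component is only known to be linear and dominated, hence the passage from [psi] to a bounded
    [phi]. *)
Definition V_dominating (p : E -> R) := seminorm p /\
  forall psi : E -> K^o, linear psi -> (forall T, rnorm (psi T) <= p T) ->
    exists2 phi : bop E K^o, V phi & forall T, phi T = psi T.

(** A functional dominated by [C * rnorm (T x)] depends on [T x] only, so it is [g (T x)] for a
    bounded [g], read off from rank-one operators that send [x] to a given vector. [V_tensor] covers
    functionals of this form. *)
Lemma V_dominating_point (C : R) (x : X) : 0 <= C ->
  V_dominating (fun T => C * rnorm (T x)).
Proof.
move=> C0; split=> [|psi lpsi psiC].
  split=> [S T|a T]; first by rewrite -mulrDr ler_wpM2l// bop_addE ler_rnormD.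
  by rewrite bop_scaleE rnormZ mulrCA.
have psi0 (T : E) : T x = 0 -> psi T = 0.
  move=> Tx; apply/rnorm0_eq0/eqP; rewrite eq_le rnorm_ge0 andbT.
  by rewrite (le_trans (psiC T))// Tx rnorm0 mulr0.
have [x0|x0] := eqVneq x 0.
  by exists 0 => // T; rewrite psi0// x0 bop0.
have [f [_ fx]] := norming_functional x.
have nx : of_real k (rnorm x) != 0 by rewrite rnormE normr_eq0.
pose f1 : bop X K^o := (of_real k (rnorm x))^-1 *: f.
have f1x : f1 x = 1 by rewrite bop_scaleE fx -[_ *: _]/(_ * _) mulVf.
pose g (y : X) : K^o := psi (rank_one f1 y).
have gl : linear g.
  move=> a y z; rewrite /g -lpsi; congr psi; apply/bopP => w.
  by rewrite bop_addE bop_scaleE !rank_oneE scalerDr !scalerA mulrC.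
have gC y : rnorm (g y) <= C * rnorm y.
  by rewrite (le_trans (psiC _))// rank_oneE f1x scale1r.
exists (bop_comp (evaluation x) (postcompose (mk_bop gl gC))); first exact: V_tensor.
move=> T; rewrite bop_compE evaluationE postcomposeE bop_compE -[LHS]/(g (T x)) /g.
apply/eqP; rewrite -subr_eq0; apply/eqP.
have := lpsi (-1) T (rank_one f1 (T x)); rewrite scaleN1r [_ *: psi _]scaleN1r addrC => h.
rewrite -h psi0// bop_addE.
rewrite -[(- T) x]/(- T x) rank_oneE f1x scale1r addNr//.
Qed.

(** The same argument for adjoints: the functional is [G (bop_comp f T)] with [G] in the bidual, and
    [rank_one g x0] with [f x0 = 1] realizes any prescribed value [g] of [bop_comp f T]. *)
Lemma V_dominating_functional (C : R) (f : bop X K^o) : 0 <= C ->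
  V_dominating (fun T => C * rnorm (bop_comp f T)).
Proof.
move=> C0; split=> [|psi lpsi psiC].
  split=> [S T|a T]; first by rewrite -mulrDr ler_wpM2l// bop_compDr ler_rnormD.
  by rewrite bop_compZr rnormZ mulrCA.
have psi0 T : bop_comp f T = 0 -> psi T = 0.
  move=> Tx; apply/rnorm0_eq0/eqP; rewrite eq_le rnorm_ge0 andbT.
  by rewrite (le_trans (psiC T))// Tx rnorm0 mulr0.
have [[x fx]|f0] := pselect (exists x, f x != 0).
  pose x0 : X := (f x : K)^-1 *: x.
  have fx0 : f x0 = 1 by rewrite functionalZ mulVf.
  have fr g : bop_comp f (rank_one g x0) = g.
    by apply/bopP => y; rewrite bop_compE rank_oneE functionalZ fx0 mulr1.
  pose G (g : bop X K^o) : K^o := psi (rank_one g x0).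
  have Gl : linear G.
    move=> a y z; rewrite /G -lpsi; congr psi; apply/bopP => w.
    rewrite -[LHS]/(((a * y w + z w) : K) *: x0).
    rewrite -[RHS]/(a *: ((y w : K) *: x0) + (z w : K) *: x0).
    by rewrite scalerDl; congr (_ + _); rewrite (scalerA a (y w : K)).
  have GC y : rnorm (G y) <= C * rnorm y by rewrite (le_trans (psiC _))// fr.
  exists (bop_comp (mk_bop Gl GC) (postcompose f)); first exact: V_tensor.
  move=> T; rewrite bop_compE postcomposeE -[LHS]/(G (bop_comp f T)) /G.
  apply/eqP; rewrite -subr_eq0; apply/eqP.
  have := lpsi (-1) T (rank_one (bop_comp f T) x0).
  rewrite scaleN1r [_ *: psi _]scaleN1r addrC => h.
  by rewrite -h psi0// bop_compDr fr -scaleN1r bop_compZr scaleN1r addNr.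
have f_0 : f = 0.
  by apply/bopP => x; apply/eqP/negPn/negP => fx; apply: f0; exists x.
by exists 0 => // T; rewrite psi0// f_0; apply/bopP.
Qed.

(** A functional dominated by [p + q] extends from the diagonal to [E * E], dominated by
    [p A.1 + q A.2]. Its restrictions to the two factors are dominated by [p] and by [q], and they
    add up to it on the diagonal. *)
Lemma V_dominatingD p q : V_dominating p -> V_dominating q ->
  V_dominating (fun T => p T + q T).
Proof.
move=> [[pD pZ] Vp] [[qD qZ] Vq]; split=> [|psi lpsi psiC].
  split=> [S T|a T]; first by have := pD S T; have := qD S T; lra.
  by rewrite pZ qZ mulrDr.
pose N (A : E * E) := p A.1 + q A.2.
have Ns : seminorm N.
  split=> [S T|a T]; first by have := pD S.1 T.1; have := qD S.2 T.2; rewrite /N/=; lra.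
  by rewrite /N/= pZ qZ mulrDr.
have dl : linear (fun T : E => (T, T)) by [].
have [Psi [Pl PN PE]] := extend_functional dl lpsi Ns psiC.
have p0 : p 0 = 0 by apply: seminorm0.
have q0 : q 0 = 0 by apply: seminorm0.
have [||f Vf fE] := Vp (fun T => Psi (T, 0)).
- move=> a S T; rewrite -Pl; congr Psi.
  by congr pair; rewrite /= scaler0 addr0.
- by move=> T; rewrite (le_trans (PN _))// /N/= q0 addr0.
have [||g Vg gE] := Vq (fun T => Psi (0, T)).
- move=> a S T; rewrite -Pl; congr Psi.
  by congr pair; rewrite /= scaler0 addr0.
- by move=> T; rewrite (le_trans (PN _))// /N/= p0 add0r.
exists (f + g); first exact: VD.
move=> T; rewrite bop_addE fE gE -linear_add// -PE; congr Psi.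
by congr pair; rewrite /= ?addr0 ?add0r.
Qed.

Lemma V_dominating_points (C : R) (a : nat -> X) n : 0 <= C ->
  V_dominating (fun T => \sum_(i < n) C * rnorm (T (a i))).
Proof.
move=> C0; elim: n => [|n IHn].
  split=> [|psi lpsi psi0].
    by split=> [S T|b T]; rewrite !big_ord0 ?addr0 ?mulr0.
  exists 0 => // T; apply/esym/rnorm0_eq0/eqP; rewrite eq_le rnorm_ge0 andbT.
  by have := psi0 T; rewrite big_ord0.
rewrite (_ : (fun T : E => _) =
   fun T => (\sum_(i < n) C * rnorm (T (a i))) + C * rnorm (T (a n))).
  by apply: V_dominatingD => //; exact: V_dominating_point.
by apply/funext => T; rewrite big_ord_recr.
Qed.

(* Hahn-Banach in [E * E] with the norm [|A| + p B]: a functional vanishing on the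
   diagonal of the compact operators is [(j - v, v)] with [v] in [V] and [j] in the
   annihilator, so its norm is controlled by [|v| + |j|]. *)
Lemma compact_approximation (A0 : E) (p : E -> R) :
  V_dominating p ->
  (forall v j : bop E K^o, (forall S, compact_operators S -> j S = 0) ->
     rnorm v + rnorm j <= 1 -> real_part (j A0 - v A0 + v (bop_id X)) <= 1) ->
  forall e, 0 < e -> exists S, [/\ compact_operators S, rnorm (A0 - S) <= 1 + e &
    p (bop_id X - S) <= 1 + e].
Proof.
move=> [ps Vp] hA e e0; apply: contrapT => hS.
have p0 T : 0 <= p T by exact: seminorm_ge0.
have [pD pZ] := ps.
pose N (A : E * E) := rnorm A.1 + p A.2.
have Ns : seminorm N.
  split=> [S T|a T]; last by rewrite /N/= pZ rnormZ mulrDr.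
  by have := ler_rnormD S.1 T.1; have := pD S.2 T.2; rewrite /N/=; lra.
pose W := [set A : E * E | compact_operators A.1 /\ A.2 = A.1].
have [J0 JP] := compact_operators_subspace X X.
have WW : linear_subspace W.
  split=> [|a u v [cu eu] [cv ev]]; first by split.
  by split=> /=; [exact: JP|rewrite eu ev].
have [|psi [pl pN pW pd]] := separate_subspace (x0 := (A0, bop_id X)) (d := 1 + e) Ns WW.
  move=> [S S'] [/= cS ->]; rewrite leNgt; apply/negP => h.
  apply: hS; exists S; rewrite /N/= in h.
  by split=> //; have := p0 (bop_id X - S); have := rnorm_ge0 (A0 - S); lra.
have psiE A B : psi (A, B) = psi (A, 0) + psi (0, B).
  by rewrite -linear_add//; congr psi; congr pair; rewrite /= ?addr0 ?add0r.
have [||v Vv vE] := Vp (fun T => psi (0, T)).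
- move=> a S T; rewrite -pl; congr psi.
  by congr pair; rewrite /= scaler0 addr0.
- by move=> T; rewrite (le_trans (pN _))// /N/= rnorm0 add0r.
have ul : linear (fun T : E => psi (T, 0)).
  move=> a S T; rewrite -pl; congr psi.
  by congr pair; rewrite /= scaler0 addr0.
have uN T : rnorm (psi (T, 0)) <= 1 * rnorm T.
  by rewrite (le_trans (pN _))// /N/= (seminorm0 ps) addr0 mul1r.
pose u : bop E K^o := mk_bop ul uN.
have j0 S : compact_operators S -> (u + v) S = 0.
  by move=> cS; rewrite bop_addE vE -psiE; apply: pW.
have Vv' : V (- v) by rewrite -scaleN1r -[_ *: v]addr0; exact: VP.
have := Vnorm j0 Vv'; rewrite addrK rnormN => un.
have u1 : rnorm u <= 1 by exact: bop_norm_le.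
have := hA v (u + v) j0; rewrite addrC -un => /(_ u1).
have -> : (u + v) A0 - v A0 + v (bop_id X) = psi (A0, bop_id X).
  by rewrite bop_addE addrK vE -psiE.
by move: pd; lra.
Qed.

(** With [A0 = S + bop_id X] the terms [v (bop_id X)] cancel and [j S = 0]; what remains,
    [j (bop_id X) - v S], is at most [rnorm j + rnorm v]. *)
Lemma compact_perturbation (S : E) (p : E -> R) : V_dominating p ->
  compact_operators S -> rnorm S <= 1 -> forall e, 0 < e ->
  exists T, [/\ compact_operators T, rnorm (S + bop_id X - T) <= 1 + e &
    p (bop_id X - T) <= 1 + e].
Proof.
move=> Vp cS S1; apply: compact_approximation => // v j j0 vj.
have -> : j (S + bop_id X) - v (S + bop_id X) + v (bop_id X) = j (bop_id X) - v S.
  by rewrite !bopD j0// add0r opprD addrA subrK.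
apply: (le_trans (real_part_le _)); apply: (le_trans (ler_rnormB _ _)).
have := bop_le_bound (lexx (rnorm j)) (rnorm_id X).
by have := bop_le_bound (lexx (rnorm v)) S1; lra.
Qed.

Lemma compact_contraction (p : E -> R) : V_dominating p -> forall e, 0 < e ->
  exists T, [/\ compact_operators T, rnorm T <= 1 + e & p (bop_id X - T) <= 1 + e].
Proof.
move=> Vp e e0; have [|T [cT T1 pT]] := compact_approximation (A0 := 0) Vp _ e0.
  move=> v j j0 vj; rewrite !bop0 subrr add0r; apply: (le_trans (real_part_le _)).
  have := bop_le_bound (lexx (rnorm v)) (rnorm_id X); have := rnorm_ge0 j; lra.
by exists T; split=> //; move: T1; rewrite sub0r rnormN.
Qed.

Lemma compact_perturbation_point (S : E) (x : X) : compact_operators S -> rnorm S <= 1 ->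
  forall e, 0 < e -> exists T, [/\ compact_operators T,
    rnorm (S + bop_id X - T) <= 1 + e & rnorm (x - T x) <= e].
Proof.
(* The weight [(1 + e) / e] turns the bound [1 + e] on the seminorm into the bound [e] on
   [rnorm (x - T x)]. *)
move=> cS S1 e e0; have C0 : 0 <= (1 + e) / e by rewrite divr_ge0 ?addr_ge0// ltW.
have [T [cT T1 pT]] := compact_perturbation (V_dominating_point x C0) cS S1 e0.
exists T; split=> //; move: pT; rewrite bop_subE bop_idE mulrAC ler_pdivrMr//.
by rewrite ler_pM2l// ltr_pwDr// ltr01.
Qed.

Lemma compact_perturbation_functional (S : E) (f : bop X K^o) :
  compact_operators S -> rnorm S <= 1 ->
  forall e, 0 < e -> exists T, [/\ compact_operators T,
    rnorm (S + bop_id X - T) <= 1 + e & rnorm (f - bop_comp f T) <= e].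
Proof.
move=> cS S1 e e0; have C0 : 0 <= (1 + e) / e by rewrite divr_ge0 ?addr_ge0// ltW.
have [T [cT T1 pT]] := compact_perturbation (V_dominating_functional f C0) cS S1 e0.
exists T; split=> //; move: pT; rewrite bop_compBr bop_comp_idr mulrAC ler_pdivrMr//.
by rewrite ler_pM2l// ltr_pwDr// ltr01.
Qed.

(** A rank-one contraction [S] sends [v] to [u]. If [T v] is close to [v], then [S + bop_id X - T]
    sends [v + x n] close to [u + x n], because the compact operator [S - T] maps the weakly null
    sequence [x] to a norm-null one; and its norm is at most [1 + d]. *)
Lemma M_ideal_monotone_M : monotone_M X.
Proof.
move=> u v x a uv wx va.
have [v0|v0] := eqVneq (rnorm v) 0.
  have -> : u = 0 by apply/rnorm0_eq0/eqP; rewrite eq_le rnorm_ge0 andbT -v0.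
  by move: va; rewrite (rnorm0_eq0 v0).
have vp : 0 < rnorm v by rewrite lt_neqAle eq_sym v0 rnorm_ge0.
have [f [f1 fv]] := norming_functional v.
pose S : E := rank_one f (of_real k (rnorm v)^-1 *: u).
have Sv : S v = u.
  by rewrite rank_oneE fv of_realZ divff// of_real1 scale1r.
have S1 : rnorm S <= 1.
  rewrite (le_trans (rnorm_rank_one _ _))// mulr_ile1 ?rnorm_ge0//.
  by rewrite rnorm_scale gtr0_norm ?invr_gt0// mulrC ler_pdivrMr// mul1r.
have cS : compact_operators S by exact: rank_one_compact.
have a0 : 0 <= a.
  apply/ler_addgt0Pr => e e0; have [N _ /(_ N (leqnn N))] := va e e0.
  exact: le_trans (rnorm_ge0 _).
have xb : (\oo : set_system nat) (fun n => rnorm (x n) <= a + 1 + rnorm v).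
  apply: filterS (va 1 ltr01) => n h; rewrite -(addrK v (x n)) addrC.
  by rewrite (le_trans (ler_rnormD _ _))// rnormN addrC lerD2r addrC.
(* The final bound [(1 + d) (a + d) + 2 d] is at most [a + d (a + 4)], since [d <= 1]. *)
move=> e e0; pose d := Num.min 1 (e / (a + 4)).
have d0 : 0 < d by rewrite lt_min ltr01 divr_gt0// ltr_wpDl.
have d1 : d <= 1 by rewrite ge_min lexx.
have dE : d * (a + 4) <= e by rewrite -ler_pdivlMr ?ltr_wpDl// ge_min lexx orbT.
have [T [cT T1 Tv]] := compact_perturbation_point v cS S1 d0.
have nST : finite_nets (S + (-1) *: T).
  by apply: finite_netsD; [|apply: finite_netsZ]; exact: compact_finite_nets.
apply: filterS2 (va d d0) (finite_nets_weak_null nST xb wx d0) => n h1 h2.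
have -> : u + x n = (S + bop_id X - T) (v + x n) - (v - T v) - (S + (-1) *: T) (x n).
  rewrite bop_subE !bop_addE bop_scaleE scaleN1r bop_idE !bopD Sv.
  vector.
have b1 := bop_le_bound T1 h1.
have b2 := ler_rnormB ((S + bop_id X - T) (v + x n) - (v - T v)) ((S + (-1) *: T) (x n)).
have b3 := ler_rnormB ((S + bop_id X - T) (v + x n)) (v - T v).
have dd : d * d <= d by rewrite ler_piMr// ltW.
move: b1 b2 b3 Tv h2; set A := (S + bop_id X - T) _; set B := v - T v; set C := (S + _) _.
clearbody A B C d; clear -dd dE d0 a0; lra.
Qed.

(** The adjoint of [S + bop_id X - T] sends [h] close to [g] and moves [w n] very little:
    [bop_comp (w n) S] tends to 0 because [S] has rank one and [w n x] tends to 0, and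
    [bop_comp (w n) T] because [T] is compact. Since [x] only nearly norms [h], a remainder
    [(1 - t) g] appears. *)
Lemma M_ideal_monotone_M_star : monotone_M_star X.
Proof.
move=> g h w M a gh w0 wM ha.
have [h0|h0] := eqVneq (rnorm h) 0.
  have -> : g = 0 by apply/rnorm0_eq0/eqP; rewrite eq_le rnorm_ge0 andbT -h0.
  by move: ha; rewrite (rnorm0_eq0 h0).
have hp : 0 < rnorm h by rewrite lt_neqAle eq_sym h0 rnorm_ge0.
have a0 : 0 <= a.
  apply/ler_addgt0Pr => e e0; have [N _ /(_ N (leqnn N))] := ha e e0.
  exact: le_trans (rnorm_ge0 _).
(* The final bound is [(a + d) (1 + d)] plus four errors of size [d], at most [a + d (a + 6)] since
   [d <= 1]. *)
move=> e e0; pose d := Num.min 1 (e / (a + 6)).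
have d0 : 0 < d by rewrite lt_min ltr01 divr_gt0// ltr_wpDl.
have d1 : d <= 1 by rewrite ge_min lexx.
have dE : d * (a + 6) <= e by rewrite -ler_pdivlMr ?ltr_wpDl// ge_min lexx orbT.
have [x [x1 hx hxE]] := functional_near h d0.
pose g' : bop X K^o := of_real k (rnorm h)^-1 *: g.
have g'1 : rnorm g' <= 1.
  by rewrite rnorm_scale gtr0_norm ?invr_gt0// mulrC ler_pdivrMr// mul1r.
pose S : E := rank_one g' x.
have S1 : rnorm S <= 1.
  by rewrite (le_trans (rnorm_rank_one _ _))// mulr_ile1 ?rnorm_ge0.
have cS : compact_operators S by exact: rank_one_compact.
have compS f : bop_comp f S = (f x : K) *: g'.
  by apply/bopP => y; rewrite bop_compE rank_oneE functionalZ bop_scaleE mulrC.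
have [T [cT T1 hT]] := compact_perturbation_functional h cS S1 d0.
have wT := to0_comp_finite_nets (compact_finite_nets cT) wM w0.
near=> n.
have h1 : rnorm (h + w n) <= a + d by near: n; exact: ha.
have h2 : rnorm (bop_comp (w n) T) <= d by near: n; exact: wT.
have h3 : rnorm (w n x) <= d by near: n; exact: w0.
pose t := rnorm (h x) / rnorm h.
have t1 : t <= 1.
  by rewrite ler_pdivrMr// mul1r; have := bop_le_bound (lexx (rnorm h)) x1; rewrite mulr1.
have -> : g + w n = bop_comp (h + w n) (S + bop_id X - T) + of_real k (1 - t) *: g
    - (w n x : K) *: g' - (h - bop_comp h T) + bop_comp (w n) T.
  rewrite bop_compBr bop_compDr bop_comp_idr !bop_compDl !compS hxE.
  rewrite /g' of_realZ -/t; vector.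
have b1 : rnorm (bop_comp (h + w n) (S + bop_id X - T)) <= (a + d) * (1 + d).
  by rewrite (le_trans (rnorm_comp _ _))// ler_pM ?rnorm_ge0.
have b2 : rnorm (of_real k (1 - t) *: g) <= d.
  rewrite rnorm_scale ger0_norm ?subr_ge0//.
  have th : t * rnorm h = rnorm (h x) by rewrite divfK.
  have : (1 - t) * rnorm g <= (1 - t) * rnorm h by rewrite ler_wpM2l// subr_ge0.
  by rewrite [X in _ <= X]mulrBl mul1r th; lra.
have b3 : rnorm ((w n x : K) *: g') <= d * 1 by rewrite rnormZ ler_pM ?rnorm_ge0.
set A := bop_comp (h + w n) _ in b1 *; set B := of_real k _ *: g in b2 *.
set C := (w n x : K) *: g' in b3 *; set D := h - _ in hT *; set F := bop_comp _ T in h2 *.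
have := ler_rnormD (A + B - C - D) F; have := ler_rnormB (A + B - C) D.
have := ler_rnormB (A + B) C; have := ler_rnormD A B.
have dd : d * d <= d by rewrite ler_piMr// ltW.
clearbody A B C D F d; clear -b1 b2 b3 hT h2 dd dE d0 a0; lra.
Unshelve. all: by end_near.
Qed.

Lemma M_ideal_compact_approximation : separable X -> metric_compact_approximation_property X.
Proof.
move=> /separable_sequence[a ad].
have /choice[T TP] : forall n : nat, exists T : E, [/\ compact_operators T, rnorm T <= 1 &
    forall i, (i < n)%N -> rnorm ((bop_id X - T) (a i)) <= n.+1%:R^-1 * (1 + rnorm (a i))].
  move=> n; pose e : R := n.+1%:R^-1.
  have e0 : 0 < e by rewrite invr_gt0 ltr0n.
  have C0 : 0 <= (1 + e) / e by rewrite divr_ge0 ?addr_ge0// ltW.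
  have [T [cT T1 pT]] := compact_contraction (V_dominating_points a n C0) e0.
  have e1 : 0 < 1 + e by rewrite addr_gt0.
  (* Rescaling makes [T] a contraction; the distance to the identity at [a i] grows at most by a
     multiple [e] of [rnorm (a i)]. *)
  exists (of_real k (1 + e)^-1 *: T); split.
  - by apply: linear_subspaceZ cT; exact: compact_operators_subspace.
  - by rewrite rnorm_scale gtr0_norm ?invr_gt0// mulrC ler_pdivrMr// mul1r.
  - move=> i ni; have hi : rnorm ((bop_id X - T) (a i)) <= e.
      have : (1 + e) / e * rnorm ((bop_id X - T) (a i)) <= 1 + e.
        apply: le_trans pT; rewrite (bigD1 (Ordinal ni))//= lerDl sumr_ge0// => j _.
        by rewrite mulr_ge0 ?rnorm_ge0.
      by rewrite mulrAC ler_pdivrMr// ler_pM2l.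
    have -> : (bop_id X - of_real k (1 + e)^-1 *: T) (a i) =
        of_real k (1 + e)^-1 *: ((bop_id X - T) (a i) + of_real k e *: a i).
      rewrite !bop_subE bop_scaleE bop_idE.
      have {1}-> : a i = of_real k (1 + e)^-1 *: (of_real k (1 + e) *: a i).
        by rewrite of_realZ mulVf ?gt_eqF// of_real1 scale1r.
      vector.
    rewrite rnorm_scale gtr0_norm ?invr_gt0//.
    rewrite mulrC ler_pdivrMr// (le_trans (ler_rnormD _ _))// rnorm_scale gtr0_norm//.
    by have := rnorm_ge0 (a i); rewrite -/e; nra.
exists nat, (fun i j => (i <= j)%N : Prop), T; split.
- split; first by exists 0%N.
  + by move=> i; exact: leqnn.
  + by move=> i j l; exact: leq_trans.
  + by move=> i j; exists (maxn i j); rewrite leq_maxl leq_maxr.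
- by move=> i; have [] := TP i.
- by move=> i; have [_ T1 _] := TP i; rewrite -rnormE -(of_real1 (k := k)) ler_of_real.
- move=> x U /nbhs_rnormP[r r0 rU].
  have fM n : rnorm (bop_id X - T n) <= 1 + 1.
    by rewrite (le_trans (ler_rnormB _ _))// lerD ?rnorm_id//; have [] := TP n.
  have : to0 \oo (fun n => (bop_id X - T n) x).
    apply: (dense_to0 fM ad) => i e e0.
    have [N hN] : exists N : nat, (1 + rnorm (a i)) / e <= N.+1%:R.
      by exists (Num.truncn ((1 + rnorm (a i)) / e)); rewrite ltW// truncnS_gt.
    exists (maxn i.+1 N) => // n /=; rewrite geq_max => /andP[ii Nn].
    have [_ _ /(_ _ ii)/le_trans] := TP n; apply.
    rewrite mulrC ler_pdivrMr ?ltr0n// mulrC -ler_pdivrMr//.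
    by rewrite (le_trans hN)// ler_nat.
  have r2 : 0 < r / 2 by rewrite divr_gt0.
  move=> /(_ _ r2)[N _ hN]; exists N => n Nn; apply: rU.
  have := hN n Nn; rewrite bop_subE bop_idE => /le_lt_trans; apply.
  by rewrite ltr_pdivrMr// ltr_pMr// ltr1n.
Qed.

End M_ideal_consequences.

(** * Separable duals and copies of l1 *)

Section separable_dual.
Context {R : realType} {k : scalar_kind}.
Local Notation K := (scalars R k).

Lemma rat_dense (x e : R) : 0 < e -> exists q : rat, `|x - ratr q| < e.
Proof.
move=> e0; have [q] := rat_in_itvoo (ltr_pwDr e0 (lexx x)).
rewrite in_itv /= => /andP[h1 h2]; exists q.
by rewrite ltr_norml; lra.
Qed.

Lemma scalar_sequence : exists q : nat -> K, forall z e, 0 < e -> exists n, rnorm (z - q n) < e.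
Proof.
case: k.
  exists (fun n => ratr (odflt 0 (unpickle n : option rat))) => z e e0.
  have [r hr] := rat_dense z e0; exists (pickle r); rewrite pickleK; exact: hr.
exists (fun n => let p := odflt (0, 0) (unpickle n : option (rat * rat)) in
  (ratr p.1 +i* ratr p.2)%C) => -[x y] e e0.
have e2 : 0 < e / 2 by rewrite divr_gt0.
have [r hr] := rat_dense x e2; have [s hs] := rat_dense y e2.
exists (pickle (r, s)); rewrite pickleK.
apply: (@le_lt_trans _ _ (Num.sqrt ((x - ratr r) ^+ 2 + (y - ratr s) ^+ 2))).
  by have <- := rnorm_complexE (x - ratr r) (y - ratr s).
rewrite -(ger0_norm (ltW e0)) -sqrtr_sqr ltr_sqrt ?exprn_gt0//.
rewrite -(real_normK (num_real (x - _))) -(real_normK (num_real (y - _))).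
by have := normr_ge0 (x - ratr r); have := normr_ge0 (y - ratr s); nra.
Qed.

(** The index of a member of [B] within [c / 2] of [f s] determines [s], which would inject
    [nat -> bool] into [nat]; Cantor's diagonal refutes this. *)
Lemma no_separated_cantor (V : normedModType K) (B : nat -> V) (f : (nat -> bool) -> V) (c : R) :
  0 < c -> (forall v e, 0 < e -> exists n, rnorm (v - B n) < e) ->
  (forall s t, s <> t -> c <= rnorm (f s - f t)) -> False.
Proof.
move=> c0 dB fc; have c2 : 0 < c / 2 by rewrite divr_gt0.
have [h hP] := choice (fun s => dB (f s) _ c2).
have hi s t : h s = h t -> s = t.
  move=> st; apply: contrapT => /fc; apply/negP; rewrite -ltNge.
  have -> : f s - f t = (f s - B (h s)) - (f t - B (h t)) by rewrite st opprB addrA subrK.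
  by rewrite (le_lt_trans (ler_rnormB _ _))// (splitr c) ltrD.
have [g gP] : {g : nat -> nat -> bool & forall n t, h t = n -> g n = t}.
  apply: (@choice nat (nat -> bool) (fun n s => forall t, h t = n -> s = t)) => n.
  have [[s hs]|hn] := pselect (exists s, h s = n); last first.
    by exists (fun=> false) => t ht; exfalso; apply: hn; exists t.
  by exists s => t ht; apply: hi; rewrite hs ht.
pose s n := ~~ g n n.
have := gP _ s erefl => /(congr1 (fun u => u (h s))); rewrite /s.
by case: (g _ _).
Qed.

Lemma combinations_subspace (V : lmodType K) (d : nat -> V) :
  linear_subspace [set v | exists n (c : nat -> K), v = \sum_(i < n) c i *: d i].
Proof.
have pad n m (c : nat -> K) : (n <= m)%N ->
    \sum_(i < n) c i *: d i = \sum_(i < m) (if (i < n)%N then c i else 0) *: d i.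
  move=> nm; rewrite (big_ord_widen m (fun i => c i *: d i) nm) big_mkcond /=.
  by apply: eq_bigr => i _; case: ifP => // _; rewrite scale0r.
split=> [|a _ _ [n [c ->]] [m [b ->]]]; first by exists 0%N, (fun=> 0); rewrite big_ord0.
exists (maxn n m), (fun i => a * (if (i < n)%N then c i else 0) + (if (i < m)%N then b i else 0)).
rewrite (pad n (maxn n m)) ?leq_maxl// (pad m (maxn n m)) ?leq_maxr//.
rewrite scaler_sumr -big_split/=; apply: eq_bigr => i _.
by rewrite scalerDl scalerA.
Qed.

(** A code prescribes approximate values at finitely many points of a dense sequence, and [D] picks
    one norm-one functional for each realizable code. Every norm-one [f] is a weak* limit of such
    functionals; since all norms are 1, (M* ) makes the convergence weak. By Hahn-Banach the span of
    the [D n] is norm dense, and coefficients from a countable dense set suffice. *)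
Lemma dual_sequence (X : normedModType K) : separable X -> monotone_M_star X ->
  exists B : nat -> bop X K^o, forall f e, 0 < e -> exists n, rnorm (f - B n) < e.
Proof.
move=> /separable_sequence[a ad] hM; have [q qd] := scalar_sequence.
pose good (c : nat * seq nat) (f : bop X K^o) := rnorm f = 1 /\
  forall i, (i < c.1)%N -> rnorm (f (a i) - q (nth 0%N c.2 i)) < c.1.+1%:R^-1.
have [D0 DP] : {D : nat * seq nat -> bop X K^o & forall c f, good c f -> good c (D c)}.
  apply: (@choice _ _ (fun c g => forall f, good c f -> good c g)) => c.
  have [[f hf]|h] := pselect (exists f, good c f); first by exists f.
  by exists 0 => f hf; exfalso; apply: h; exists f.
pose D n := D0 (odflt (0%N, [::]) (unpickle n)).
have vanish (F : bop (bop X K^o) K^o) f : (forall n, F (D n) = 0) -> rnorm f = 1 -> F f = 0.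
  move=> FD f1.
  have [s sP] : {s : nat -> seq nat & forall n, good (n, s n) f}.
    apply: (@choice _ _ (fun n s => good (n, s) f)) => n.
    have n0 : 0 < n.+1%:R^-1 :> R by rewrite invr_gt0 ltr0n.
    have [h hP] := choice (fun i => qd (f (a i)) _ n0).
    exists (mkseq h n); split=> // i /= ni; rewrite nth_mkseq//.
  have dP n : good (n, s n) (D0 (n, s n)) by exact: DP (sP n).
  pose w n := D0 (n, s n) - f.
  have wM n : rnorm (w n) <= 1 + 1.
    by rewrite (le_trans (ler_rnormB _ _))// f1 lerD2r; have [-> _] := dP n.
  have w0 : weak_star_null w.
    apply: (dense_to0 wM ad) => i e e0.
    have [N hN] : exists N : nat, 2 / e <= N.+1%:R.
      by exists (Num.truncn (2 / e)); rewrite ltW// truncnS_gt.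
    exists (maxn i.+1 N) => // n /=; rewrite geq_max => /andP[ii Nn].
    have [_ /(_ _ ii) /= h1] := dP n; have [_ /(_ _ ii) /= h2] := sP n.
    suff : rnorm ((D0 (n, s n) (a i) - q (nth 0%N (s n) i)) -
        (f (a i) - q (nth 0%N (s n) i))) <= e by rewrite opprB addrA subrK.
    rewrite (le_trans (ler_rnormB _ _))//.
    apply: (@le_trans _ _ (n.+1%:R^-1 + n.+1%:R^-1)); first by rewrite lerD// ltW.
    have -> : n.+1%:R^-1 + n.+1%:R^-1 = 2 / n.+1%:R :> R by ring.
    rewrite ler_pdivrMr ?ltr0n// mulrC -ler_pdivrMr//.
    by rewrite (le_trans hN)// ler_nat.
  have fw : limsup_le (fun n => rnorm (f + w n)) (rnorm f).
    move=> e e0; apply: filterE => n; rewrite /w addrC subrK.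
    by have [-> _] := dP n; rewrite f1 lerDl ltW.
  have Fw (G : bop (bop X K^o) K^o) e : (forall n, G (D n) = 0) -> 0 < e ->
      real_part (G (- f)) <= e.
    move=> GD e0; have [N _ /(_ N (leqnn N))] := weak_star_weak_cvg hM w0 wM fw G e0.
    rewrite /w bopD; suff -> : G (D0 (N, s N)) = 0 by rewrite add0r.
    by rewrite -(GD (pickle (N, s N))) /D pickleK.
  (* The one-sided estimate [Fw], applied to [- u *: F], bounds [rnorm (F f)] by every [e > 0]. *)
  have [u [u1 uF]] := phase (F f).
  apply/rnorm0_eq0/eqP; rewrite eq_le rnorm_ge0 andbT; apply/ler_addgt0Pr => e e0.
  rewrite add0r -(@of_realK R k (rnorm (F f))) -uF.
  have := Fw (- u *: F) e; rewrite bop_scaleE bopN.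
  have -> : - u *: - F f = u * F f by rewrite -[LHS]/(- u * - F f) mulrNN.
  apply=> // n.
  by rewrite bop_scaleE FD scaler0.
pose W := [set v : bop X K^o | exists n (c : nat -> K), v = \sum_(i < n) c i *: D i].
have WW : linear_subspace W by exact: combinations_subspace.
have Wd1 f d : rnorm f = 1 -> 0 < d -> exists w, W w /\ rnorm (f - w) < d.
  move=> f1 d0; apply: contrapT => h.
  have [|F [F1 FW Fd]] := distance_functional (x0 := f) (d := d) WW.
    by move=> w Ww; rewrite leNgt; apply/negP => fw; apply: h; exists w.
  have F0 : F f = 0.
    apply: vanish => // n; apply: FW; exists n.+1, (fun i => (i == n)%:R).
    rewrite big_ord_recr /= eqxx scale1r big1 ?add0r// => i _.
    by rewrite ltn_eqF// scale0r.
  by move: Fd; rewrite F0 -(of_real0 (k := k)) of_realK; lra.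
have Wd f d : 0 < d -> exists w, W w /\ rnorm (f - w) < d.
  move=> d0; have [f0|f0] := eqVneq f 0.
    by exists 0; rewrite f0 subrr rnorm0; split=> //; have [] := WW.
  have fp : 0 < rnorm f by rewrite rnorm_gt0.
  have [|w [Ww wd]] := Wd1 (of_real k (rnorm f)^-1 *: f) (d / rnorm f) _ (divr_gt0 d0 fp).
    by rewrite rnorm_scale gtr0_norm ?invr_gt0// mulVf ?gt_eqF.
  exists (of_real k (rnorm f) *: w); split; first exact: linear_subspaceZ.
  have -> : f - of_real k (rnorm f) *: w =
      of_real k (rnorm f) *: (of_real k (rnorm f)^-1 *: f - w).
    by rewrite scalerBr of_realZ divff ?gt_eqF// of_real1 scale1r.
  by rewrite rnorm_scale gtr0_norm// mulrC -ltr_pdivlMr.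
pose B n : bop X K^o := let s := odflt [::] (unpickle n : option (seq nat)) in
  \sum_(i < size s) q (nth 0%N s i) *: D i.
exists B => f e e0; have e2 : 0 < e / 2 by rewrite divr_gt0.
have [_ [[n [c ->]] fc]] := Wd f _ e2.
pose M := \sum_(i < n) rnorm (D i).
have M0 : 0 <= M by apply: sumr_ge0 => i _; exact: rnorm_ge0.
have M1 : 0 < M + 1 by rewrite ltr_wpDl.
have [h hP] := choice (fun i => qd (c i) _ (divr_gt0 e2 M1)).
exists (pickle (mkseq h n)); rewrite /B pickleK /= size_mkseq.
have -> : f - \sum_(i < n) q (nth 0%N (mkseq h n) i) *: D i =
   (f - \sum_(i < n) c i *: D i) + \sum_(i < n) (c i - q (h i)) *: D i.
  rewrite -addrA; congr (_ + _); rewrite -sumrN -sumrN -big_split/=.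
  apply: eq_bigr => i _; rewrite nth_mkseq// scalerBl addrA addNr add0r.
  by [].
rewrite (le_lt_trans (ler_rnormD _ _))// (splitr e) ltr_leD//.
rewrite (le_trans (rnorm_sum _ _ _))//.
apply: (@le_trans _ _ (\sum_(i < n) (e / 2 / (M + 1)) * rnorm (D i))).
  by apply: ler_sum => i _; rewrite rnormZ ler_wpM2r ?rnorm_ge0// ltW.
rewrite -mulr_sumr -/M mulrAC ler_pdivrMr//.
by rewrite ler_wpM2l ?(ltW e2)// lerDl.
Qed.

Lemma ell1_partial_le (a : ell1 R k) n : \sum_(i < n) rnorm (a i) <= rnorm a.
Proof.
have -> : rnorm a = ell1_norm a by rewrite /rnorm ell1_normE of_realK.
have nd : nondecreasing_seq (series (fun n => rnorm (a n))).
  by apply: nondecreasing_series => i _ _; exact: rnorm_ge0.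
apply: le_trans (nondecreasing_cvgn_le nd (@ell1_summable R k a) n).
by rewrite /series/= big_mkord.
Qed.

Lemma ell1_norm_le (a : ell1 R k) M : (forall n, \sum_(i < n) rnorm (a i) <= M) -> rnorm a <= M.
Proof.
move=> h; have -> : rnorm a = ell1_norm a by rewrite /rnorm ell1_normE of_realK.
apply: limr_le; first exact: ell1_summable.
by apply: nearW => n; rewrite /series/= big_mkord.
Qed.

Lemma mk_ell1 (a : nat -> K^o) M : (forall n, \sum_(i < n) rnorm (a i) <= M) ->
  exists b : ell1 R k, forall n, b n = a n.
Proof.
move=> h; have am : a \in abs_summable (R := R) (k := k).
  apply/mem_set => /=; apply: nondecreasing_is_cvgn.
    by apply: nondecreasing_series => i _ _; exact: rnorm_ge0.
  by exists M => _ [n _ <-]; rewrite /series/= big_mkord.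
by exists (Ell1 am).
Qed.

Lemma ell1_unit m : exists e : ell1 R k, rnorm e <= 1 /\ forall n, e n = (n == m)%:R.
Proof.
have h n : \sum_(i < n) rnorm ((i == m :> nat)%:R : K^o) <= 1.
  have [mn|nm] := ltnP m n.
    rewrite (bigD1 (Ordinal mn))//= eqxx big1 ?addr0 ?rnorm1// => i im.
    by rewrite -[_ == m]/(i == Ordinal mn) (negbTE im) rnorm0.
  rewrite big1 ?ler01// => i _.
  by rewrite ltn_eqF ?rnorm0// (leq_trans (ltn_ord i)).
have [e eE] := mk_ell1 (a := fun i => (i == m)%:R) h.
exists e; split=> //; apply: ell1_norm_le => n.
by under eq_bigr do rewrite eE; exact: h.
Qed.

(** Continuity of the inverse at 0 on [Y] gives a radius [d] below which [S] has values in the unit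
    ball; scaling [T a] to norm [d / 2] yields the linear bound. *)
Lemma copy_lower_bound (X E : normedModType K) (Y : set X) (T : bop E X) (S : X -> E) :
  range T = Y -> cancel T S -> {within Y, continuous S} ->
  exists2 C, 0 < C & forall a, rnorm a <= C * rnorm (T a).
Proof.
move=> TY TS /subspace_continuousP cS.
have Y0 : Y 0 by rewrite -TY; exists 0 => //; rewrite bop0.
have S0 : S 0 = 0 by rewrite -(bop0 T) TS.
have : nbhs (S 0) [set a | rnorm a < 1].
  by apply/nbhs_rnormP; exists 1 => // y; rewrite S0 sub0r rnormN.
move=> /(cS 0 Y0); rewrite /= nbhs_simpl /within /= => /nbhs_rnormP[d d0 hd].
exists (2 / d); first by rewrite divr_gt0.
move=> a; have [Ta0|Ta0] := eqVneq (rnorm (T a)) 0.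
  have -> : a = 0 by rewrite -(TS a) (rnorm0_eq0 Ta0) S0.
  by rewrite rnorm0 mulr_ge0 ?rnorm_ge0// divr_ge0// ltW.
have Tp : 0 < rnorm (T a) by rewrite lt_neqAle eq_sym Ta0 rnorm_ge0.
pose t := d / 2 / rnorm (T a).
have t0 : 0 < t by rewrite !divr_gt0.
have h : rnorm (S (T (of_real k t *: a))) < 1.
  apply: (hd (T (of_real k t *: a))); last by rewrite -TY; exists (of_real k t *: a).
  rewrite sub0r rnormN bopZ rnorm_scale gtr0_norm// divfK//.
  by rewrite ltr_pdivrMr// ltr_pMr// ltr1n.
have : t * rnorm a <= 1 by move: h; rewrite TS rnorm_scale gtr0_norm// => /ltW.
rewrite /t mulrAC ler_pdivrMr// mul1r -mulrA mulrC => h'.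
by rewrite mulrC mulrA ler_pdivlMr// mulrC; lra.
Qed.

(** Each 0-1 sequence defines a functional on l1, which extends from the copy to [X]. Two such
    functionals differ by 1 in modulus at the image of some unit vector, so they form an uncountable
    separated set. The pairing with l1 is taken as an ultrafilter limit of its bounded partial
    sums. *)
Lemma separable_dual_no_ell1 (X : normedModType K) (B : nat -> bop X K^o) :
  (forall f e, 0 < e -> exists n, rnorm (f - B n) < e) -> ~ contains_copy X (ell1 R k).
Proof.
move=> dB [Y [T [S [_ TY TS cS]]]].
have [C C0 hC] := copy_lower_bound TY TS cS.
have [U [UU oU]] := ultraFilterLemma eventually_filter.
have ext (s : nat -> bool) : exists f : bop X K^o, forall (m : nat) (e : ell1 R k),
    (forall n, e n = (n == m)%:R) -> f (T e) = (s m)%:R.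
  pose P (a : ell1 R k) n : K^o := \sum_(i < n) (s i)%:R * (a i : K).
  have PM a n : rnorm (P a n) <= rnorm a.
    apply: le_trans (ell1_partial_le a n); apply: (le_trans (rnorm_sum _ _ _)).
    apply: ler_sum => i _; rewrite rnormM ler_piMl ?rnorm_ge0//.
    by case: (s i); rewrite ?rnorm1 ?rnorm0 ?ler01.
  have [g gP] := choice (fun a => ultra_limit (U := U) (PM a)).
  have gl : linear g.
    move=> a x y; apply: (to0_unique (gP _)).
    apply: (to0_eq (to0D (to0Z a (gP x)) (gP y))) => n.
    have -> : P (a *: x + y) n = a *: P x n + P y n.
      rewrite /P scaler_sumr -big_split/=; apply: eq_bigr => i _.
      change ((s i)%:R * (a * (ell1_seq x i : K) + (ell1_seq y i : K)) =
        a * ((s i)%:R * (ell1_seq x i : K)) + (s i)%:R * (ell1_seq y i : K)).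
      by ring.
    by rewrite scalerBr opprD addrACA.
  have gC a : rnorm (g a) <= C * rnorm (T a).
    apply: le_trans (hC a); apply/ler_addgt0Pr => e e0.
    have /filter_ex[n hn] := gP a e e0.
    rewrite -(subrK (P a n) (g a)) addrC (le_trans (ler_rnormD _ _))// lerD//.
    by rewrite rnorm_distC.
  have [f [_ fE]] := extend_bounded_functional (ltW C0) (bop_linear T) gl gC.
  exists f => m e eE; rewrite fE; apply: (to0_unique (gP e)) => d d0.
  apply: oU; exists m.+1 => // n /= mn; rewrite /P (bigD1 (Ordinal mn))//= eE eqxx.
  rewrite big1 ?addr0 ?mulr1 ?subrr ?rnorm0 ?ltW// => i im.
  by rewrite eE -[_ == m]/(i == Ordinal mn) (negbTE im) mulr0.
have [f fP] := choice ext.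
have T1 : 0 < rnorm T + 1 by rewrite ltr_wpDl// rnorm_ge0.
apply: (@no_separated_cantor _ B f (rnorm T + 1)^-1) => //; first by rewrite invr_gt0.
move=> s t st; have [m sm] : exists m, s m <> t m.
  by apply: contrapT => h; apply: st; apply/funext => m; apply: contrapT => sm; apply: h; exists m.
have [e [e1 eE]] := ell1_unit m.
rewrite -div1r ler_pdivrMr//.
have TT : rnorm T <= rnorm T + 1 by rewrite lerDl.
have := bop_le_bound (lexx (rnorm (f s - f t))) (bop_le_bound TT e1).
rewrite mulr1 bop_subE (fP s m e eE) (fP t m e eE); apply: le_trans.
by move: sm; case: (s m); case: (t m) => // _; rewrite ?subr0 ?sub0r ?rnormN rnorm1.
Qed.

End separable_dual.

(** * Rosenthal's theorem *)

Section independence.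
Variables (W : Type) (A B : nat -> set W).
Implicit Types (L M : set nat) (D : set W).

Definition unbounded L := forall N, exists n, (N <= n)%N /\ L n.

(** In the application [A n] and [B n] consist of the functionals whose values at [x n] are near two
    separated scalars; an oscillating functional is then one along which [x] has no limit over
    [L]. *)
Definition oscillates L w :=
  unbounded [set n | L n /\ A n w] /\ unbounded [set n | L n /\ B n w].

(** Oscillation that no passage to an infinite subset removes. This is the invariant that the
    splitting of [D] into pieces preserves. *)
Definition hereditarily_oscillating L D :=
  forall L', L' `<=` L -> unbounded L' -> exists w, D w /\ oscillates L' w.

Lemma pigeonhole (T : finType) (c : nat -> T) : exists v, unbounded [set n | c n = v].
Proof.
apply: contrapT => h.
have [N hN] : {N : T -> nat & forall v n, (N v <= n)%N -> c n <> v}.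
  apply: (@choice T nat (fun v m => forall n, (m <= n)%N -> c n <> v)) => v.
  apply: contrapT => hv; apply: h; exists v => m; apply: contrapT => hm.
  by apply: hv; exists m => n mn cn; apply: hm; exists n.
pose n := \max_(v : T) N v.
by apply: (hN (c n) n) => //; exact: leq_bigmax.
Qed.

(* Otherwise one diagonalizes: along the exceptional indices, infinitely many of
   which share the same set [D] and the same letter, some point of [D] oscillates,
   and it lies in a piece on which it should not. *)
Lemma oscillating_split L (s : seq (set W)) N :
  unbounded L -> (forall i, (i < size s)%N -> hereditarily_oscillating L (nth setT s i)) ->
  exists n L', [/\ L n, (N <= n)%N, L' `<=` L, unbounded L' &
    forall i, (i < size s)%N -> hereditarily_oscillating L' (nth setT s i `&` A n) /\
      hereditarily_oscillating L' (nth setT s i `&` B n)].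
Proof.
move=> uL hL; apply: contrapT => h.
pose X (b : bool) n := if b then A n else B n.
have bad n L' : L n -> (N <= n)%N -> L' `<=` L -> unbounded L' ->
    exists (c : 'I_(size s) * bool) L'', [/\ L'' `<=` L', unbounded L'' &
      forall w, nth setT s c.1 w -> X c.2 n w -> ~ oscillates L'' w].
  move=> Ln Nn L'L uL'; apply: contrapT => h'; apply: h; exists n, L'; split=> // i si.
  by split=> L'' sL'' uL''; apply: contrapT => hw; apply: h';
    [exists (Ordinal si, true), L''|exists (Ordinal si, false), L'']; split=> // w /= w1 w2 w3;
    apply: hw; exists w.
(* A state is an index with a set of further candidates. [c] records a piece, a letter and a thinner
   set along which that part of the piece never oscillates; the next index is drawn from the thinner
   set. *)
pose St := {p : nat * set nat | [/\ L p.1, (N <= p.1)%N, p.2 `<=` L & unbounded p.2]}.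
have [c cP] : {c : St -> ('I_(size s) * bool) * set nat & forall p : St,
    [/\ (c p).2 `<=` (sval p).2, unbounded (c p).2 &
      forall w, nth setT s (c p).1.1 w -> X (c p).1.2 (sval p).1 w -> ~ oscillates (c p).2 w]}.
  apply: (@choice St (('I_(size s) * bool) * set nat)%type
    (fun p r => [/\ r.2 `<=` (sval p).2, unbounded r.2 &
      forall w, nth setT s r.1.1 w -> X r.1.2 (sval p).1 w -> ~ oscillates r.2 w])).
  move=> [[n L'] /= [Ln Nn L'L uL']]; have [c [L'' [h1 h2 h3]]] := bad n L' Ln Nn L'L uL'.
  by exists (c, L'').
have [nx nxP] : {nx : St -> St & forall p, [/\ (c p).2 (sval (nx p)).1,
    ((sval p).1 < (sval (nx p)).1)%N & (sval (nx p)).2 = (c p).2]}.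
  apply: (@choice St St (fun p p' => [/\ (c p).2 (sval p').1,
    ((sval p).1 < (sval p').1)%N & (sval p').2 = (c p).2])) => p.
  have [c1 c2 _] := cP p; have [m [pm cm]] := c2 (maxn N (sval p).1.+1).
  have [_ _ p3 _] := svalP p.
  have hp : [/\ L m, (N <= m)%N, (c p).2 `<=` L & unbounded (c p).2].
    by split=> //; [exact/p3/c1|exact: leq_trans (leq_maxl _ _) pm|exact: subset_trans p3].
  by exists (exist _ (m, (c p).2) hp); split=> //=; exact: leq_trans (leq_maxr _ _) pm.
have [n0 [Nn0 Ln0]] := uL N.
pose st j := iter j nx (exist _ (n0, L) (And4 Ln0 Nn0 (@subset_refl _ L) uL) : St).
pose n j := (sval (st j)).1; pose Lj j := (c (st j)).2.
have nS j : (n j < n j.+1)%N by have [] := nxP (st j).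
have n_mono i j : (i < j)%N -> (n i < n j)%N.
  by elim: j => // j IHj; rewrite ltnS leq_eqVlt => /predU1P[->//|/IHj/ltn_trans]; apply.
have n_ge j : (j <= n j)%N by elim: j => // j IHj; exact: leq_ltn_trans IHj (nS j).
have LS j : Lj j.+1 `<=` Lj j.
  have [_ _ e] := nxP (st j); have [h1 _ _] := cP (st j.+1).
  by move=> m /h1; rewrite /st iterS e.
have Ldec i j : (i <= j)%N -> Lj j `<=` Lj i.
  elim: j => [|j IHj]; first by rewrite leqn0 => /eqP ->.
  rewrite leq_eqVlt => /predU1P[->//|/IHj h1]; exact: subset_trans (LS j) h1.
have nL i j : (i < j)%N -> Lj i (n j).
  by case: j => // j ij; apply: (Ldec i j) => //; have [] := nxP (st j).
have [[i b] vP] := pigeonhole (fun j => (c (st j)).1).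
pose M := [set n j | j in [set j | (c (st j)).1 = (i, b)]].
have ML : M `<=` L.
  by move=> _ [j _ <-]; have [] := svalP (st j).
have uM : unbounded M.
  by move=> m; have [j [mj cj]] := vP m; exists (n j); split; [exact: leq_trans (n_ge j)|exists j].
have [w [Dw oM]] := hL i (ltn_ord i) M ML uM.
have [m [j cj jm] wm] : exists2 m, M m & X b m w.
  have [oA oB] := oM; rewrite /X; case: (b).
    by have [m [_ [Mm wm]]] := oA 0%N; exists m.
  by have [m [_ [Mm wm]]] := oB 0%N; exists m.
have wj : X b (n j) w by rewrite jm.
clear m jm wm.
have [_ _ /(_ w)] := cP (st j); rewrite cj => /(_ Dw wj); apply.
(* Beyond [n j] the set [M] lies in [Lj j], so oscillation of [w] along [M] is oscillation along
   [Lj j], which the choice at stage [j] excludes. *)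
have tail m : M m -> (n j < m)%N -> Lj j m.
  move=> [l _ <-]; have [jl _|lj] := ltnP j l; first exact: nL.
  rewrite ltnNge; have [->|lj'] := eqVneq l j; first by rewrite leqnn.
  by rewrite ltnW// n_mono// ltn_neqAle lj'.
have [oA oB] := oM; split=> m.
  have [l [ml [Ml wl]]] := oA (maxn m (n j).+1); exists l; split.
    exact: leq_trans (leq_maxl _ _) ml.
  by split=> //; apply: tail => //; exact: leq_trans (leq_maxr _ _) ml.
have [l [ml [Ml wl]]] := oB (maxn m (n j).+1); exists l; split.
  exact: leq_trans (leq_maxl _ _) ml.
by split=> //; apply: tail => //; exact: leq_trans (leq_maxr _ _) ml.
Qed.

(** The state is an infinite set with the list of all pieces obtained so far from [D] by
    intersecting with [A] or [B] at the chosen indices. Each pattern [sg] selects a piece of the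
    list, and a hereditarily oscillating piece is not empty. *)
Lemma independent_subsequence L D : unbounded L -> hereditarily_oscillating L D ->
  exists phi : nat -> nat, forall r (sg : nat -> bool), exists w, D w /\
    forall i, (i < r)%N -> (if sg i then A (phi i) else B (phi i)) w.
Proof.
move=> uL hD.
pose St := {p : set nat * seq (set W) | unbounded p.1 /\
  forall i, (i < size p.2)%N -> hereditarily_oscillating p.1 (nth setT p.2 i)}.
pose ext n (s : seq (set W)) := [seq D `&` A n | D <- s] ++ [seq D `&` B n | D <- s].
have [nx nxP] : {nx : St -> nat * St & forall p, (sval (nx p).2).2 = ext (nx p).1 (sval p).2}.
  apply: (@choice St _ (fun p r => (sval r.2).2 = ext r.1 (sval p).2)) => -[[L0 s] /= [uL0 hs]].
  have [n [L' [_ _ _ uL' hL']]] := oscillating_split 0 uL0 hs.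
  have hp : unbounded L' /\ forall i, (i < size (ext n s))%N ->
      hereditarily_oscillating L' (nth setT (ext n s) i).
    split=> // i; rewrite /ext size_cat !size_map nth_cat size_map => il.
    case: ltnP => si; first by rewrite (nth_map setT)//; have [] := hL' i si.
    have si' : (i - size s < size s)%N by rewrite ltn_subLR.
    by rewrite (nth_map setT)//; have [] := hL' _ si'.
  by exists (n, exist _ (L', ext n s) hp).
have h0 : unbounded L /\ forall i, (i < size [:: D])%N ->
    hereditarily_oscillating L (nth setT [:: D] i).
  by split=> // -[|].
pose st j := iter j (fun p => (nx p).2) (exist _ (L, [:: D]) h0 : St).
exists (fun j => (nx (st j)).1) => r sg.
suff [i ir hi] : exists2 i, (i < size (sval (st r)).2)%N &
    forall w, nth setT (sval (st r)).2 i w -> D w /\ forall j, (j < r)%N ->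
      (if sg j then A (nx (st j)).1 else B (nx (st j)).1) w.
  have [uS hS] := svalP (st r).
  by have [w [Dw _]] := hS i ir _ (@subset_refl _ _) uS; exists w; exact: hi.
elim: r => [|r [i ir hi]]; first by exists 0%N.
have e := nxP (st r); rewrite /st iterS -/(st r) e /ext.
set s := (sval (st r)).2 in ir hi *; set n := (nx (st r)).1.
exists (if sg r then i else size s + i)%N.
  rewrite size_cat !size_map; case: (sg r); last by rewrite ltn_add2l.
  exact: leq_trans ir (leq_addr _ _).
move=> w; rewrite nth_cat size_map; case E : (sg r).
  rewrite ir (nth_map setT)// => -[/hi[Dw hw] Aw]; split=> // j.
  by rewrite ltnS leq_eqVlt => /predU1P[->|/hw//]; rewrite E.
rewrite ltnNge leq_addr /= addKn (nth_map setT)// => -[/hi[Dw hw] Bw]; split=> // j.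
by rewrite ltnS leq_eqVlt => /predU1P[->|/hw//]; rewrite E.
Qed.

End independence.

(** * Copies of l1 and weakly Cauchy subsequences *)

Section ell1_copies.
Context {R : realType} {k : scalar_kind}.
Local Notation K := (scalars R k).

(** Coordinatewise limits along an ultrafilter; the Cauchy estimate passes to every partial sum of
    norms, hence to the norm. *)
Lemma ell1_complete (a : nat -> ell1 R k) :
  (forall e, 0 < e -> exists N, forall m n, (N <= m)%N -> (N <= n)%N -> rnorm (a m - a n) <= e) ->
  exists b, to0 \oo (fun n => a n - b).
Proof.
move=> ca; have [U [UU oU]] := ultraFilterLemma eventually_filter.
have coord (u : ell1 R k) i : rnorm (u i) <= rnorm u.
  apply: le_trans (ell1_partial_le u i.+1).
  by rewrite big_ord_recr/= lerDr sumr_ge0// => j _; exact: rnorm_ge0.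
have [N0 hN0] := ca 1 ltr01.
have bd n i : rnorm (a (maxn N0 n) i) <= rnorm (a N0) + 1.
  apply: (le_trans (coord _ i)); rewrite -(subrK (a N0) (a (maxn N0 n))) addrC.
  by rewrite (le_trans (ler_rnormD _ _))// lerD2l hN0// leq_maxl.
have lim i : exists l : K^o, to0 U (fun n => a (maxn N0 n) i - l).
  exact: (ultra_limit (fun n => bd n i)).
have [b bP] := choice lim.
have close e : 0 < e -> exists N, forall n, (N <= n)%N ->
    forall m, \sum_(i < m) rnorm (b i - a n i) <= e.
  move=> e0; have [N hN] := ca e e0; exists N => n Nn m.
  apply/ler_addgt0Pr => d d0.
  have dm : 0 < d / m.+1%:R by rewrite divr_gt0// ltr0n.
  have [p [hp1 hp2]] : exists p, (N <= maxn N0 p)%N /\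
      forall i, (i < m)%N -> rnorm (a (maxn N0 p) i - b i) <= d / m.+1%:R.
    have h q : U (fun p => forall i, (i < q)%N -> rnorm (a (maxn N0 p) i - b i) <= d / m.+1%:R).
      elim: q => [|q IHq]; first exact: filterE.
      apply: filterS2 IHq (bP q _ dm) => p h1 h2 i.
      by rewrite ltnS leq_eqVlt => /predU1P[->//|]; exact: h1.
    have /oU h' : (\oo : set_system nat) (fun p => (N <= maxn N0 p)%N).
      by exists N => // p /= Np; rewrite (leq_trans Np)// leq_maxr.
    by have [p [h1 h2]] := filter_meet h' (h m); exists p.
  apply: (@le_trans _ _ (\sum_(i < m) (rnorm (a (maxn N0 p) i - a n i) + d / m.+1%:R))).
    apply: ler_sum => i _.
    have -> : b i - a n i = (a (maxn N0 p) i - a n i) - (a (maxn N0 p) i - b i).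
      by rewrite opprB [RHS]addrC addrA subrK.
    by rewrite (le_trans (ler_rnormB _ _))// lerD2l hp2.
  rewrite big_split/= lerD//.
    exact: le_trans (ell1_partial_le (a (maxn N0 p) - a n) m) (hN _ _ hp1 Nn).
  rewrite sumr_const card_ord -[_ *+ m]mulr_natr mulrAC ler_pdivrMr ?ltr0n//.
  by apply: ler_wpM2l; [exact: ltW|rewrite ler_nat].
have [N hN] := close 1 ltr01.
have bM m : \sum_(i < m) rnorm (b i) <= 1 + rnorm (a N).
  apply: (@le_trans _ _ (\sum_(i < m) (rnorm (b i - a N i) + rnorm (a N i)))).
    apply: ler_sum => i _; rewrite -{1}(subrK (a N i) (b i)); exact: ler_rnormD.
  by rewrite big_split/= lerD ?hN ?ell1_partial_le.
have [c cE] := mk_ell1 bM; exists c => e e0; have [N' hN'] := close e e0.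
exists N' => // n /= N'n; apply: ell1_norm_le => m.
apply: le_trans (hN' n N'n m); apply: ler_sum => i _.
by rewrite -(cE i) rnorm_distC.
Qed.

Lemma ell1_tail (a : ell1 R k) e : 0 < e ->
  exists N, forall n, (N <= n)%N -> rnorm a - e <= \sum_(i < n) rnorm (a i).
Proof.
move=> e0; apply: contrapT => h.
suff : rnorm a <= rnorm a - e by lra.
apply: ell1_norm_le => n; rewrite leNgt; apply/negP => hn; apply: h.
exists n => m nm; apply: (le_trans (ltW hn)).
rewrite (big_ord_widen m (fun i => rnorm (a i)) nm) big_mkcond/=.
by apply: ler_sum => i _; case: ifP => // _; exact: rnorm_ge0.
Qed.

(** The map [a |-> sum of a i *: z i] is bounded by 1 from above and by [c] from below. The lower
    bound makes the inverse Lipschitz and, with the completeness of [ell1], the range closed. *)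
Lemma ell1_copy (X : completeNormedModType K) (z : nat -> X) (c : R) :
  0 < c -> (forall i, rnorm (z i) <= 1) ->
  (forall n (a : nat -> K), c * \sum_(i < n) rnorm (a i) <= rnorm (\sum_(i < n) a i *: z i)) ->
  contains_copy X (ell1 R k).
Proof.
move=> c0 z1 hz; pose P (a : ell1 R k) n : X := \sum_(i < n) (a i : K) *: z i.
have Pd (a : ell1 R k) m n : (m <= n)%N ->
    rnorm (P a n - P a m) <= \sum_(i < n) rnorm (a i) - \sum_(i < m) rnorm (a i).
  move=> mn; rewrite /P -!(big_mkord xpredT (fun i => rnorm (a i))).
  rewrite -!(big_mkord xpredT (fun i => (a i : K) *: z i)).
  rewrite (big_cat_nat (n := m) (p := n))//= 
    (big_cat_nat (n := m) (p := n) (F := fun i => rnorm (a i)))//=.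
  rewrite addrAC subrr add0r [X in _ <= X]addrAC subrr add0r.
  apply: (le_trans (rnorm_sum _ _ _)); apply: ler_sum => i _.
  by rewrite rnormZ ler_piMr ?rnorm_ge0.
have Pc a : exists l, to0 \oo (fun n => P a n - l).
  apply: complete_sequence => e e0; have [N hN] := ell1_tail a e0.
  have wlog_le m n : (N <= m)%N -> (m <= n)%N -> rnorm (P a n - P a m) <= e.
    move=> Nm mn; apply: (le_trans (Pd a m n mn)).
    by have := hN m Nm; have := ell1_partial_le a n; lra.
  exists N => m n Nm Nn; have [mn|nm] := leqP m n.
    by rewrite rnorm_distC wlog_le.
  by rewrite wlog_le// ltnW.
have [T TP] := choice Pc.
have Tl : linear T.
  move=> b x y; apply: (to0_unique (TP _)).
  apply: (to0_eq (to0D (to0Z b (TP x)) (TP y))) => n.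
  have -> : P (b *: x + y) n = b *: P x n + P y n.
    rewrite /P scaler_sumr -big_split/=; apply: eq_bigr => i _.
    by rewrite scalerA -scalerDl.
  by rewrite scalerBr opprD addrACA.
have TM a : rnorm (T a) <= 1 * rnorm a.
  rewrite mul1r; apply/ler_addgt0Pr => e e0; have /filter_ex[n hn] := TP a e e0.
  rewrite -(subrK (P a n) (T a)) addrC (le_trans (ler_rnormD _ _))// lerD//; last first.
    by rewrite rnorm_distC.
  apply: le_trans (ell1_partial_le a n); apply: (le_trans (rnorm_sum _ _ _)).
  by apply: ler_sum => i _; rewrite rnormZ ler_piMr ?rnorm_ge0.
have Tlow a : c * rnorm a <= rnorm (T a).
  apply/ler_addgt0Pr => e e0; have e2 : 0 < e / 2 by rewrite divr_gt0.
  have [N hN] := ell1_tail a (divr_gt0 e2 c0).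
  have [n [h1 h2]] := filter_meet (nbhs_infty_ge N : (\oo : set_system nat) _) (TP a _ e2).
  have := hz n a; rewrite -/(P a n) => h3.
  have : c * (rnorm a - e / 2 / c) <= c * \sum_(i < n) rnorm (a i).
    by rewrite ler_wpM2l ?(ltW c0)// hN.
  rewrite mulrBr [c * (e / 2 / c)]mulrC divfK ?gt_eqF// => h4.
  by have := lerB_rnorm (P a n) (T a); lra.
pose TT : bop (ell1 R k) X := mk_bop Tl TM.
pose Y := range TT.
have [S SP] : {S : X -> ell1 R k & forall a, S (TT a) = a}.
  suff [S SP] : {S : X -> ell1 R k & forall y b, TT b = y -> b = S y}.
    by exists S => a; rewrite -(SP _ a).
  apply: (@choice X (ell1 R k) (fun y a => forall b, TT b = y -> b = a)).
  move=> y; have [[a ay]|h] := pselect (exists a, TT a = y); last first.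
    by exists 0 => b yb; exfalso; apply: h; exists b.
  exists a => b yb; apply/eqP; rewrite -subr_eq0; apply/eqP/(@rnorm0_eq0 R k).
  apply/eqP; rewrite eq_le rnorm_ge0 andbT.
  rewrite -(ler_pM2l c0) mulr0 (le_trans (Tlow _))// -[T _]/(TT _) bopB yb ay subrr rnorm0.
  by [].
exists Y, TT, S; split=> //.
- split; last first.
    split; first by exists 0 => //; exact: bop0.
    by move=> b _ _ [x _ <-] [y _ <-]; exists (b *: x + y) => //; rewrite bopD bopZ.
  move=> y cly.
  have [a aP] : {a : nat -> ell1 R k & forall n, rnorm (TT (a n) - y) <= n.+1%:R^-1}.
    apply: (@choice nat (ell1 R k) (fun n b => rnorm (TT b - y) <= n.+1%:R^-1)) => n.
    have n0 : 0 < n.+1%:R^-1 :> R by rewrite invr_gt0 ltr0n.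
    have [|_ [[b _ <-] hb]] := cly [set u | rnorm (u - y) <= n.+1%:R^-1].
      apply/nbhs_rnormP; exists n.+1%:R^-1 => // u /ltW.
      by rewrite /= rnorm_distC.
    by exists b.
  have small e : 0 < e -> exists N, forall n, (N <= n)%N -> rnorm (TT (a n) - y) <= e.
    move=> e0; have [N hN] : exists N : nat, e^-1 <= N.+1%:R.
      by exists (Num.truncn e^-1); rewrite ltW// truncnS_gt.
    exists N => n Nn; apply: (le_trans (aP n)).
    rewrite invf_ple ?posrE ?ltr0n//; apply: (le_trans hN); by rewrite ler_nat.
  have [|b bP] := @ell1_complete a.
    move=> e e0; have ce : 0 < c * e / 2 by rewrite divr_gt0// mulr_gt0.
    have [N hN] := small _ ce; exists N => m n Nm Nn.
    rewrite -(ler_pM2l c0) (le_trans (Tlow _))// -[T _]/(TT _) bopB.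
    have -> : TT (a m) - TT (a n) = (TT (a m) - y) - (TT (a n) - y) by rewrite opprB addrA subrK.
    by rewrite (le_trans (ler_rnormB _ _))// [leRHS]splitr lerD ?hN.
  exists b => //; apply/eqP; rewrite -subr_eq0; apply/eqP/(@rnorm0_eq0 R k).
  apply/eqP; rewrite eq_le rnorm_ge0 andbT; apply/ler_addgt0Pr => e e0; rewrite add0r.
  have e2 : 0 < e / 2 by rewrite divr_gt0.
  have [N hN] := small _ e2.
  have [n [h1 h2]] := filter_meet (nbhs_infty_ge N : (\oo : set_system nat) _) (bP _ e2).
  have -> : TT b - y = (TT (a n) - y) - TT (a n - b) by rewrite bopB; vector.
  rewrite (le_trans (ler_rnormB _ _))// [leRHS]splitr lerD ?hN//.
  by apply: (le_trans (TM _)); rewrite mul1r.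
- apply/subspace_continuousP => y [a _ <-].
  move=> V /nbhs_rnormP[r r0 rV]; rewrite /= nbhs_simpl /within /=.
  apply/nbhs_rnormP; exists (c * r); first by rewrite mulr_gt0.
  move=> y' h [b _ E]; have {}h : rnorm (TT (a - b)) < c * r by rewrite bopB E.
  rewrite -E; apply: rV; suff : rnorm (S (TT a) - S (TT b)) < r by [].
  rewrite !SP.
  rewrite -(ltr_pM2l c0); exact: le_lt_trans (Tlow _) h.
Qed.

(** Over the complex numbers, signs are chosen to make either all real parts or all imaginary parts
    nonnegative, whichever have the larger absolute sum; the factor 2 pays for the other half. *)
Lemma sign_sum (c : nat -> K) n : exists sg : nat -> bool,
  \sum_(i < n) rnorm (c i) <= 2 * rnorm (\sum_(i < n) (if sg i then c i else - c i)).
Proof.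
case: k c => c.
  exists (fun i => 0 <= c i).
  have -> : \sum_(i < n) (if 0 <= c i then c i else - c i) = \sum_(i < n) `|c i|.
    apply: eq_bigr => i _; case: ifPn => [/ger0_norm//|]; rewrite -ltNge => /ltr0_norm -> //.
  apply: (@le_trans _ _ (\sum_(i < n) `|c i|)); first exact: ler_sum.
  have s0 : 0 <= \sum_(i < n) `|c i| by apply: sumr_ge0.
  rewrite -[X in 2 * X]/(`|\sum_(i < n) `|c i| |) ger0_norm//; lra.
have nc (w : scalars R ComplexScalars) : rnorm w = Num.sqrt (complex.Re w ^+ 2 + complex.Im w ^+ 2).
  by case: w => a b; exact: rnorm_complexE.
have Rele (w : scalars R ComplexScalars) : `|complex.Re w| <= rnorm w.
  by rewrite nc -sqrtr_sqr ler_wsqrtr// lerDl sqr_ge0.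
have Imle (w : scalars R ComplexScalars) : `|complex.Im w| <= rnorm w.
  by rewrite nc -sqrtr_sqr ler_wsqrtr// lerDr sqr_ge0.
have leRI (w : scalars R ComplexScalars) : rnorm w <= `|complex.Re w| + `|complex.Im w|.
  have h0 : 0 <= `|complex.Re w| + `|complex.Im w| by rewrite addr_ge0.
  rewrite nc -[leRHS](ger0_norm h0) -[leRHS]sqrtr_sqr ler_wsqrtr//.
  rewrite -(real_normK (num_real (complex.Re w))) -(real_normK (num_real (complex.Im w))).
  by have := normr_ge0 (complex.Re w); have := normr_ge0 (complex.Im w); nra.
pose s1 := \sum_(i < n) `|complex.Re (c i)|; pose s2 := \sum_(i < n) `|complex.Im (c i)|.
have s12 : \sum_(i < n) rnorm (c i) <= s1 + s2.
  by rewrite -big_split/=; apply: ler_sum => i _; exact: leRI.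
have ReS (d : nat -> scalars R ComplexScalars) :
    complex.Re (\sum_(i < n) d i) = \sum_(i < n) complex.Re (d i).
  by elim: n {s1 s2 s12} => [|m IHm]; rewrite ?big_ord0// !big_ord_recr/= -IHm;
      case: (\sum_(i < m) d i) (d m) => a b [a' b'].
have ImS (d : nat -> scalars R ComplexScalars) :
    complex.Im (\sum_(i < n) d i) = \sum_(i < n) complex.Im (d i).
  by elim: n {s1 s2 s12 ReS} => [|m IHm]; rewrite ?big_ord0// !big_ord_recr/= -IHm;
      case: (\sum_(i < m) d i) (d m) => a b [a' b'].
have [s21|s12'] := leP s2 s1.
  exists (fun i => 0 <= complex.Re (c i)); apply: (le_trans s12).
  have : s1 <= rnorm (\sum_(i < n) (if 0 <= complex.Re (c i) then c i else - c i)).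
    apply: le_trans (Rele _).
    rewrite (ReS (fun i => if 0 <= complex.Re (c i) then c i else - c i)).
    apply: le_trans (ler_norm _); apply: ler_sum => i _.
    case: ifPn => [/ger0_norm -> //|]; rewrite -ltNge => /ltr0_norm ->.
    by case: (c i).
  by lra.
exists (fun i => 0 <= complex.Im (c i)); apply: (le_trans s12).
have : s2 <= rnorm (\sum_(i < n) (if 0 <= complex.Im (c i) then c i else - c i)).
  apply: le_trans (Imle _).
    rewrite (ImS (fun i => if 0 <= complex.Im (c i) then c i else - c i)).
    apply: le_trans (ler_norm _); apply: ler_sum => i _.
  case: ifPn => [/ger0_norm -> //|]; rewrite -ltNge => /ltr0_norm ->.
  by case: (c i).
by lra.
Qed.

(** Functionals [f], [g] with opposite sign patterns give [f v - g v], which is [(al - be)] times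
    the signed sum of the [a i] up to [2 r S]. By [sign_sum] the main term is at least
    [|al - be| S / 2], the error at most [|al - be| S / 4] because of the factor 8, and the left
    side at most [2 rnorm v]. *)
Lemma independent_lower_bound (X : normedModType K) (z : nat -> X) (al be : K) (r : R) :
  8 * r <= rnorm (al - be) ->
  (forall n (sg : nat -> bool), exists f : bop X K^o, rnorm f <= 1 /\
    forall i, (i < n)%N -> rnorm (f (z i) - (if sg i then al else be)) <= r) ->
  forall n (a : nat -> K),
    rnorm (al - be) / 8 * \sum_(i < n) rnorm (a i) <= rnorm (\sum_(i < n) a i *: z i).
Proof.
move=> hr hf n a; have [sg hsg] := sign_sum a n.
have [f [f1 fz]] := hf n sg; have [g [g1 gz]] := hf n (fun i => ~~ sg i).
set S := \sum_(i < n) rnorm (a i) in hsg *; set v := \sum_(i < n) a i *: z i.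
have S0 : 0 <= S by apply: sumr_ge0 => i _; exact: rnorm_ge0.
pose w := \sum_(i < n) (if sg i then a i else - a i) : K.
have lin (h : bop X K^o) : h v = \sum_(i < n) a i * h (z i).
  rewrite /v linear_sum; apply: eq_bigr => i _; exact: functionalZ.
have err : rnorm ((f v - g v : K) - (al - be) * w) <= 2 * r * S.
  rewrite !lin /w mulr_sumr -!sumrB.
  apply: (le_trans (rnorm_sum _ _ _)); rewrite /S mulr_sumr; apply: ler_sum => i _.
  have hfi := fz i (ltn_ord i); have hgi := gz i (ltn_ord i).
  have -> : (a i * f (z i) - a i * g (z i) - (al - be) * (if sg i then a i else - a i) : K) =
     a i * ((f (z i) - (if sg i then al else be)) - (g (z i) - (if ~~ sg i then al else be))).
    by case: (sg i) => /=; ring.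
  rewrite rnormM mulrC ler_wpM2r ?rnorm_ge0// (le_trans (ler_rnormB _ _))//.
  by move: hfi hgi; lra.
have fg : rnorm (f v - g v : K) <= 2 * rnorm v.
  rewrite -[f v - g v]/((f - g) v); apply: bop_le_bound => //.
  by apply: (le_trans (ler_rnormB _ _)); lra.
have h1 := lerB_rnormD ((al - be) * w) ((f v - g v : K) - (al - be) * w).
rewrite [X in _ <= rnorm X]addrC subrK rnormM in h1.
have h2 : rnorm (al - be) * S <= rnorm (al - be) * (2 * rnorm w) by rewrite ler_wpM2l ?rnorm_ge0.
have h3 : 8 * r * S <= rnorm (al - be) * S by rewrite ler_wpM2r.
set D := rnorm (al - be) in h1 h2 h3 *; rewrite mulrAC ler_pdivrMr//.
set e1 := rnorm (_ - _) in err h1; set e2 := rnorm (f v - g v) in fg h1.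
set e3 := rnorm w in h1 h2; set e4 := rnorm v in fg *.
clearbody D e1 e2 e3 e4 S; clear -h1 h2 h3 fg err S0; lra.
Qed.

Definition weakly_cauchy {X : normedModType K} (x : nat -> X) :=
  forall (f : bop X K^o) e, 0 < e -> exists N, forall m n, (N <= m)%N -> (N <= n)%N ->
    rnorm (f (x m) - f (x n)) <= e.

(** Codes enumerate triples of two scalars from a dense sequence and a radius. For a separated pair
    the oscillation can be removed on an infinite subset, since otherwise independence yields a copy
    of l1; [phi] is diagonal across these nested subsets. A functional in the ball along which
    [x \o phi] diverges would oscillate between two cluster values, which some code detects. *)
Theorem rosenthal_ell1 (X : completeNormedModType K) (x : nat -> X) :
  ~ contains_copy X (ell1 R k) -> (forall n, rnorm (x n) <= 1) ->
  exists phi : nat -> nat, (forall n, (n <= phi n)%N) /\ weakly_cauchy (x \o phi).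
Proof.
move=> nX x1; have [q qd] := @scalar_sequence R k.
pose code c : nat * nat * nat := odflt (0, 0, 0)%N (unpickle c).
pose al c := q (code c).1.1; pose be c := q (code c).1.2.
pose r c : R := (code c).2.+1%:R^-1.
have r0 c : 0 < r c by rewrite invr_gt0 ltr0n.
pose A c n := [set f : bop X K^o | rnorm (f (x n) - al c) <= r c].
pose B c n := [set f : bop X K^o | rnorm (f (x n) - be c) <= r c].
pose ball1 := [set f : bop X K^o | rnorm f <= 1].
pose valid c := 8 * r c <= rnorm (al c - be c).
have nonosc c L : valid c -> unbounded L -> exists L', [/\ L' `<=` L, unbounded L' &
    forall f, ball1 f -> ~ oscillates (A c) (B c) L' f].
  move=> vc uL; apply: contrapT => h; apply: nX.
  have [|phi phiP] := @independent_subsequence _ (A c) (B c) L ball1 uL.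
    move=> L' L'L uL'; apply: contrapT => h'; apply: h; exists L'; split=> // f f1 of_.
    by apply: h'; exists f.
  apply: (@ell1_copy X (x \o phi) (rnorm (al c - be c) / 8)).
  - by rewrite divr_gt0// (lt_le_trans _ vc)// mulr_gt0.
  - by move=> i; exact: x1.
  - apply: independent_lower_bound vc _ => n sg.
    have [f [f1 fP]] := phiP n sg; exists f; split=> // i /fP.
    by rewrite /A /B /=; case: (sg i).
have [nx nxP] : {nx : nat * {L | unbounded L} -> {L | unbounded L} & forall p,
    sval (nx p) `<=` sval p.2 /\ (valid p.1 ->
    forall f, ball1 f -> ~ oscillates (A p.1) (B p.1) (sval (nx p)) f)}.
  apply: (@choice _ _ (fun p L' => sval L' `<=` sval p.2 /\ (valid p.1 ->
    forall f, ball1 f -> ~ oscillates (A p.1) (B p.1) (sval L') f))) => -[c [L uL]] /=.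
  have [vc|vc] := pselect (valid c); last by exists (exist _ L uL); split.
  by have [L' [h1 h2 h3]] := nonosc c L vc uL; exists (exist _ L' h2); split.
have uT : unbounded setT by move=> n; exists n.
pose Lc := fix Lc c := if c is c'.+1 then nx (c', Lc c') else exist _ setT uT : {L | unbounded L}.
have Ldec i j : (i <= j)%N -> sval (Lc j) `<=` sval (Lc i).
  elim: j => [|j IHj]; first by rewrite leqn0 => /eqP ->.
  rewrite leq_eqVlt => /predU1P[->//|/IHj h1]; apply: subset_trans h1.
  by have [] := nxP (j, Lc j).
have [phi phiP] : {phi : nat -> nat & forall n, (n <= phi n)%N /\ sval (Lc n) (phi n)}.
  by apply: (@choice nat nat (fun n m => (n <= m)%N /\ sval (Lc n) m)) => n; exact: (svalP (Lc n)).
exists phi; split=> [n|]; first by have [] := phiP n.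
have noosc c f : valid c -> ball1 f -> ~ oscillates (A c) (B c) (range phi) f.
  move=> vc f1 [oA oB]; have [_ /(_ vc f f1)] := nxP (c, Lc c); apply.
  (* Terms [phi n] above [m0] have [n > c], so they lie in [Lc c.+1], where code [c] no longer
     oscillates. *)
  pose m0 := \max_(i < c.+1) phi i.
  have tail n : (m0 < phi n)%N -> sval (Lc c.+1) (phi n).
    move=> h; apply: (Ldec c.+1 n); last by have [] := phiP n.
    rewrite ltnNge; apply: contraTN h => nc; rewrite -leqNgt.
    exact: (leq_bigmax (Ordinal (nc : (n < c.+1)%N))).
  split=> N.
    have [p [h1 [[n _ E] h2]]] := oA (maxn N m0.+1); rewrite -E in h1 h2; exists (phi n).
    split; first exact: leq_trans (leq_maxl _ _) h1.
    by split=> //; apply: tail; exact: leq_trans (leq_maxr _ _) h1.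
  have [p [h1 [[n _ E] h2]]] := oB (maxn N m0.+1); rewrite -E in h1 h2; exists (phi n).
  split; first exact: leq_trans (leq_maxl _ _) h1.
  by split=> //; apply: tail; exact: leq_trans (leq_maxr _ _) h1.
suff ball_cauchy f : ball1 f -> exists l : K^o, to0 \oo (fun n => f (x (phi n)) - l).
  move=> f e e0; have f1 : 0 < rnorm f + 1 by rewrite ltr_wpDl// rnorm_ge0.
  have [|l fl] := ball_cauchy (of_real k (rnorm f + 1)^-1 *: f).
    rewrite /ball1 /= rnorm_scale gtr0_norm ?invr_gt0// mulrC ler_pdivrMr// mul1r.
    by rewrite lerDl.
  have e2 : 0 < e / (rnorm f + 1) / 2 by rewrite !divr_gt0.
  have [N _ hN] := fl _ e2; exists N => m n Nm Nn.
  have -> : f ((x \o phi) m) - f ((x \o phi) n) = of_real k (rnorm f + 1) *: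
      (((of_real k (rnorm f + 1)^-1 *: f) (x (phi m)) - l) -
       ((of_real k (rnorm f + 1)^-1 *: f) (x (phi n)) - l)).
    rewrite opprB addrA subrK !bop_scaleE -scalerBr of_realZ divff ?gt_eqF//.
    by rewrite of_real1 scale1r.
  rewrite rnorm_scale gtr0_norm// mulrC -ler_pdivlMr//.
  by rewrite (le_trans (ler_rnormB _ _))// [leRHS]splitr lerD ?hN.
move=> f1; have [U [UU oU]] := ultraFilterLemma eventually_filter.
have zM n : rnorm (f (x (phi n))) <= 1.
  by have := bop_le_bound f1 (x1 (phi n)); rewrite mulr1.
have [l hl] := ultra_limit (U := U) zM; exists l; apply: contrapT => h.
have [e e0 he] : exists2 e, 0 < e & forall N, exists n, (N <= n)%N /\ e < rnorm (f (x (phi n)) - l).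
  apply: contrapT => h'; apply: h => e e0; apply: contrapT => h''; apply: h'; exists e => // N.
  apply: contrapT => hN; apply: h''; exists N => // n /= Nn; rewrite leNgt; apply/negP => hn.
  by apply: hN; exists n.
have [psi psiP] := choice he.
(* [l'] is a cluster value along indices whose values stay farther than [e] from the cluster value
   [l]. *)
have [l' hl'] := ultra_limit (U := U) (fun n => zM (psi n)).
have ll' : e <= rnorm (l - l').
  apply/ler_addgt0Pr => d d0; have /filter_ex[n hn] := hl' d d0.
  have [_ /ltW h1] := psiP n.
  apply: (le_trans h1); have -> : f (x (phi (psi n))) - l = (f (x (phi (psi n))) - l') - (l - l').
    by rewrite opprB addrA subrK.
  by rewrite (le_trans (ler_rnormB _ _))// addrC lerD2l.
(* The radius [d = 1 / (N + 1)] satisfies [20 d <= e]. The centres lie within [d / 2] of [l] and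
   [l'], so their distance is at least [e - d], more than the [8 d] that validity asks for. *)
have [N hN] : exists N : nat, 20 / e <= N.+1%:R.
  by exists (Num.truncn (20 / e)); rewrite ltW// truncnS_gt.
pose d : R := N.+1%:R^-1.
have d0 : 0 < d by rewrite invr_gt0 ltr0n.
have d2 : 0 < d / 2 by rewrite divr_gt0.
have dE : 20 * d <= e.
  by rewrite ler_pdivrMr ?ltr0n// mulrC -ler_pdivrMr.
have [i hi] := qd l _ d2; have [j hj] := qd l' _ d2.
pose c := pickle (i, j, N).
have cE : code c = (i, j, N) by rewrite /code /c pickleK.
have alE : al c = q i by rewrite /al cE.
have beE : be c = q j by rewrite /be cE.
have rE : r c = d by rewrite /r cE.
have vc : valid c.
  rewrite /valid rE alE beE.
  have -> : q i - q j = (l - l') - ((l - q i) - (l' - q j)) :> K by ring.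
  have := lerB_rnorm (l - l' : K) ((l - q i) - (l' - q j)).
  by have := ler_rnormB (l - q i : K) (l' - q j); lra.
apply: (noosc c f vc f1); split=> m.
  have /oU hm : (\oo : set_system nat) (fun n => (m <= n)%N) by exists m.
  have [n [h1 h2]] := filter_meet hm (hl _ d2); exists (phi n).
  split; first by have [h3 _] := phiP n; exact: leq_trans h1 h3.
  split; first by exists n.
  rewrite /A /= rE alE; 
  have -> : f (x (phi n)) - q i = (f (x (phi n)) - l) + (l - q i) :> K by ring.
  by rewrite (le_trans (ler_rnormD _ _))// [leRHS]splitr lerD// ltW.
have /oU hm : (\oo : set_system nat) (fun n => (m <= n)%N) by exists m.
have [n [h1 h2]] := filter_meet hm (hl' _ d2); exists (phi (psi n)).
split.
  have [h3 _] := phiP (psi n); have [h4 _] := psiP n.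
  by apply: leq_trans h3; exact: leq_trans h4.
split; first by exists (psi n).
rewrite /B /= rE beE; 
have -> : f (x (phi (psi n))) - q j = (f (x (phi (psi n))) - l') + (l' - q j) :> K by ring.
by rewrite (le_trans (ler_rnormD _ _))// [leRHS]splitr lerD// ltW.
Qed.

End ell1_copies.

(** * Weakly Cauchy sequences and (M) *)

Section convex_tails.
Context {R : realType} {k : scalar_kind}.
Local Notation K := (scalars R k).
Variable X : normedModType K.

Definition convex_subset (D : set X) := forall u v t, D u -> D v -> 0 <= t -> t <= 1 ->
  D (of_real k t *: u + of_real k (1 - t) *: v).

(** The convex hull of a tail, given as an intersection: an estimate on it is proved by exhibiting
    one convex set that contains the tail. *)
Definition tail_hull (x : nat -> X) (m : nat) : set X :=
  [set c | forall D, convex_subset D -> (forall i, (m <= i)%N -> D (x i)) -> D c].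

Variable x : nat -> X.
Local Notation C := (tail_hull x).

Lemma tail_hull_le m n c : (m <= n)%N -> C n c -> C m c.
Proof. by move=> mn cn D cD hD; apply: cn => // i ni; apply: hD; exact: leq_trans ni. Qed.

Lemma tail_hull_mem m i : (m <= i)%N -> C m (x i).
Proof. by move=> mi D _; exact. Qed.

Lemma tail_hull_convex m : convex_subset (C m).
Proof. by move=> u v t Cu Cv t0 t1 D cD hD; apply: (cD); [exact: Cu|exact: Cv|..]. Qed.

Lemma tail_hull_mean m y u v : 0 <= y -> C m u -> C m v ->
  C m (of_real k (1 + y)^-1 *: (u + of_real k y *: v)).
Proof.
move=> y0 Cu Cv; have y1 : 0 < 1 + y by rewrite ltr_pwDl.
have -> : of_real k (1 + y)^-1 *: (u + of_real k y *: v) =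
    of_real k (1 + y)^-1 *: u + of_real k (1 - (1 + y)^-1) *: v.
  rewrite scalerDr of_realZ; congr (_ + of_real k _ *: _).
  by field; rewrite gt_eqF.
apply: tail_hull_convex => //; first by rewrite invr_ge0 ltW.
by rewrite invf_le1// lerDl.
Qed.

Lemma tail_hull_near (f : bop X K^o) (a : K^o) e m c :
  (forall i, (m <= i)%N -> rnorm (f (x i) - a) <= e) -> C m c -> rnorm (f c - a) <= e.
Proof.
move=> h Cc; apply: (Cc [set c | rnorm (f c - a) <= e]) => // u v t /= hu hv t0 t1.
have -> : f (of_real k t *: u + of_real k (1 - t) *: v) - a =
    of_real k t *: (f u - a) + of_real k (1 - t) *: (f v - a).
  by rewrite bopD !bopZ; vector.
rewrite (le_trans (ler_rnormD _ _))// !rnorm_scale !ger0_norm ?subr_ge0//.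
have : t * rnorm (f u - a) <= t * e by rewrite ler_wpM2l.
have : (1 - t) * rnorm (f v - a) <= (1 - t) * e by rewrite ler_wpM2l// subr_ge0.
lra.
Qed.

Lemma tail_hull_norm B m c : (forall n, rnorm (x n) <= B) -> C m c -> rnorm c <= B.
Proof.
move=> x1 Cc; apply: (Cc [set c | rnorm c <= B]) => [u v t /= hu hv t0 t1|i _]; last exact: x1.
rewrite (le_trans (ler_rnormD _ _))// !rnorm_scale !ger0_norm ?subr_ge0//.
have : t * rnorm u <= t * B by rewrite ler_wpM2l.
have : (1 - t) * rnorm v <= (1 - t) * B by rewrite ler_wpM2l// subr_ge0.
lra.
Qed.

(** [l] is the supremum, hence the limit, of the infima of [F] over the shrinking tail hulls. *)
Lemma tail_infimum (F : X -> R) (B : R) : (forall c, 0 <= F c) -> (forall c, C 0 c -> F c <= B) ->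
  exists l, [/\ forall e, 0 < e -> exists m, forall c, C m c -> l - e <= F c &
    forall m e, 0 < e -> exists2 c, C m c & F c <= l + e].
Proof.
move=> F0 FB; pose I m := inf [set F c | c in C m].
have hI m : has_inf [set F c | c in C m].
  by split; [exists (F (x m)), (x m) => //; exact: tail_hull_mem|exists 0 => _ [c _ <-]].
have Ile m c : C m c -> I m <= F c.
  by move=> Cc; apply: ge_inf; [have [] := hI m|exists c].
have hS : has_sup (range I).
  split; first by exists (I 0%N), 0%N.
  exists B => _ [m _ <-]; apply: (le_trans (Ile m (x m) _)); first exact: tail_hull_mem.
  by apply: FB; exact: tail_hull_mem.
exists (sup (range I)); split=> [e e0|m e e0].
  have [_ [m _ <-] hm] := sup_adherent e0 hS; exists m => c Cc.
  exact: le_trans (ltW hm) (Ile m c Cc).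
have [_ [c Cc <-] hc] := inf_adherent e0 (hI m); exists c => //.
rewrite (le_trans (ltW hc))// lerD2r; apply: sup_upper_bound => //.
Qed.

End convex_tails.

Section weakly_cauchy_sequences.
Context {R : realType} {k : scalar_kind}.
Local Notation K := (scalars R k).
Variable X : normedModType K.
Hypothesis hM : monotone_M X.
Variable x : nat -> X.
Hypothesis x1 : forall n, rnorm (x n) <= 1.
Hypothesis cx : weakly_cauchy x.
Local Notation C := (tail_hull x).

(** These differences replace [x n] minus its weak limit: on a late tail, and so on its hull, every
    functional is nearly constant. *)
Lemma weak_null_difference (y c : nat -> X) (n : nat -> nat) :
  (forall j, (j <= n j)%N) -> (forall j, C j (c j)) -> weak_null (fun j => x (n j) - c j).
Proof.
move=> hn hc f e e0; have [N hN] := cx f e0; exists N => // j /= Nj.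
rewrite bopB rnorm_distC; apply: (tail_hull_near (m := j) (x := x)) => // i ji.
by apply: hN; [exact: leq_trans ji|exact: leq_trans (hn j)].
Qed.

(** The limsup of [rnorm (z + x n)], kept in [R] as the infimum of its bounds. *)
Definition limit_norm (z : X) : R := inf [set a | limsup_le (fun n => rnorm (z + x n)) a].

Local Notation G := limit_norm.

Lemma limit_norm_has_inf z : has_inf [set a | limsup_le (fun n => rnorm (z + x n)) a].
Proof.
split.
  exists (rnorm z + 1) => e e0; apply: filterE => n.
  by rewrite (le_trans (ler_rnormD _ _))// -addrA lerD2l (le_trans (x1 n))// lerDl ltW.
exists 0 => a ha; apply/ler_addgt0Pr => e e0.
by have [N _ /(_ N (leqnn N))] := ha e e0; exact: le_trans (rnorm_ge0 _).
Qed.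

Lemma limit_norm_ge0 z : 0 <= G z.
Proof.
apply: lb_le_inf; first by have [] := limit_norm_has_inf z.
move=> a ha; apply/ler_addgt0Pr => e e0.
by have [N _ /(_ N (leqnn N))] := ha e e0; exact: le_trans (rnorm_ge0 _).
Qed.

Lemma limit_normP z : limsup_le (fun n => rnorm (z + x n)) (G z).
Proof.
move=> e e0; have e2 : 0 < e / 2 by rewrite divr_gt0.
have [a ha aG] := inf_adherent e2 (limit_norm_has_inf z).
by apply: filterS (ha _ e2) => n h; rewrite (le_trans h)// [in leRHS](splitr e) addrA lerD2r ltW.
Qed.

Lemma limit_norm_le z a : limsup_le (fun n => rnorm (z + x n)) a -> G z <= a.
Proof. by move=> h; apply: ge_inf => //; have [] := limit_norm_has_inf z. Qed.

Lemma limit_norm_ge z e m : 0 < e -> exists2 n, (m <= n)%N & G z - e <= rnorm (z + x n).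
Proof.
move=> e0; apply: contrapT => h; suff : G z <= G z - e by lra.
apply: limit_norm_le => d d0; exists m => // n /= mn.
rewrite leNgt; apply/negP => hn; apply: h; exists n => //.
by apply: le_trans (ltW hn); rewrite lerDl ltW.
Qed.

Lemma limit_norm_lipschitz u v : G u <= G v + rnorm (u - v).
Proof.
apply: limit_norm_le => e e0; apply: filterS (limit_normP v e0) => n h.
have -> : u + x n = (v + x n) + (u - v) by vector.
by rewrite (le_trans (ler_rnormD _ _))//; lra.
Qed.

Lemma limit_norm_dilate y w : 0 < y -> (1 + y) * G w <= G (of_real k (1 + y) *: w) + y.
Proof.
move=> y0; have y1 : 0 < 1 + y by rewrite addr_gt0.
rewrite mulrC -ler_pdivlMr//; apply: limit_norm_le => e e0.
have ey : 0 < (1 + y) * e by rewrite mulr_gt0.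
apply: filterS (limit_normP (of_real k (1 + y) *: w) ey) => n h.
rewrite -(ler_pM2l y1) mulrDr [(1 + y) * (_ / _)]mulrC divfK ?gt_eqF//.
rewrite -[X in X * rnorm _](gtr0_norm y1) -rnorm_scale.
have -> : of_real k (1 + y) *: (w + x n) = (of_real k (1 + y) *: w + x n) + of_real k y *: x n.
  vector.
have := ler_rnormD (of_real k (1 + y) *: w + x n) (of_real k y *: x n).
have : y * rnorm (x n) <= y * 1 by rewrite ler_wpM2l// ltW.
by rewrite rnorm_scale gtr0_norm//; lra.
Qed.

Lemma shift_infimum v : exists l,
  [/\ forall e, 0 < e -> exists m, forall c, C m c -> l - e <= G (v - c) &
    forall m e, 0 < e -> exists2 c, C m c & G (v - c) <= l + e].
Proof.
apply: (@tail_infimum _ _ _ x (fun c => G (v - c)) (rnorm v + 1 + 1)).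
  by move=> c; exact: limit_norm_ge0.
move=> c Cc; apply: limit_norm_le => e e0; apply: filterE => n.
have := ler_rnormD (v - c) (x n); have := ler_rnormB v c.
by have := tail_hull_norm x1 Cc; have := x1 n; lra.
Qed.

(* The limit over [m] of the infimum of [limit_norm (v - c)] for [c] in [C m]. *)
Definition shift_norm (v : X) : R := sval (cid (shift_infimum v)).
Local Notation d := shift_norm.

Lemma shift_norm_ge v e : 0 < e -> exists m, forall c, C m c -> d v - e <= G (v - c).
Proof. by have [h _] := svalP (cid (shift_infimum v)); exact: h. Qed.

Lemma shift_norm_le v m e : 0 < e -> exists2 c, C m c & G (v - c) <= d v + e.
Proof. by have [_ h] := svalP (cid (shift_infimum v)); exact: h. Qed.

(** Far out, a hull point [c j] nearly minimizes for [v], and an index [n j] nearly realizes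
    [limit_norm (u - c j)] from below while respecting [limit_norm (v - c j)] from above. As
    [x (n j) - c j] is weakly null, (M) compares the two. *)
Lemma shift_norm_monotone u v : rnorm u <= rnorm v -> d u <= d v.
Proof.
move=> uv; rewrite leNgt; apply/negP => duv; pose e := (d u - d v) / 8.
have e0 : 0 < e by rewrite divr_gt0// subr_gt0.
have eE : d u = d v + 8 * e by rewrite /e; field.
clearbody e; have [m hm] := shift_norm_ge u e0.
have cP j : exists c, C (maxn m j) c /\ G (v - c) <= d v + e.
  by have [c] := shift_norm_le v (maxn m j) e0; exists c.
have [c {}cP] := choice cP.
have [n nP] : {n : nat -> nat & forall j, [/\ (j <= n j)%N,
    d u - 2 * e <= rnorm (u - c j + x (n j)) & rnorm (v - c j + x (n j)) <= d v + 2 * e]}.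
  apply: (@choice nat nat (fun j i => [/\ (j <= i)%N,
    d u - 2 * e <= rnorm (u - c j + x i) & rnorm (v - c j + x i) <= d v + 2 * e])) => j.
  have [Cj Gj] := cP j; have [N _ hN] := limit_normP (v - c j) e0.
  have [i ji hi] := limit_norm_ge (u - c j) (maxn N j) e0; exists i; split.
  - exact: leq_trans (leq_maxr _ _) ji.
  - apply: le_trans hi; have := hm (c j) (tail_hull_le (leq_maxl m j) Cj); lra.
  - apply: (le_trans (hN i (leq_trans (leq_maxl _ _) ji))); lra.
have wn : weak_null (fun j => x (n j) - c j).
  apply: weak_null_difference => // j; first by have [] := nP j.
  by apply: (tail_hull_le (leq_maxr m j)); have [] := cP j.
have vl : limsup_le (fun j => rnorm (v + (x (n j) - c j))) (d v + 2 * e).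
  move=> e' e'0; apply: filterE => j; have [_ _ h] := nP j.
  by rewrite addrA addrAC (le_trans h)// lerDl ltW.
have [N _ /(_ N (leqnn N))] := hM uv wn vl e0.
have [_ h _] := nP N; rewrite addrA addrAC => h'.
by have := le_trans h h'; rewrite eE; lra.
Qed.

Lemma shift_norm_lipschitz u v : d u <= d v + rnorm (u - v).
Proof.
apply/ler_addgt0Pr => e e0; have e2 : 0 < e / 2 by rewrite divr_gt0.
have [m hm] := shift_norm_ge u e2; have [c Cc hc] := shift_norm_le v m e2.
have := hm c Cc; have := limit_norm_lipschitz (u - c) (v - c).
have -> : u - c - (v - c) = u - v by rewrite opprB addrA subrK.
lra.
Qed.

Section contradiction.
Variables (rho : R) (v0 : X).
Hypothesis rho0 : 0 < rho.
Hypothesis rho_ge : forall e, 0 < e -> exists m, forall c, C m c -> rho - e <= rnorm c.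
Hypothesis rho_le : forall m e, 0 < e -> exists2 c, C m c & rnorm c <= rho + e.
Hypothesis v0E : rnorm v0 = rho.
Hypothesis d1 : 1 < d v0.
Local Notation eta := (d v0 - 1).

(** Comparison with a multiple of [v0]: monotonicity replaces [u] by the multiple of the same norm,
    and the Lipschitz estimate brings that back to [v0]. The next lemma does the same in the other
    direction. *)
Lemma shift_norm_scaled u : d u <= d v0 + Num.max 0 (rnorm u - rho).
Proof.
have [h|h] := leP (rnorm u) rho.
  have := @shift_norm_monotone u v0; rewrite v0E => /(_ h).
  by have : 0 <= Num.max 0 (rnorm u - rho) by [rewrite le_max lexx]; lra.
pose t := rnorm u / rho; have t1 : 1 < t by rewrite ltr_pdivlMr// mul1r.
have tv : rnorm (of_real k t *: v0) = rnorm u.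
  by rewrite rnorm_scale v0E gtr0_norm ?divfK ?gt_eqF// (lt_trans _ t1).
have h1 : d u <= d (of_real k t *: v0) by apply: shift_norm_monotone; rewrite tv.
have h2 := shift_norm_lipschitz (of_real k t *: v0) v0.
have h3 : rnorm (of_real k t *: v0 - v0) = rnorm u - rho.
  have -> : of_real k t *: v0 - v0 = of_real k (t - 1) *: v0 by vector.
  by rewrite rnorm_scale v0E gtr0_norm ?subr_gt0// mulrBl divfK ?gt_eqF// mul1r.
apply: (le_trans h1); apply: (le_trans h2); rewrite h3 lerD2l.
by rewrite le_max lexx orbT.
Qed.

Lemma shift_norm_lower u e : 0 < e -> rho - e <= rnorm u -> d v0 - e <= d u.
Proof.
move=> e0 hu; have [re|er] := leP rho e.
  have h0 : rnorm (0 : X) <= rnorm u by rewrite rnorm0 rnorm_ge0.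
  have := shift_norm_monotone h0; have := shift_norm_lipschitz v0 0.
  by rewrite subr0 v0E; lra.
pose t := (rho - e) / rho.
have t0 : 0 <= t by rewrite divr_ge0 ?(ltW rho0)// subr_ge0 ltW.
have tE : t * rho = rho - e by rewrite divfK ?gt_eqF.
have tv : rnorm (of_real k t *: v0) = rho - e by rewrite rnorm_scale v0E ger0_norm.
have h1 : d (of_real k t *: v0) <= d u by apply: shift_norm_monotone; rewrite tv.
have := shift_norm_lipschitz v0 (of_real k t *: v0).
have -> : v0 - of_real k t *: v0 = of_real k (1 - t) *: v0 by vector.
have t1 : t <= 1 by rewrite ler_pdivrMr// mul1r lerBlDr lerDl ltW.
rewrite rnorm_scale v0E ger0_norm ?subr_ge0// mulrBl tE mul1r; lra.
Qed.

(* With [c1 = (u0 + y u1) / (1 + y)], [c2 = (y u2 + u3) / (1 + y)] and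
   [z = u0 + y (u1 - u2)], the vector [z - u3] is [(1 + y) (c1 - c2)]; convexity of
   [t |-> limsup |t (c1 - c2) + x n|] at [t = 0, 1, 1 + y] bounds [|z|] from below. *)
Lemma ell1_growth y e : 0 < y -> 0 < e -> exists m, forall u0 u1, C m u0 -> C m u1 ->
  exists m1, forall u2, C m1 u2 ->
    rho + eta * y - e <= rnorm (u0 + of_real k y *: (u1 - u2)).
Proof.
move=> y0 e0; have y1 : 0 < 1 + y by rewrite addr_gt0.
have ey : 0 < eta * y by rewrite mulr_gt0// subr_gt0.
have [e' [e'0 h1 h2]] : exists e', [/\ 0 < e', (3 + 2 * y) * e' <= e & (3 + 2 * y) * e' < eta * y].
  have yy : 0 < 3 + 2 * y by rewrite addr_gt0// mulr_gt0.
  exists (Num.min e (eta * y / 2) / (3 + 2 * y)); split.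
  - by rewrite divr_gt0// lt_min e0 divr_gt0.
  - by rewrite mulrC divfK ?gt_eqF// ge_min lexx.
  - by rewrite mulrC divfK ?gt_eqF// gt_min; apply/orP; right;
       rewrite ltr_pdivrMr// ltr_pMr// ltr1n.
have [m hm] := rho_ge e'0; exists m => u0 u1 Cu0 Cu1.
pose c1 := of_real k (1 + y)^-1 *: (u0 + of_real k y *: u1).
have Cc1 : C m c1 by exact: tail_hull_mean (ltW y0) Cu0 Cu1.
have dc1 := shift_norm_lower e'0 (hm c1 Cc1).
have [m1 hm1] := shift_norm_ge c1 e'0; exists m1 => u2 Cu2.
pose z := u0 + of_real k y *: (u1 - u2).
have [u3 Cu3 hu3] := shift_norm_le z m1 e'0.
pose c2 := of_real k (1 + y)^-1 *: (u3 + of_real k y *: u2).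
have Cc2 : C m1 c2 by exact: tail_hull_mean (ltW y0) Cu3 Cu2.
have h3 := hm1 c2 Cc2.
have h4 := limit_norm_dilate (c1 - c2) y0.
have zE : of_real k (1 + y) *: (c1 - c2) = z - u3.
  rewrite /c1 /c2 scalerBr !of_realZ divff ?gt_eqF// of_real1 !scale1r /z; vector.
rewrite zE in h4; have h5 := shift_norm_scaled z.
have h6 : (1 + y) * (d v0 - 2 * e') <= (1 + y) * G (c1 - c2).
  by rewrite ler_wpM2l ?(ltW y1)//; lra.
have h7 : eta * y - (3 + 2 * y) * e' <= Num.max 0 (rnorm z - rho).
  by move: h3 h4 h5 h6 hu3 dc1; clear; lra.
rewrite -/z; move: h7; rewrite le_max => /orP[h7|h7].
  by move: h2 h7; clear; lra.
by move: h1 h7; clear; lra.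
Qed.

(** Scaling reduces to [rnorm v = rho]. There (M) exchanges [v] for a hull point [u0] of nearly the
    same norm, since the differences of late terms are weakly null, and [ell1_growth] applies to
    [u0]. *)
Lemma ell1_growth_difference v y e N : v != 0 -> 0 < y -> 0 < e ->
  exists i j, [/\ (N <= i)%N, (N <= j)%N &
    rnorm v + eta * y - e <= rnorm (v + of_real k y *: (x i - x j))].
Proof.
move=> vn0 y0 e0; have vp : 0 < rnorm v by rewrite rnorm_gt0.
pose t := rho / rnorm v; have t0 : 0 < t by rewrite divr_gt0.
have tv : t * rnorm v = rho by rewrite divfK ?gt_eqF.
pose v' := of_real k t *: v; pose y' := t * y.
have y'0 : 0 < y' by rewrite mulr_gt0.
have v'E : rnorm v' = rho by rewrite rnorm_scale gtr0_norm.
pose e' := t * e / 4; have e'0 : 0 < e' by rewrite divr_gt0// mulr_gt0.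
have [m hm] := ell1_growth y'0 e'0; have [u0 Cu0 hu0] := rho_le m e'0.
have jP i : exists j, (i <= j)%N /\ rho + eta * y' - e' <=
    rnorm (u0 + of_real k y' *: (x (maxn m i) - x j)).
  have [m1 hm1] := hm u0 (x (maxn m i)) Cu0 (tail_hull_mem (leq_maxl m i)).
  exists (maxn m1 i); split; first exact: leq_maxr.
  by apply: hm1; apply: tail_hull_mem; exact: leq_maxl.
have [j {}jP] := choice jP.
have wn : weak_null (fun i => of_real k y' *: (x (maxn m i) - x (j i))).
  move=> f; apply: (to0_eq (z := fun i => of_real k y' *: f (x (maxn m i) - x (j i)))).
    apply: to0Z; apply: weak_null_difference => // i; first exact: leq_maxr.
    by apply: tail_hull_mem; have [] := jP i.
  by move=> i; rewrite bopZ.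
apply: contrapT => h.
(* [u0] may be slightly longer than [v'], so [v'] is stretched to norm [rho + e'] before (M) is
   applied. The margin [4 e'] exceeds the three errors [e'] of the stretching, of (M) and of
   [ell1_growth]. *)
pose u0' := of_real k ((rho + e') / rho) *: v'.
have re0 : 0 < (rho + e') / rho by rewrite divr_gt0// addr_gt0.
have u0E : rnorm u0' = rho + e' by rewrite rnorm_scale v'E gtr0_norm// divfK ?gt_eqF.
have u0le : rnorm u0 <= rnorm u0' by rewrite u0E.
have ul : limsup_le (fun i => rnorm (u0' + of_real k y' *: (x (maxn m i) - x (j i))))
    (rho + eta * y' - 4 * e' + e').
  move=> d' d'0; exists N => // i /= Ni.
  have [ij _] := jP i.
  have hi : rnorm (v + of_real k y *: (x (maxn m i) - x (j i))) < rnorm v + eta * y - e.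
    rewrite ltNge; apply/negP => hi; apply: h; exists (maxn m i), (j i); split=> //.
      by rewrite (leq_trans Ni)// leq_maxr.
    exact: leq_trans Ni ij.
  have hi' : rnorm (v' + of_real k y' *: (x (maxn m i) - x (j i))) < rho + eta * y' - 4 * e'.
    have -> : v' + of_real k y' *: (x (maxn m i) - x (j i)) =
       of_real k t *: (v + of_real k y *: (x (maxn m i) - x (j i))).
      by rewrite /v' /y'; clear; vector.
    rewrite rnorm_scale gtr0_norm//.
    have := hi; rewrite -(ltr_pM2l t0) => /lt_le_trans; apply.
    have : t * (rnorm v + eta * y - e) = t * rnorm v + eta * (t * y) - t * e by ring.
    rewrite tv => ->; rewrite /y' /e'; lra.
  have -> : u0' + of_real k y' *: (x (maxn m i) - x (j i)) =
      (v' + of_real k y' *: (x (maxn m i) - x (j i))) + of_real k (e' / rho) *: v'.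
    rewrite /u0' (_ : (rho + e') / rho = 1 + e' / rho); last by field; rewrite gt_eqF.
    by vector.
  have : rnorm (of_real k (e' / rho) *: v') = e'.
    by rewrite rnorm_scale v'E gtr0_norm ?divfK ?gt_eqF// divr_gt0.
  have := ler_rnormD (v' + of_real k y' *: (x (maxn m i) - x (j i))) (of_real k (e' / rho) *: v').
  by move: hi' d'0; clear; lra.
have [i _ /(_ i (leqnn i))] := hM u0le wn ul e'0.
have [_ hi] := jP i; move=> hi'; have := le_trans hi hi'.
by move: e'0; clear; lra.
Qed.

Lemma weakly_cauchy_contradiction : False.
Proof.
have eta0 : 0 < eta by rewrite subr_gt0.
(* As [th <= 1/2], the increments after step [i] sum to at most [4 th^(i+1)], which [16 th <= eta]
   makes at most a quarter of [eta th^i]. The growth at step [i] is three quarters of [eta th^i], so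
   half of [eta] remains for [f n (w i)]. *)
have [th [th0 th1 th2]] : exists th, [/\ 0 < th, th <= 2^-1 & 16 * th <= eta].
  exists (Num.min 2^-1 (eta / 16)); split.
  - by rewrite lt_min invr_gt0 ltr0n divr_gt0.
  - by rewrite ge_min lexx.
  - by rewrite mulrC -ler_pdivlMr// ge_min lexx orbT.
have thn n : 0 < th ^+ n by rewrite exprn_gt0.
have [s sP] : {s : nat * X -> nat * nat & forall p, p.2 != 0 ->
    [/\ (p.1 <= (s p).1)%N, (p.1 <= (s p).2)%N &
      rnorm p.2 + eta * th ^+ p.1 - eta * th ^+ p.1 / 4 <=
      rnorm (p.2 + of_real k (th ^+ p.1) *: (x (s p).1 - x (s p).2))]}.
  apply: (@choice (nat * X)%type (nat * nat)%type (fun p q => p.2 != 0 ->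
    [/\ (p.1 <= q.1)%N, (p.1 <= q.2)%N &
      rnorm p.2 + eta * th ^+ p.1 - eta * th ^+ p.1 / 4 <=
      rnorm (p.2 + of_real k (th ^+ p.1) *: (x q.1 - x q.2))])) => -[n v] /=.
  have [->|v_0] := eqVneq v 0; first by exists (0, 0)%N.
  have e0 : 0 < eta * th ^+ n / 4 by rewrite divr_gt0// mulr_gt0.
  by have [i [j h]] := ell1_growth_difference n v_0 (thn n) e0; exists (i, j).
pose v := fix v n := if n is n'.+1 then
  v n' + of_real k (th ^+ n') *: (x (s (n', v n')).1 - x (s (n', v n')).2) else v0.
pose w n := x (s (n, v n)).1 - x (s (n, v n)).2.
have vS n : v n.+1 = v n + of_real k (th ^+ n) *: w n by [].
have step n : v n != 0 -> rnorm (v n) + 3 / 4 * eta * th ^+ n <= rnorm (v n.+1).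
  by move=> /(sP (n, v n)) [_ _ /=]; rewrite -/(w n) -vS; move: (rnorm (v n.+1)) => b; lra.
have vn0 n : v n != 0.
  elim: n => [|n IHn]; first by rewrite -rnorm_gt0 v0E.
  rewrite -rnorm_gt0; apply: lt_le_trans (step n IHn).
  by rewrite ltr_pwDr ?rnorm_ge0// mulr_gt0// mulr_gt0.
have vmono n p : (n <= p)%N -> rnorm (v n) <= rnorm (v p).
  elim: p => [|p IHp]; first by rewrite leqn0 => /eqP ->.
  rewrite leq_eqVlt => /predU1P[->//|/IHp h]; apply: (le_trans h).
  by apply: le_trans (step p (vn0 p)); rewrite lerDl ltW// mulr_gt0// mulr_gt0.
have w2 n : rnorm (w n) <= 2.
  rewrite (le_trans (ler_rnormB _ _))//.
  by have := x1 (s (n, v n)).1; have := x1 (s (n, v n)).2; lra.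
have close n p : rnorm (v (n + p)%N - v n) <= 4 * th ^+ n - 4 * th ^+ (n + p).
  elim: p => [|p IHp]; first by rewrite addn0 !subrr rnorm0.
  rewrite addnS vS addrAC (le_trans (ler_rnormD _ _))// rnorm_scale gtr0_norm// exprS.
  have := ler_wpM2l (ltW (thn (n + p)%N)) (w2 (n + p)%N).
  have : th * th ^+ (n + p) <= 2^-1 * th ^+ (n + p) by rewrite ler_wpM2r// ltW.
  move: IHp; move: (rnorm _) => a; move: (rnorm (w _)) => b; move: (th ^+ (n + p)) => q; lra.
have [f fP] : {f : nat -> bop X K^o & forall n,
    rnorm (f n) <= 1 /\ f n (v n) = of_real k (rnorm (v n))}.
  apply: (@choice nat (bop X K^o)
    (fun n f => rnorm f <= 1 /\ f (v n) = of_real k (rnorm (v n)))) => n.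
  exact: norming_functional.
have fw i n : (i < n)%N -> eta / 2 <= real_part (f n (w i)).
  move=> ni; have [f1 fv] := fP n.
  have h1 := step i (vn0 i); have h2 := vmono _ _ ni.
  have h3 : rnorm (v n - v i.+1) <= 4 * th ^+ i.+1.
    have := close i.+1 (n - i.+1)%N; rewrite subnKC// => /le_trans; apply.
    by rewrite gerBl mulr_ge0// ltW.
  have h4 := le_trans (real_part_le _) (bop_le_bound f1 h3).
  have h5 := le_trans (real_part_le _) (bop_le_bound f1 (lexx (rnorm (v i)))).
  have h6 : real_part (f n (v n)) = real_part (f n (v n - v i.+1)) + real_part (f n (v i)) +
      th ^+ i * real_part (f n (w i)).
    rewrite -real_partM -functionalZ -!real_partD -!bopD; congr (real_part (f n _)).
    by rewrite vS; clear; vector.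
  rewrite fv of_realK in h6.
  rewrite -(ler_pM2l (thn i)); rewrite exprS in h4.
  have h7 : 16 * th * th ^+ i <= eta * th ^+ i by rewrite ler_wpM2r// ltW.
  move: h1 h2 h4 h5 h6 h7; clear; rewrite !mul1r.
  move: (rnorm (v n)) (rnorm (v i)) (rnorm (v i.+1)) (real_part _) (real_part _) (real_part _).
  by move: (th ^+ i) => q a b c e g r; lra.
have [U [UU oU]] := ultraFilterLemma eventually_filter.
have [g [g1 gP]] := weak_star_ultra_limit (U := U) ler01 (fun n => proj1 (fP n)).
have gw i : eta / 4 <= real_part (g (w i)).
  have e4 : 0 < eta / 4 by rewrite divr_gt0.
  have /oU hi : (\oo : set_system nat) (fun n => (i < n)%N) by exists i.+1.
  have [n [h1 h2]] := filter_meet hi (gP (w i) _ e4).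
  have := le_trans (real_part_le _) h2; rewrite real_partB; have := fw i n h1.
  by move: (real_part _) (real_part _) => a b; lra.
have e8 : 0 < eta / 8 by rewrite divr_gt0.
have [N hN] := cx g e8; have [h1 h2 _] := sP (N, v N) (vn0 N).
have := le_trans (real_part_le _) (hN _ _ h1 h2).
by rewrite -bopB -/(w N); have := gw N; move: (real_part _) => a; lra.
Qed.

End contradiction.

(* If [shift_norm v > 1] for some [v] of norm [rho], then by [monotone_M] far differences
   [x i - x j] act like an l1 basis over every vector; adding geometrically decreasing
   multiples of such differences produces a functional bounded below on all of them. *)
Lemma weakly_cauchy_shift : exists rho, [/\ 0 <= rho, rho <= 1,
  forall m e, 0 < e -> exists2 c, C m c & rnorm c <= rho + e &
  forall v, rnorm v <= rho -> forall m e, 0 < e -> exists2 c, C m c &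
    limsup_le (fun n => rnorm (v - c + x n)) (1 + e)].
Proof.
have [|c Cc|rho [rho_ge rho_le]] := @tail_infimum _ _ _ x (fun c => rnorm c) 1.
- by move=> c; exact: rnorm_ge0.
- exact: tail_hull_norm Cc.
have rho0 : 0 <= rho.
  apply/ler_addgt0Pr => e e0; have [c _ h] := rho_le 0%N e e0.
  exact: le_trans (rnorm_ge0 _) h.
have rho1 : rho <= 1.
  apply/ler_addgt0Pr => e e0; have [m hm] := rho_ge e e0.
  have := hm (x m) (tail_hull_mem (leqnn m)); have := x1 m; lra.
exists rho; split=> // v hv m e e0.
suff dv : d v <= 1.
  have [c Cc hc] := shift_norm_le v m e0; exists c => // e' e'0.
  apply: filterS (limit_normP (v - c) e'0) => n h; apply: (le_trans h).
  by rewrite lerD2r (le_trans hc)// lerD2r.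
(* If [rho = 0] then [v = 0], and hull points of small norm already give [d 0 <= 1]. The scaling by
   [1 / rho] needs the other case. *)
move: rho0; rewrite le_eqVlt => /predU1P[r0|rho0].
  have -> : v = 0 by apply/rnorm0_eq0/eqP; rewrite eq_le rnorm_ge0 andbT r0.
  apply/ler_addgt0Pr => e' e'0; have e2 : 0 < e' / 2 by rewrite divr_gt0.
  have [p hp] := shift_norm_ge 0 e2; have [c Cc hc] := rho_le p _ e2.
  have := hp c Cc; have : G (0 - c) <= 1 + e' / 2.
    apply: limit_norm_le => b b0; apply: filterE => n.
    rewrite (le_trans (ler_rnormD _ _))// sub0r rnormN; have := x1 n.
    by move: hc; rewrite -r0 add0r; lra.
  by lra.
rewrite leNgt; apply/negP => dv.
have r2 : 0 < rho / 2 by rewrite divr_gt0.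
have [p hp] := rho_ge _ r2.
have xp : 0 < rnorm (x p) by have := hp _ (tail_hull_mem (leqnn p)); lra.
(* The contradiction needs a vector of norm exactly [rho], whereas [v] may be shorter; a late [x p]
   is nonzero and can be scaled, and [d v <= d v0] by monotonicity. *)
pose v0 := of_real k (rho / rnorm (x p)) *: x p.
have v0E : rnorm v0 = rho by rewrite rnorm_scale gtr0_norm ?divfK ?gt_eqF// divr_gt0.
apply: (@weakly_cauchy_contradiction rho v0) => //.
by apply: (lt_le_trans dv); apply: shift_norm_monotone; rewrite v0E.
Qed.

End weakly_cauchy_sequences.

Lemma small_factor (R : realFieldType) (D b : R) : 0 < D -> 0 < b ->
  exists t, [/\ 0 < t, t <= 1 & t * D <= b].
Proof.
move=> D0 b0; exists (Num.min 1 (b / D)); split.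
- by rewrite lt_min ltr01 divr_gt0.
- by rewrite ge_min lexx.
- apply: (@le_trans _ _ (b / D * D)); last by rewrite divfK ?gt_eqF.
  by rewrite ler_pM2r// ge_min lexx orbT.
Qed.

(** * From (M) to its dual version *)

Section M_star.
Context {R : realType} {k : scalar_kind}.
Local Notation K := (scalars R k).

(* Take [y n] almost norming [g + w n] and weakly Cauchy.  Since the hull of a tail of [y]
   has a point of norm about [rho], [g (y n)] is about at most [rho * |g|], which
   [h v] reaches for some [v] of norm [rho]; now test [h + w n] on [v - c + y n]. *)
Lemma monotone_M_star_of_M (X : completeNormedModType K) :
  ~ contains_copy X (ell1 R k) -> monotone_M X -> monotone_M_star X.
Proof.
move=> nX hM g h w M a gh w0 wM ha.
have a0 : 0 <= a.
  apply/ler_addgt0Pr => e e0; have [N _ /(_ N (leqnn N))] := ha e e0.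
  exact: le_trans (rnorm_ge0 _).
apply: contrapT => hg.
have [e e0 he] : exists2 e, 0 < e & forall N, exists n, (N <= n)%N /\ a + e < rnorm (g + w n).
  apply: contrapT => h'; apply: hg => e e0; apply: contrapT => h''; apply: h'; exists e => // N.
  apply: contrapT => hN; apply: h''; exists N => // n /= Nn; rewrite leNgt; apply/negP => hn.
  by apply: hN; exists n.
have [psi psiP] := choice he; have e8 : 0 < e / 8 by rewrite divr_gt0.
have [x xP] := choice (fun n => functional_near (g + w (psi n)) e8).
have [|phi [phin cx]] := rosenthal_ell1 (x := x) nX; first by move=> n; have [] := xP n.
pose y n := x (phi n); pose W n := w (psi (phi n)).
have y1 n : rnorm (y n) <= 1 by have [] := xP (phi n).
have pn n : (n <= psi (phi n))%N by have [h' _] := psiP (phi n); exact: leq_trans (phin n) h'.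
have W0 u : to0 \oo (fun n => W n u) by exact: (to0_subseq pn (w0 u)).
have gW n : a + 7 / 8 * e <= real_part (g (y n)) + real_part (W n (y n)).
  have [_ h1 h2] := xP (phi n); have [_ h3] := psiP (phi n).
  rewrite -real_partD -[g (y n) + _]/((g + w (psi (phi n))) (x (phi n))) h2 of_realK.
  by move: h1 h3; move: (rnorm _) (rnorm _) => b c; lra.
have [rho [rho0 rho1 rho_le hv]] := weakly_cauchy_shift hM y1 cx.
(* All errors below add up to at most [dl (2 a + 12 + rnorm g)], hence to [e / 2], while the assumed
   excess in [gW] is [7/8 e]. *)
have [dl [dl0 dl1 dlE]] : exists dl, [/\ 0 < dl, dl <= 1 & dl * (2 * a + 12 + rnorm g) <= e / 2].
  by apply: small_factor; [have := rnorm_ge0 g; lra|rewrite divr_gt0].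
move: dlE gW; clear wM hM nX hg xP psiP he; have [z [z1 hz zE]] := functional_near h dl0.
pose v := of_real k rho *: z.
have vr : rnorm v <= rho.
  by have := ler_wpM2l rho0 z1; rewrite mulr1 /v rnorm_scale (ger0_norm rho0).
have hvE : rho * rnorm h - dl <= real_part (h v).
  rewrite functionalZ real_partM zE of_realK.
  move: rho0 rho1 dl0 (ltW hz); clear; move: (rnorm h) (rnorm _) => b c; nra.
have [N1 hN1] := cx g _ dl0; have [N2 hN2] := cx h _ dl0.
have [c1 Cc1 c1n] := rho_le N1 _ dl0.
have gy n : (N1 <= n)%N -> real_part (g (y n)) <= rho * rnorm g + dl * rnorm g + dl.
  move=> Nn; have hh : rnorm (g c1 - g (y n)) <= dl.
    by apply: tail_hull_near Cc1 => i Ni; exact: hN1.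
  have := le_trans (real_part_le _) (bop_le_bound (lexx (rnorm g)) c1n).
  rewrite rnorm_distC in hh; have := le_trans (real_part_le _) hh; rewrite real_partB.
  by move: (real_part _) (real_part _) => b c; lra.
have [c Cc hc] := hv v vr N2 _ dl0.
have hyc n : (N2 <= n)%N -> - dl <= real_part (h (y n)) - real_part (h c).
  move=> Nn; have hh : rnorm (h c - h (y n)) <= dl.
    by apply: tail_hull_near Cc => i Ni; exact: hN2.
  have := le_trans (real_part_le _) hh; rewrite real_partB.
  by move: (real_part _) (real_part _) => b b'; lra.
have ha' : limsup_le (fun n => rnorm (h + W n)) a.
  move=> b b0; have [N _ hN] := ha b b0; exists N => // n /= Nn.
  by apply: hN; exact: leq_trans Nn (pn n).
move=> dlE gW'; have [n [[[h1 h2] [h3 h4]] [h5 h6]]] : exists n, (((N1 <= n)%N /\ (N2 <= n)%N) /\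
    (rnorm (v - c + y n) <= 1 + dl + dl /\ rnorm (h + W n) <= a + dl)) /\
    (rnorm (W n v) <= dl /\ rnorm (W n c) <= dl).
  apply: (@filter_ex _ (\oo : set_system nat)).
  apply: filterI; last exact: filterI (W0 v _ dl0) (W0 c _ dl0).
  apply: filterI; last exact: filterI (hc _ dl0) (ha' _ dl0).
  by apply: filterI; exact: nbhs_infty_ge.
have h7 := le_trans (real_part_le _) (bop_le_bound h4 h3).
have h8 := hyc n h2; have h9 := gy n h1; have h10 := gW' n.
have h11 : - dl <= real_part (W n v).
  rewrite lerNl -real_partN; apply: (le_trans (real_part_le _)); by rewrite rnormN.
have h12 := le_trans (real_part_le _) h6.
have h13 : real_part ((h + W n) (v - c + y n)) = real_part (h v) - real_part (h c) +
    real_part (h (y n)) + (real_part (W n v) - real_part (W n c) + real_part (W n (y n))).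
  rewrite -!real_partB -!real_partD; congr real_part.
  by rewrite bop_addE !bopD !bopN.
rewrite h13 in h7.
have h14 : rho * rnorm g <= rho * rnorm h by exact: ler_wpM2l.
have h15 : dl * dl <= dl by move: dl0 dl1; clear; nra.
move: h7 h8 h9 h10 h11 h12 h14 h15 hvE dlE dl0 e0; clear.
move: (real_part _) (real_part _) (real_part _) (real_part _).
move: (real_part _) (real_part _) (real_part _).
move: (rnorm g) (rnorm h) => ng nh r1 r2 r3 r4 r5 r6 r7; lra.
Qed.

End M_star.

(** The induction step of [gap] in [simons_bound]: [L] is the norm of the sum of the series, [U] and
    [U'] are those of two consecutive partial sums, [V] is that of the nearly minimal vector,
    [A = la^n] and [t = 2^-n]. *)
Lemma gap_step (R : realFieldType) (L U' U V A t la de : R) :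
  U' <= (1 - la) * V + la * U ->
  (1 - la) * V <= (1 - la) * (L + de * (la * A) * (2^-1 * t)) ->
  la * (A * (L - de * (1 - t))) <= la * (L - U) ->
  0 <= la * (de * (la * A) * (2^-1 * t)) ->
  la * A * (L - de * (1 - 2^-1 * t)) <= L - U'.
Proof. lra. Qed.

(** * Simons' inequality *)

Section Simons.
Context {R : realType} {k : scalar_kind}.
Local Notation K := (scalars R k).
Variables (E : normedModType K) (d : nat -> E) (B : R).
Hypothesis cE : forall u : nat -> E,
  (forall e, 0 < e -> exists N, forall m n, (N <= m)%N -> (N <= n)%N -> rnorm (u m - u n) <= e) ->
  exists l, to0 \oo (fun n => u n - l).
Hypothesis dB : forall n, rnorm (d n) <= B.
Hypothesis attained : forall D : E,
  (forall e, 0 < e -> exists2 c, tail_hull d 0 c & rnorm (D - c) <= e) -> 1 < rnorm D ->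
  exists phi : bop E K^o, [/\ rnorm phi <= 1, real_part (phi D) = rnorm D &
    forall e, 0 < e -> (\oo : set_system nat) (fun n => real_part (phi (d n)) <= 1 + e)].

Lemma tail_hull_real_part (phi : bop E K^o) m a c :
  (forall i, (m <= i)%N -> real_part (phi (d i)) <= a) -> tail_hull d m c ->
  real_part (phi c) <= a.
Proof.
move=> h Cc; apply: (Cc [set c | real_part (phi c) <= a]) => // u v t /= hu hv t0 t1.
rewrite bopD !functionalZ real_partD !real_partM.
have : t * real_part (phi u) <= t * a by rewrite ler_wpM2l.
have : (1 - t) * real_part (phi v) <= (1 - t) * a by rewrite ler_wpM2l// subr_ge0.
lra.
Qed.

Lemma near_minimal m (u : E) (t e : R) : 0 < e -> exists g, tail_hull d m g /\
  forall h, tail_hull d m h -> rnorm (u + of_real k t *: g) <= rnorm (u + of_real k t *: h) + e.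
Proof.
move=> e0; pose A := [set rnorm (u + of_real k t *: h) | h in tail_hull d m].
have hA : has_inf A.
  split; first by exists (rnorm (u + of_real k t *: d m)), (d m) => //; exact: tail_hull_mem.
  by exists 0 => _ [h _ <-]; exact: rnorm_ge0.
have [_ [g Cg <-] hg] := inf_adherent e0 hA; exists g; split=> // h Ch.
by apply: (le_trans (ltW hg)); rewrite lerD2r; apply: ge_inf; [have [] := hA|exists h].
Qed.

Section minimizing.
Variables (N : nat) (a la de : R) (g u : nat -> E).
Hypothesis la0 : 0 < la.
Hypothesis la1 : la < 1.
Local Notation q := (1 - la)^-1.
Hypothesis de0 : 0 < de.
Hypothesis hN : forall c, tail_hull d N c -> a <= rnorm c.
Hypothesis u0 : u 0%N = 0.
Hypothesis uS : forall n, u n.+1 = u n + of_real k (la ^+ n) *: g n.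
Hypothesis gC : forall n, tail_hull d (N + n) (g n).
Hypothesis gmin : forall n h, tail_hull d (N + n) h ->
  rnorm (u n + of_real k (la ^+ n * q) *: g n) <=
  rnorm (u n + of_real k (la ^+ n * q) *: h) + de * la ^+ n.+1 * 2^-1 ^+ n.+1.
Local Notation v n := (u n + of_real k (la ^+ n * q) *: g n).

Let q0 : 0 < q. Proof. by rewrite invr_gt0 subr_gt0. Qed.
Let qE : q * (1 - la) = 1. Proof. by rewrite mulVf// gt_eqF// subr_gt0. Qed.
Let lan n : 0 < la ^+ n. Proof. exact: exprn_gt0. Qed.

(** [v n] is [u n] with the whole remaining mass [la^n q], the sum of [la^p] over [p >= n], put on
    [g n]. A later vector of this form redistributes that mass over [g n] and later terms, which
    amounts to another point of the same hull. *)
Lemma partial_mean j n : exists2 h, tail_hull d (N + n) h &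
  v (n + j)%N = u n + of_real k (la ^+ n * q) *: h.
Proof.
elim: j n => [|j IHj] n; first by exists (g n); rewrite ?addn0.
have [h Ch E1] := IHj n.+1; rewrite addnS -addSn E1.
exists (of_real k la *: h + of_real k (1 - la) *: g n).
  apply: tail_hull_convex => //; [|exact: ltW..].
  by apply: tail_hull_le Ch; rewrite addnS.
rewrite uS exprS scalerDr !of_realZ.
have -> : la ^+ n * q * (1 - la) = la ^+ n by rewrite -mulrA qE mulr1.
have -> : la * la ^+ n * q = la ^+ n * q * la by ring.
by vector.
Qed.

Lemma partial_sum_norm n j : rnorm (u (n + j)%N - u n) <= B * q * (la ^+ n - la ^+ (n + j)).
Proof.
elim: j => [|j IHj]; first by rewrite addn0 !subrr rnorm0 mulr0.
rewrite addnS uS addrAC (le_trans (ler_rnormD _ _))// rnorm_scale gtr0_norm//.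
have h1 : la ^+ (n + j) * rnorm (g (n + j)) <= la ^+ (n + j) * B.
  have gB := tail_hull_norm dB (@gC (n + j)%N); exact: (ler_wpM2l (ltW (lan (n + j)%N)) gB).
have -> : B * q * (la ^+ n - la ^+ (n + j).+1) =
    B * q * (la ^+ n - la ^+ (n + j)) + la ^+ (n + j) * B * (q * (1 - la)).
  by rewrite exprS; ring.
by rewrite qE mulr1 lerD.
Qed.

Let B0 : 0 <= B. Proof. exact: le_trans (rnorm_ge0 _) (dB 0). Qed.

Lemma partial_sum_cvg : exists l, [/\ forall e n, 0 < e -> exists2 m, (n <= m)%N &
    rnorm (v m - l) <= e & forall n, rnorm (l - u n) <= B * q * la ^+ n].
Proof.
have dist n j : rnorm (u (n + j)%N - u n) <= B * q * la ^+ n.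
  apply: (le_trans (partial_sum_norm n j)); rewrite ler_wpM2l ?mulr_ge0//; first exact: ltW.
  by rewrite gerBl ltW.
have la_cvg e : 0 < e -> (\oo : set_system nat) (fun n => B * q * la ^+ n <= e).
  move=> e0.
  have /cvgrPdist_le hc : geometric (B * q) la @ \oo --> (0 : R).
    by apply: cvg_geometric; rewrite gtr0_norm.
  apply: filterS (hc e e0) => n; rewrite sub0r normrN; exact: le_trans (ler_norm _).
have [|l hl] := cE (u := u).
  move=> e e0; have e2 : 0 < e / 2 by rewrite divr_gt0.
  have [M _ hM] := la_cvg _ e2; exists M => m n Mm Mn.
  have h1 := dist M (m - M)%N; have h2 := dist M (n - M)%N; rewrite !subnKC// in h1 h2.
  have h3 := hM M (leqnn M).
  have -> : u m - u n = (u m - u M) - (u n - u M) by vector.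
  by rewrite (le_trans (ler_rnormB _ _))//; lra.
exists l; split=> [e n e0|n].
  have e2 : 0 < e / 2 by rewrite divr_gt0.
  have [m [nm [h1 h2]]] := filter_meet (nbhs_infty_ge n) (filterI (la_cvg _ e2) (hl _ e2)).
  exists m => //.
  have -> : v m - l = (u m - l) + of_real k (la ^+ m * q) *: g m by vector.
  rewrite (le_trans (ler_rnormD _ _))// rnorm_scale gtr0_norm ?mulr_gt0//.
  have h3 : la ^+ m * q * rnorm (g m) <= la ^+ m * q * B.
    have gB := tail_hull_norm dB (@gC m); exact: (ler_wpM2l (ltW (mulr_gt0 (lan m) q0)) gB).
  have h4 : la ^+ m * q * B = B * q * la ^+ m by ring.
  by rewrite h4 in h3; lra.
apply/ler_addgt0Pr => e e0.
have [m [nm h]] := filter_meet (nbhs_infty_ge n) (hl _ e0).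
have h1 := dist n (m - n)%N; rewrite subnKC// in h1.
have -> : l - u n = (u m - u n) - (u m - l) by vector.
by rewrite (le_trans (ler_rnormB _ _))// lerD.
Qed.

(** Let [l] be the sum of the series. Near-minimality bounds [rnorm (v n)] by about [rnorm l], and
    [u n.+1 = (1 - la) v n + la u n] then makes [rnorm l - rnorm (u n)] at least about
    [la^n rnorm l]. A functional attaining its norm at [l] collects this amount from [la^n g n] and
    from the later terms, which contribute at most [la^n la q B]. So its value at [g n] is at least
    about [a - la q B], yet eventually at most [1 + de]. *)
Lemma simons_bound : 1 < a -> a - de - la * q * B <= 1 + de.
Proof.
move=> a1; have [l [hv hu]] := partial_sum_cvg.
have vl n : rnorm (v n) <= rnorm l + de * la ^+ n.+1 * 2^-1 ^+ n.+1.
  apply/ler_addgt0Pr => e e0; have [m nm hm] := hv e n e0.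
  have [h Ch hE] := partial_mean (m - n) n; rewrite subnKC// in hE.
  apply: (le_trans (gmin Ch)); rewrite -hE addrAC lerD2r.
  by have := ler_rnormD (v m - l) l; rewrite subrK; move: hm; lra.
have uv n : u n.+1 = of_real k (1 - la) *: v n + of_real k la *: u n.
  rewrite uS scalerDr of_realZ.
  have -> : (1 - la) * (la ^+ n * q) = la ^+ n by rewrite mulrCA [X in _ * X]mulrC qE mulr1.
  by vector.
(* The tolerance in [gmin] carries the factor [la^(n+1) 2^-(n+1)]: relative to the geometric weight,
   the accumulated errors stay below [de]. *)
have gap n : la ^+ n * (rnorm l - de * (1 - 2^-1 ^+ n)) <= rnorm l - rnorm (u n).
  elim: n => [|n IHn]; first by rewrite !expr0 subrr mulr0 !subr0 mul1r u0 rnorm0 subr0.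
  have h1 : rnorm (u n.+1) <= (1 - la) * rnorm (v n) + la * rnorm (u n).
    rewrite uv (le_trans (ler_rnormD _ _))// !rnorm_scale.
    by rewrite (gtr0_norm la0) gtr0_norm ?subr_gt0.
  have h2 := vl n; have h3 : 0 <= de * la ^+ n.+1 * 2^-1 ^+ n.+1.
    by rewrite mulr_ge0 ?mulr_ge0 ?exprn_ge0 ?invr_ge0 ?(ltW la0) ?(ltW de0).
  have h4 : (1 - la) * rnorm (v n) <= (1 - la) * (rnorm l + de * la ^+ n.+1 * 2^-1 ^+ n.+1).
    by rewrite ler_wpM2l// subr_ge0 ltW.
  have h5 : la * (la ^+ n * (rnorm l - de * (1 - 2^-1 ^+ n))) <= la * (rnorm l - rnorm (u n)).
    by rewrite ler_wpM2l// ltW.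
  have h6 : 0 <= la * (de * la ^+ n.+1 * 2^-1 ^+ n.+1) by rewrite mulr_ge0// ltW.
  by move: h1 h4 h5 h6; rewrite !exprS; exact: gap_step.
(* The weights [la^p] have sum [q], so [(1 - la) l] is a limit of hull points. Its norm is therefore
   at least [a > 1], which is what [attained] asks for. *)
have lN : a <= (1 - la) * rnorm l.
  apply/ler_addgt0Pr => e e0; have [m _ hm] := hv e 0%N e0.
  have [h Ch hE] := partial_mean m 0; rewrite add0n u0 add0r expr0 mul1r in hE.
  have h1 : of_real k (1 - la) *: v m = h.
    by rewrite hE of_realZ mulrC qE of_real1 scale1r.
  have := hN (c := h); rewrite addn0 in Ch; move=> /(_ Ch); rewrite -h1 => h2.
  rewrite (le_trans h2)// rnorm_scale gtr0_norm ?subr_gt0//.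
  have h3 : rnorm (v m) <= rnorm l + e.
    by have := ler_rnormD (v m - l) l; rewrite subrK; move: hm; lra.
  have : (1 - la) * rnorm (v m) <= (1 - la) * (rnorm l + e) by rewrite ler_wpM2l// subr_ge0 ltW.
  by rewrite mulrDr => /le_trans; apply; rewrite lerD2l mulrBl mul1r gerBl ltW// mulr_gt0.
have lpos := rnorm_ge0 l.
have [||phi [phi1 phil hphi]] := @attained (of_real k (1 - la) *: l).
- move=> e e0; have [m _ hm] := hv e 0%N e0.
  have [h Ch hE] := partial_mean m 0; rewrite add0n u0 add0r expr0 mul1r in hE.
  exists h; first by apply: tail_hull_le Ch.
  have -> : h = of_real k (1 - la) *: v m by rewrite hE of_realZ mulrC qE of_real1 scale1r.
  rewrite -scalerBr rnorm_scale gtr0_norm ?subr_gt0// rnorm_distC.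
  have := ler_wpM2l (ltW la0) (rnorm_ge0 (v m - l)); rewrite mulr0.
  by move: hm; move: (rnorm _) => b; lra.
- by rewrite rnorm_scale gtr0_norm ?subr_gt0//; lra.
rewrite functionalZ real_partM rnorm_scale gtr0_norm ?subr_gt0// in phil.
have {}phil : real_part (phi l) = rnorm l.
  by apply: (mulfI (x := 1 - la)); rewrite ?gt_eqF ?subr_gt0.
have [n _ hn] := hphi _ de0.
have h1 : real_part (phi (g n)) <= 1 + de.
  apply: (tail_hull_real_part (m := n)); first exact: hn.
  by apply: tail_hull_le (@gC n); rewrite leq_addl.
apply: le_trans h1.
have h2 : real_part (phi (u n)) <= rnorm (u n).
  by have := le_trans (real_part_le _) (bop_le_bound phi1 (lexx (rnorm (u n)))); rewrite mul1r.
have h3 : real_part (phi (l - u n.+1)) <= B * q * la ^+ n.+1.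
  by have := le_trans (real_part_le _) (bop_le_bound phi1 (hu n.+1)); rewrite mul1r.
have h4 : real_part (phi l) = real_part (phi (l - u n.+1)) + real_part (phi (u n)) +
    la ^+ n * real_part (phi (g n)).
  rewrite -real_partM -functionalZ -!real_partD -!bopD; congr (real_part (phi _)).
  by rewrite uS; vector.
have h5 := gap n; rewrite exprS in h3.
have h6 : 0 <= de * 2^-1 ^+ n by rewrite mulr_ge0 ?exprn_ge0 ?invr_ge0 ?(ltW de0).
have h7 : a <= rnorm l by have := mulr_ge0 (ltW la0) lpos; lra.
rewrite -(ler_pM2l (lan n)).
have h8 : la ^+ n * (a - de) <= la ^+ n * (rnorm l - de * (1 - 2^-1 ^+ n)).
  by rewrite ler_wpM2l ?(ltW (lan n))//; lra.
have -> : la ^+ n * (a - de - la * q * B) = la ^+ n * (a - de) - B * q * (la * la ^+ n) by ring.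
rewrite lerBlDr (le_trans h8)// (le_trans h5)// lerBlDr -phil h4.
by rewrite [leLHS]addrC -[leRHS]addrA lerD2l lerD.
Qed.

End minimizing.

(* [g n] nearly minimizes [|u n + (sum_(p >= n) la^p) g|] over the hull of the tail, with
   [u n = sum_(p < n) la^p g p]; a functional attaining the norm of the whole series then
   stays close to the infimum at every [g n]. *)
Lemma simons N e : 0 < e -> exists2 c, tail_hull d N c & rnorm c <= 1 + e.
Proof.
move=> e0; apply: contrapT => h.
have hN c : tail_hull d N c -> 1 + e <= rnorm c.
  by move=> Cc; rewrite leNgt; apply/negP => hc; apply: h; exists c => //; exact: ltW.
have B0 : 0 <= B by exact: le_trans (rnorm_ge0 _) (dB 0).
have B1 : 0 < 8 * B + 1 by lra.
(* The parameter [t] below is at most [1/2] with [t (8 B + 1) <= e]. Hence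
   [t (1 - t)^-1 B <= 2 t B <= e / 4], and with [de = e / 8] the conclusion of [simons_bound] would
   give [e <= e / 2]. *)
have [la [la0 la1 laB]] := small_factor B1 e0.
have la2 : 0 < Num.min (2^-1) la by rewrite lt_min invr_gt0 ltr0n.
move: (Num.min 2^-1 la) la2 (ge_min 2^-1 (2^-1 : R) la) (ge_min la 2^-1 la).
rewrite !lexx orbT /= => t t0 t2 tla.
have t1 : t < 1 by lra.
pose de := e / 8; have de0 : 0 < de by rewrite divr_gt0.
have eps n : 0 < de * t ^+ n.+1 * 2^-1 ^+ n.+1 by rewrite !mulr_gt0 ?exprn_gt0.
have [s sP] := choice (fun p : nat * E =>
  near_minimal (N + p.1) p.2 (t ^+ p.1 * (1 - t)^-1) (eps p.1)).
pose u := fix u n := if n is n'.+1 then u n' + of_real k (t ^+ n') *: s (n', u n') else 0.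
have h1 : 1 + e - de - t * (1 - t)^-1 * B <= 1 + de.
  apply: (@simons_bound N (1 + e) t de (fun n => s (n, u n)) u t0 t1 de0 hN) => //.
  - by move=> n; have [] := sP (n, u n).
  - by move=> n h' Ch'; have [_ /(_ _ Ch')] := sP (n, u n).
  - by rewrite ltrDl.
have q2 : t * (1 - t)^-1 * B <= 2 * t * B.
  by rewrite ler_wpM2r// mulrC ler_wpM2r ?(ltW t0)// invf_ple ?posrE ?subr_gt0//; lra.
have : t * (8 * B + 1) <= la * (8 * B + 1) by rewrite ler_wpM2r// ltW.
by move: h1; rewrite /de; lra.
Qed.

End Simons.

(** * Attainment of norms and the M-ideal property *)

Section operator_M_star.
Context {R : realType} {k : scalar_kind}.
Local Notation K := (scalars R k).
Variable X : normedModType K.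
Hypothesis hM : monotone_M_star X.

(** (M* ) is used twice. Choose [f] in the unit ball with [rnorm (bop_comp f T)] at least
    [1 / (1 + s)]. Then [g] is no longer than [bop_comp (c f) T] with [c = rnorm h (1 + s)], which
    bounds [g + bop_comp (w n) T] by the image of [c f + w n] under the contractive adjoint of [T];
    and [rnorm h *: f] is no longer than [h]. *)
Lemma operator_M_star (T : bop X X) (g h : bop X K^o) (w : nat -> bop X K^o) (M a : R) :
  rnorm T = 1 -> rnorm g <= rnorm h -> weak_star_null w -> (forall n, rnorm (w n) <= M) ->
  limsup_le (fun n => rnorm (h + w n)) a ->
  limsup_le (fun n => rnorm (g + bop_comp (w n) T)) a.
Proof.
move=> T1 gh w0 wM ha e e0.
have H1 : 0 < rnorm h + 1 by rewrite ltr_wpDl ?rnorm_ge0.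
have e3 : 0 < e / 3 by rewrite divr_gt0.
pose s := e / 3 / (rnorm h + 1); have s0 : 0 < s by rewrite divr_gt0.
have sE : s * (rnorm h + 1) = e / 3 by rewrite divfK ?gt_eqF.
clearbody s; have s1 : 0 < 1 + s by rewrite addr_gt0.
have ss : 0 < s / (1 + s) by rewrite divr_gt0.
have [x [x1 Tx]] := bop_norm_near T ss.
have [f [f1 fx]] := norming_functional (T x).
pose c := rnorm h * (1 + s).
have c0 : 0 <= c by rewrite mulr_ge0 ?rnorm_ge0 ?ltW.
have fT : (1 + s)^-1 <= rnorm (bop_comp f T).
  have h1 : rnorm (bop_comp f T x) <= rnorm (bop_comp f T) * 1 by exact: bop_le_bound.
  rewrite bop_compE fx rnorm_of_real ger0_norm ?rnorm_ge0// mulr1 in h1.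
  apply: le_trans h1; apply: le_trans (ltW Tx); rewrite T1.
  by rewrite le_eqVlt; apply/orP; left; apply/eqP; field; rewrite gt_eqF.
have gk : rnorm g <= rnorm (of_real k c *: bop_comp f T).
  rewrite rnorm_scale ger0_norm//; apply: (le_trans gh).
  have h1 : c * (1 + s)^-1 <= c * rnorm (bop_comp f T) by rewrite ler_wpM2l.
  by apply: le_trans h1; rewrite /c mulfK ?gt_eqF.
have hf : rnorm (of_real k (rnorm h) *: f) <= rnorm h.
  by rewrite rnorm_scale ger0_norm ?rnorm_ge0// ler_piMr ?rnorm_ge0.
have fa := hM hf w0 wM ha e3.
have ka : limsup_le (fun n => rnorm (of_real k c *: bop_comp f T + bop_comp (w n) T))
    (a + e / 3 + e / 3).
  move=> e' e'0; apply: filterS fa => n hn.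
  rewrite -bop_compZl -bop_compDl (le_trans (rnorm_comp _ _))// T1 mulr1.
  have -> : of_real k c *: f + w n =
      (of_real k (rnorm h) *: f + w n) + of_real k (rnorm h * s) *: f.
    by rewrite /c; vector.
  rewrite (le_trans (ler_rnormD _ _))// rnorm_scale ger0_norm ?mulr_ge0 ?rnorm_ge0 ?(ltW s0)//.
  have h1 : rnorm h * s * rnorm f <= rnorm h * s.
    by rewrite ler_piMr// mulr_ge0 ?rnorm_ge0// ltW.
  have h2 : rnorm h * s <= e / 3 by rewrite -sE mulrC ler_wpM2l ?(ltW s0)// lerDl.
  rewrite -[leRHS]addrA lerD//; apply: (le_trans h1); apply: (le_trans h2).
  by rewrite lerDl ltW.
have wT0 : weak_star_null (fun n => bop_comp (w n) T) by move=> y; exact: w0.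
have wTM n : rnorm (bop_comp (w n) T) <= M.
  by rewrite (le_trans (rnorm_comp _ _))// T1 mulr1.
apply: filterS (hM gk wT0 wTM ka e3) => n hn; apply: (le_trans hn).
have -> : a + e = a + e / 3 + e / 3 + e / 3 by field.
by [].
Qed.

End operator_M_star.

Section attainment.
Context {R : realType} {k : scalar_kind}.
Local Notation K := (scalars R k).
Variable X : normedModType K.
Hypothesis hM : monotone_M_star X.
Hypothesis sepX : separable X.

Lemma natSinv_le (e : R) : 0 < e -> (\oo : set_system nat) (fun n => n.+1%:R^-1 <= e).
Proof.
move=> e0; have /cvgrPdist_le hc := @cvg_harmonic R.
by apply: filterS (hc e e0) => n; rewrite sub0r normrN; exact: le_trans (ler_norm _).
Qed.

Lemma adjoint_maximizing (D : bop X X) : exists f : nat -> bop X K^o,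
  forall n, rnorm (f n) <= 1 /\ rnorm D - n.+1%:R^-1 <= rnorm (bop_comp (f n) D).
Proof.
suff h n : exists f : bop X K^o, rnorm f <= 1 /\ rnorm D - n.+1%:R^-1 <= rnorm (bop_comp f D).
  by have [f fP] := choice h; exists f.
have n0 : (0 : R) < n.+1%:R^-1 by rewrite invr_gt0 ltr0n.
have [x [x1 Dx]] := bop_norm_near D n0; have [f [f1 fx]] := norming_functional (D x).
exists f; split=> //; apply: (le_trans (ltW Dx)).
have h1 : rnorm (bop_comp f D x) <= rnorm (bop_comp f D) * 1 by exact: bop_le_bound.
by rewrite bop_compE fx rnorm_of_real ger0_norm ?rnorm_ge0// mulr1 in h1.
Qed.

(* Along a weak* convergent maximizing sequence the compact part converges in norm,
   and the operator version of (M* ) shows that no norm is lost in the limit. *)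
Lemma adjoint_attains (T P : bop X X) : rnorm T = 1 -> finite_nets P -> 1 < rnorm (T + P) ->
  exists (f : bop X K^o) (F : bop (bop X K^o) K^o), [/\ rnorm f <= 1, rnorm F <= 1 &
    F (bop_comp f (T + P)) = of_real k (rnorm (T + P))].
Proof.
move=> T1 nP; set D := T + P => D1.
have [f fP] := adjoint_maximizing D.
have [g [phi [g1 phin hg]]] := weak_star_subsequence (f := f) sepX ler01 (fun n => proj1 (fP n)).
pose w n := f (phi n) - g.
have w0 : weak_star_null w by [].
have wM n : rnorm (w n) <= 2.
  by rewrite (le_trans (ler_rnormB _ _))// [leRHS](_ : 2 = 1 + 1)// lerD//; have [] := fP (phi n).
have gw n : g + w n = f (phi n) by rewrite addrC subrK.
(* [c] is 1 or, if larger, the quotient of [rnorm (bop_comp g D)] by [rnorm g]. Once [rnorm D <= c]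
   is known, [1 < rnorm D] forces the second case, so [g] is nonzero and its normalization attains
   the norm. *)
have [c [c1 gc cE]] : exists c, [/\ 1 <= c, rnorm (bop_comp g D) <= c * rnorm g &
    1 < c -> 0 < rnorm g /\ rnorm (bop_comp g D) = c * rnorm g].
  have [h|h] := leP (rnorm (bop_comp g D)) (rnorm g).
    by exists 1; rewrite mul1r; split=> //; rewrite ltxx.
  have gp : 0 < rnorm g.
    rewrite lt_neqAle rnorm_ge0 andbT eq_sym; apply/eqP => g0.
    by have := rnorm_comp g D; rewrite g0 mul0r => /(lt_le_trans h); rewrite g0 ltxx.
  exists (rnorm (bop_comp g D) / rnorm g); rewrite divfK ?gt_eqF//; split=> //.
  by rewrite ler_pdivlMr// mul1r ltW.
have c0 : 0 <= c by rewrite (le_trans ler01).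
(* This vector is [f (phi n) + (c - 1) g], a sum of terms of norms at most 1 and [c - 1]. *)
have cw : limsup_le (fun n => rnorm (of_real k c *: g + w n)) c.
  move=> e e0; apply: filterE => n.
  have -> : of_real k c *: g + w n = (g + w n) + of_real k (c - 1) *: g by vector.
  rewrite gw (le_trans (ler_rnormD _ _))// rnorm_scale ger0_norm ?subr_ge0//.
  have [h1 _] := fP (phi n); have h2 : (c - 1) * rnorm g <= c - 1 by rewrite ler_piMr// subr_ge0.
  apply: (le_trans (lerD h1 h2)); rewrite addrC subrK lerDl; exact: ltW.
have gc' : rnorm (bop_comp g D) <= rnorm (of_real k c *: g) by rewrite rnorm_scale ger0_norm.
have Tw := operator_M_star hM T1 gc' w0 wM cw.
have Pw : to0 \oo (fun n => bop_comp (w n) P) by exact: to0_comp_finite_nets nP wM w0.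
have Dc : rnorm D <= c.
  apply/ler_addgt0Pr => e e0; have e3 : 0 < e / 3 by rewrite divr_gt0.
  have [n [h1 [h2 h3]]] := filter_meet (natSinv_le e3) (filterI (Tw _ e3) (Pw _ e3)).
  have [_ h4] := fP (phi n).
  have h5 : ((phi n).+1%:R^-1 : R) <= n.+1%:R^-1.
    by rewrite lef_pV2 ?posrE ?ltr0n// ler_nat ltnS.
  have h6 : bop_comp (f (phi n)) D = (bop_comp g D + bop_comp (w n) T) + bop_comp (w n) P.
    by rewrite -addrA -bop_compDr -bop_compDl gw.
  have h7 := ler_rnormD (bop_comp g D + bop_comp (w n) T) (bop_comp (w n) P).
  rewrite -h6 in h7; have := le_trans h4 h7.
  have -> : c + e = c + e / 3 + e / 3 + e / 3 by field.
  rewrite lerBlDr => /le_trans; apply; rewrite lerD ?lerD//; exact: le_trans h1.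
have [gp {}cE] := cE (lt_le_trans D1 Dc).
pose h : bop X K^o := of_real k (rnorm g)^-1 *: g.
have h1 : rnorm h <= 1 by rewrite rnorm_scale gtr0_norm ?invr_gt0// mulVf ?gt_eqF.
have hD : rnorm (bop_comp h D) = rnorm D.
  apply/eqP; rewrite eq_le; apply/andP; split.
    by rewrite (le_trans (rnorm_comp _ _))// ler_piMl ?rnorm_ge0.
  rewrite bop_compZl rnorm_scale gtr0_norm ?invr_gt0// cE mulrCA mulVf ?gt_eqF// mulr1.
  exact: Dc.
have [F [F1 Fh]] := norming_functional (bop_comp h D).
by exists h, F; split=> //; rewrite Fh hD.
Qed.

(** Directedness gives a member of the net within [1 / (n + 1)] of the identity at the first [n]
    points of a dense sequence; contractivity extends the convergence to all points. *)
Lemma compact_sequence : metric_compact_approximation_property X ->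
  exists Ks : nat -> bop X X, [/\ forall n, finite_nets (Ks n), forall n, rnorm (Ks n) <= 1 &
    forall x, to0 \oo (fun n => (Ks n - bop_id X) x)].
Proof.
move=> [I [le [T [[[i0 _] le_refl le_trans' le_up] cT T1 Tx]]]].
have [a ad] := separable_sequence sepX.
have near (e : R) n : 0 < e -> exists i, forall j, le i j -> forall m, (m < n)%N ->
    rnorm ((T j - bop_id X) (a m)) <= e.
  move=> e0; elim: n => [|n [i IHn]]; first by exists i0.
  have [|i' hi'] := Tx (a n) [set y | rnorm (a n - y) < e].
    by apply/nbhs_rnormP; exists e.
  have [j [ij i'j]] := le_up i i'; exists j => l jl m; rewrite ltnS leq_eqVlt => /predU1P[->|mn].
    by rewrite bop_subE bop_idE rnorm_distC ltW//; apply: hi'; exact: le_trans' jl.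
  by apply: IHn mn; exact: le_trans' jl.
have h n : exists S : bop X X, [/\ finite_nets S, rnorm S <= 1 & forall m, (m < n)%N ->
    rnorm ((S - bop_id X) (a m)) <= n.+1%:R^-1].
  have n0 : (0 : R) < n.+1%:R^-1 by rewrite invr_gt0 ltr0n.
  have [i hi] := near _ n n0; exists (T i); split; last exact: hi.
    exact: compact_finite_nets.
  by have := T1 i; rewrite -rnormE -(of_real1 (k := k)) ler_of_real.
have [Ks KsP] := choice h; exists Ks; split; try by move=> n; have [] := KsP n.
have KM n : rnorm (Ks n - bop_id X) <= 1 + 1.
  by rewrite (le_trans (ler_rnormB _ _))// lerD ?rnorm_id//; have [] := KsP n.
apply: (dense_to0 KM ad) => i e e0; apply: filterS2 (nbhs_infty_gt i) (natSinv_le e0) => n ni.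
by apply: le_trans; have [_ _] := KsP n; exact.
Qed.

End attainment.

(** * Convex combinations of small norm *)

Section near_contraction.
Context {R : realType} {k : scalar_kind}.
Local Notation K := (scalars R k).
Variable X : completeNormedModType K.
Hypothesis hM : monotone_M_star X.
Hypothesis sepX : separable X.
Variable Ks : nat -> bop X X.
Hypothesis finK : forall n, finite_nets (Ks n).
Hypothesis K1 : forall n, rnorm (Ks n) <= 1.
Hypothesis Kx : forall x, to0 \oo (fun n => (Ks n - bop_id X) x).

(** [bop_comp f (Ks n) - f] is weak* null and, added to [f], gives functionals of norm at most
    [rnorm f]; this is the situation of [weak_star_weak_cvg]. *)
Lemma adjoint_weak_cvg (f : bop X K^o) (F : bop (bop X K^o) K^o) e : 0 < e ->
  (\oo : set_system nat) (fun n => real_part (F (bop_comp f (Ks n) - f)) <= e).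
Proof.
have w0 : weak_star_null (fun n => bop_comp f (Ks n) - f).
  move=> x; apply: (to0_le (M := rnorm f) _ (Kx x)) => n.
  have -> : (bop_comp f (Ks n) - f) x = f ((Ks n - bop_id X) x) by rewrite [RHS]bopB.
  exact: bop_le.
have wM n : rnorm (bop_comp f (Ks n) - f) <= rnorm f + rnorm f.
  rewrite (le_trans (ler_rnormB _ _))// lerD2r (le_trans (rnorm_comp _ _))//.
  by rewrite ler_piMr ?rnorm_ge0.
apply: (weak_star_weak_cvg (f := f) hM w0 wM) => e' e'0; apply: filterE => n.
rewrite addrC subrK (le_trans (rnorm_comp _ _))//.
by rewrite (@le_trans _ _ (rnorm f)) ?ler_piMr ?rnorm_ge0// lerDl ltW.
Qed.

Lemma compact_shift_hull (S T : bop X X) m c : finite_nets S ->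
  tail_hull (fun n => S + T - bop_comp (Ks n) T) m c -> finite_nets (c - T).
Proof.
move=> nS Cc; apply: (Cc [set c : bop X X | finite_nets (c - T)]) => [u v t nu nv _ _|i _].
  have E1 : of_real k t *: (u - T) + of_real k (1 - t) *: (v - T) =
      of_real k t *: u + of_real k (1 - t) *: v - T by vector.
  have : finite_nets (of_real k t *: (u - T) + of_real k (1 - t) *: (v - T)).
    by apply: finite_netsD; exact: finite_netsZ.
  by rewrite E1.
have E1 : S + (-1) *: bop_comp (Ks i) T = S + T - bop_comp (Ks i) T - T by vector.
have : finite_nets (S + (-1) *: bop_comp (Ks i) T).
  by apply: finite_netsD => //; apply: finite_netsZ; exact: finite_nets_compr.
by rewrite E1.
Qed.

(** Simons' inequality in the space of operators. A point [D] of the closed hull is [T] plus a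
    compact operator, so above norm 1 it has an attaining functional [A |-> F (bop_comp f A)]. On
    the sequence itself this functional tends to [F (bop_comp f S)], of modulus at most 1, because
    [F] composed with the adjoint of [T] annihilates [bop_comp f (Ks n) - f] in the limit. *)
Lemma near_contraction_unit (S T : bop X X) e : finite_nets S -> rnorm S <= 1 -> rnorm T = 1 ->
  0 < e -> exists2 c, tail_hull (fun n => S + T - bop_comp (Ks n) T) 0 c & rnorm c <= 1 + e.
Proof.
move=> nS S1 T1 e0.
have dB n : rnorm (S + T - bop_comp (Ks n) T) <= 3.
  have h1 : rnorm (bop_comp (Ks n) T) <= 1 by rewrite (le_trans (rnorm_comp _ _))// T1 mulr1.
  have h2 := ler_rnormB (S + T) (bop_comp (Ks n) T); have h3 := ler_rnormD S T.
  by rewrite T1 in h3; lra.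
apply: (simons (@bop_complete R k X X) dB _ _ e0) => D hD D1.
have nP : finite_nets (D - T).
  apply: finite_nets_limit => d d0; have [c Cc hc] := hD d d0.
  exists (c - T); first exact: compact_shift_hull Cc.
  by have -> : D - T - (c - T) = D - c by vector.
have DE : T + (D - T) = D by rewrite addrC subrK.
rewrite -DE in D1; have [f [F [f1 F1 FE]]] := adjoint_attains hM sepX T1 nP D1.
rewrite DE in FE; exists (bop_comp F (postcompose f)); split.
- apply: bop_norm_le1 => A A1; rewrite bop_compE postcomposeE.
  have h1 : rnorm (bop_comp f A) <= 1.
    by rewrite (le_trans (rnorm_comp _ _))// mulr_ile1 ?rnorm_ge0.
  by have := bop_le_bound F1 h1; rewrite mulr1.
- by rewrite bop_compE postcomposeE FE of_realK.
move=> d d0; apply: filterS (adjoint_weak_cvg f (bop_comp (- F) (adjoint T)) d0) => n.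
rewrite !bop_compE postcomposeE adjointE => h.
have -> : bop_comp f (S + T - bop_comp (Ks n) T) =
    bop_comp f S - bop_comp (bop_comp f (Ks n) - f) T.
  apply/bopP => x; rewrite bop_subE !bop_compE !bop_subE bop_addE !bop_compE bopB bopD.
  by rewrite opprB addrA.
rewrite bopB real_partB; rewrite -[(- F) _]/(- F _) real_partN in h.
have h1 : rnorm (bop_comp f S) <= 1.
  by rewrite (le_trans (rnorm_comp _ _))// mulr_ile1 ?rnorm_ge0.
have := le_trans (real_part_le _) (bop_le_bound F1 h1); rewrite mulr1 => h2.
by rewrite lerD.
Qed.

End near_contraction.

(** * The L-projection along the annihilator *)

Section M_ideal_sufficient.
Context {R : realType} {k : scalar_kind}.
Local Notation K := (scalars R k).
Variable X : completeNormedModType K.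
Hypothesis hM : monotone_M_star X.
Hypothesis sepX : separable X.
Local Notation E := (bop X X).

(** For [T = rnorm T *: U] with [rnorm U = 1], the affine map
    [c |-> rnorm T *: c + (1 - rnorm T) *: S] carries the hull built from [U] into the hull built
    from [T], and keeps norms below [1 + e] since [S] is a contraction. *)
Lemma near_contraction (Ks : nat -> bop X X) (S T : bop X X) e :
  (forall n, finite_nets (Ks n)) -> (forall n, rnorm (Ks n) <= 1) ->
  (forall x, to0 \oo (fun n => (Ks n - bop_id X) x)) ->
  finite_nets S -> rnorm S <= 1 -> rnorm T <= 1 -> 0 < e ->
  exists2 c, tail_hull (fun n => S + T - bop_comp (Ks n) T) 0 c & rnorm c <= 1 + e.
Proof.
move=> nK K1 Kx nS S1 T1 e0.
have [T0|Tn0] := eqVneq T 0.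
  exists (S + T - bop_comp (Ks 0%N) T); first exact: tail_hull_mem.
  have -> : S + T - bop_comp (Ks 0%N) T = S.
    apply/bopP => x; rewrite bop_subE bop_addE bop_compE T0.
    by rewrite -[(0 : E) x]/(0 : X) bop0 addr0 subr0.
  by rewrite (le_trans S1)// lerDl ltW.
have Tp : 0 < rnorm T by rewrite rnorm_gt0.
pose U : bop X X := of_real k (rnorm T)^-1 *: T.
have U1 : rnorm U = 1 by rewrite rnorm_scale gtr0_norm ?invr_gt0// mulVf ?gt_eqF.
have TU : T = of_real k (rnorm T) *: U by rewrite of_realZ divff ?gt_eqF// of_real1 scale1r.
have [c Cc c1] := near_contraction_unit hM sepX nK K1 Kx nS S1 U1 e0.
have T1' : 0 <= 1 - rnorm T by rewrite subr_ge0.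
exists (of_real k (rnorm T) *: c + of_real k (1 - rnorm T) *: S); last first.
  rewrite (le_trans (ler_rnormD _ _))// !rnorm_scale (ger0_norm T1') gtr0_norm//.
  have h1 : rnorm T * rnorm c <= rnorm T * (1 + e) by rewrite ler_pM2l.
  have h2 : (1 - rnorm T) * rnorm S <= (1 - rnorm T) * 1 by rewrite ler_wpM2l.
  have h3 : (1 - rnorm T) * 1 <= (1 - rnorm T) * (1 + e) by rewrite ler_wpM2l// lerDl ltW.
  apply: (le_trans (lerD h1 (le_trans h2 h3))).
  by rewrite -mulrDl addrC subrK mul1r.
apply: (Cc [set c | tail_hull (fun n => S + T - bop_comp (Ks n) T) 0
  (of_real k (rnorm T) *: c + of_real k (1 - rnorm T) *: S)]) => [u v t hu hv t0 t1|i _].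
  have E1 : of_real k (rnorm T) *: (of_real k t *: u + of_real k (1 - t) *: v) +
      of_real k (1 - rnorm T) *: S =
      of_real k t *: (of_real k (rnorm T) *: u + of_real k (1 - rnorm T) *: S) +
      of_real k (1 - t) *: (of_real k (rnorm T) *: v + of_real k (1 - rnorm T) *: S).
    by vector.
  rewrite /mkset E1; exact: tail_hull_convex.
have E1 : of_real k (rnorm T) *: (S + U - bop_comp (Ks i) U) + of_real k (1 - rnorm T) *: S =
    S + T - bop_comp (Ks i) T.
  have -> : S + T = S + of_real k (rnorm T) *: U by rewrite -TU.
  have -> : bop_comp (Ks i) T = of_real k (rnorm T) *: bop_comp (Ks i) U by rewrite -bop_compZr -TU.
  by vector.
rewrite /mkset E1; exact: (tail_hull_mem (x := fun n => S + T - bop_comp (Ks n) T)).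
Qed.

Definition compose_left (A : E) : bop E E.
Proof.
apply: (@mk_bop _ _ _ _ (fun T => bop_comp A T) (rnorm A)) => [a S T|T].
  by rewrite bop_compDr bop_compZr.
exact: rnorm_comp.
Defined.

Lemma rnorm_compose_left A : rnorm (compose_left A) <= rnorm A.
Proof. by apply: bop_norm_le => [|T]; [exact: rnorm_ge0|exact: rnorm_comp]. Qed.

Variable Ks : nat -> E.
Hypothesis nK : forall n, finite_nets (Ks n).
Hypothesis K1 : forall n, rnorm (Ks n) <= 1.
Hypothesis Kx : forall x, to0 \oo (fun n => (Ks n - bop_id X) x).
Variable U : set_system nat.
Hypothesis UU : UltraFilter U.
Hypothesis oU : \oo `<=` U.

(** The range of the L-projection: functionals recovered from their values on compact operators. The
    ultrafilter makes the defining limit available for every functional, so that the projection is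
    everywhere defined. *)
Definition approximated : set (bop E K^o) :=
  [set phi | forall T : E, to0 U (fun n => phi (bop_comp (Ks n) T) - phi T)].

Lemma approximated_subspace : linear_subspace approximated.
Proof.
split=> [T e e0|a f g hf hg T]; first by apply: filterE => n; rewrite subrr rnorm0 ltW.
apply: (to0_eq (z := fun n => a *: (f (bop_comp (Ks n) T) - f T) + (g (bop_comp (Ks n) T) - g T))).
  by apply: to0D; [exact: (to0Z (V := K^o) a (hf T))|exact: hg].
move=> n; rewrite !bop_addE !bop_scaleE.
by rewrite scalerBr opprD addrACA.
Qed.

Lemma compact_limit (phi : bop E K^o) (S : E) : finite_nets S ->
  to0 U (fun n => phi (bop_comp (Ks n) S) - phi S).
Proof.
move=> nS e e0; apply: oU.
have KM n : rnorm (Ks n - bop_id X) <= 1 + 1.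
  by rewrite (le_trans (ler_rnormB _ _))// lerD ?rnorm_id.
have h : to0 \oo (fun n => bop_comp (Ks n - bop_id X) S) by exact: to0_comp_finite_nets nS KM Kx.
apply: (to0_le (M := rnorm phi) _ h) => // n.
by rewrite -bopB bop_compBl bop_comp_idl; exact: bop_le.
Qed.

(** [v] is the limit of [T |-> phi (bop_comp (Ks n) T)]. It agrees with [phi] on compact operators,
    where [Ks n] acts as the identity in the limit. So [v] and [phi] coincide at each
    [bop_comp (Ks n) T], and [v] is its own limit. *)
Lemma approximated_projection (phi : bop E K^o) : exists2 v, approximated v &
  forall S : E, finite_nets S -> (phi - v) S = 0.
Proof.
have hb n : rnorm (bop_comp phi (compose_left (Ks n))) <= rnorm phi.
  rewrite (le_trans (rnorm_comp _ _))// ler_piMr ?rnorm_ge0//.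
  exact: le_trans (rnorm_compose_left _) (K1 n).
have [v [_ hv]] := weak_star_ultra_limit (U := U) (rnorm_ge0 phi) hb.
have vS (S : E) : finite_nets S -> v S = phi S.
  by move=> nS; apply: (to0_unique (hv S)); exact: compact_limit.
exists v; last by move=> S nS; rewrite bop_subE vS// subrr.
move=> T; apply: to0_eq (hv T) _ => n /=.
by rewrite (vS (bop_comp (Ks n) T))//; exact: finite_nets_compr.
Qed.

Lemma approximated_annihilator (j : bop E K^o) : approximated j ->
  (forall S : E, finite_nets S -> j S = 0) -> j = 0.
Proof.
move=> hj j0; apply/bopP => T; apply: (to0_unique (hj T)) => e e0; apply: filterE => n.
rewrite (j0 (bop_comp (Ks n) T)); last exact: finite_nets_compr.
by rewrite -[(0 : bop E K^o) T]/(0 : K^o) subrr rnorm0 ltW.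
Qed.

(* For compact [S] almost norming [v] and [T] almost norming [j], a convex combination of
   the [S + T - Ks n T] has norm close to 1, while [j + v] takes there a value close to
   [j T + v S]. *)
Lemma approximated_norm (j v : bop E K^o) : (forall S : E, finite_nets S -> j S = 0) ->
  approximated v -> rnorm (j + v) = rnorm j + rnorm v.
Proof.
move=> j0 hv; apply/eqP; rewrite eq_le ler_rnormD/=.
have main e : 0 < e -> rnorm j + rnorm v <= (1 + e) * rnorm (j + v) + 4 * e.
  move=> e0; have [T [T1 jT jE]] := functional_near j e0.
  have [T' [T'1 vT' v'E]] := functional_near v e0.
  have [m hm] := filter_ex (hv T' e e0).
  pose S := bop_comp (Ks m) T'.
  have S1 : rnorm S <= 1 by rewrite (le_trans (rnorm_comp _ _))// mulr_ile1 ?rnorm_ge0.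
  have nS : finite_nets S by exact: finite_nets_compr.
  (* Only [U]-many indices make [v (bop_comp (Ks i) T)] close to [v T]. Passing to [Ks \o rho] makes
     the estimate hold at every term, hence on the hull, and preserves strong convergence. *)
  have hK n : exists i, (n <= i)%N /\ rnorm (v (bop_comp (Ks i) T) - v T) <= e.
    exact: filter_meet (oU (nbhs_infty_ge n)) (hv T e e0).
  have [rho hrho] := choice hK.
  have rhon n : (n <= rho n)%N by have [] := hrho n.
  have [c Cc c1] := near_contraction (fun n => nK (rho n)) (fun n => K1 (rho n))
    (fun x => to0_subseq rhon (Kx x)) nS S1 T1 e0.
  have hc : rnorm ((j + v) c - (j T + v S)) <= e.
    apply: tail_hull_near Cc => i _; have [_ h] := hrho i.
    have -> : (j + v) (S + T - bop_comp (Ks (rho i)) T) - (j T + v S) =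
        v T - v (bop_comp (Ks (rho i)) T).
      rewrite bop_addE !bopB !bopD (j0 S nS) (j0 (bop_comp _ T)); last exact: finite_nets_compr.
      by rewrite add0r subr0; vector.
    by rewrite rnorm_distC.
  have h1 := le_trans (real_part_le _) (bop_le_bound (lexx (rnorm (j + v))) c1).
  rewrite rnorm_distC in hc; have h2 := le_trans (real_part_le _) hc.
  have h3 : real_part (v T') - real_part (v S) <= e.
    rewrite -real_partB; apply: (le_trans (real_part_le _)); by rewrite rnorm_distC.
  rewrite real_partB real_partD jE of_realK in h2; rewrite v'E of_realK in h3.
  rewrite mulrC; move: jT vT' h1 h2 h3; clear.
  move: (rnorm (j T)) (rnorm (v T')) (real_part _) (real_part _) => a b r s.
  by move: (rnorm _ * _) => p; lra.
apply/ler_addgt0Pr => e e0.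
have D0 : 0 < rnorm (j + v) + 4 by rewrite ltr_wpDl ?rnorm_ge0.
have [t [t0 t1 tD]] := small_factor D0 e0.
apply: (le_trans (main t t0)); move: tD; move: (rnorm (j + v)) => p; lra.
Qed.

Lemma compact_operators_M_ideal : M_ideal (@compact_operators R k X X).
Proof.
split; [exact: compact_operators_closed|exact: compact_operators_subspace|].
have annP (f : bop E K^o) :
    annihilator (@compact_operators R k X X) f <-> forall S : E, finite_nets S -> f S = 0.
  split=> h S hS; apply: h; [exact: finite_nets_compact|exact: compact_finite_nets].
exists approximated; split; first exact: approximated_subspace.
split=> [phi|j v /annP j0 hv]; last by rewrite -!rnormE approximated_norm// of_realD.
have [v hv vS] := approximated_projection phi.
exists (phi - v, v); split=> [|[j w] /= [/annP j0 hw E1]].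
  by split=> //=; [exact/annP|rewrite subrK].
suff vw : v - w = 0 by move/eqP: vw; rewrite subr_eq0 => /eqP vw; rewrite E1 vw addrK.
apply: approximated_annihilator.
  apply: linear_subspaceD hv _; first exact: approximated_subspace.
  by apply: linear_subspaceN hw; exact: approximated_subspace.
move=> S nS; have := vS S nS; rewrite E1 !bop_subE bop_addE (j0 S nS) add0r => /eqP.
by rewrite subr_eq0 => /eqP ->; rewrite subrr.
Qed.

End M_ideal_sufficient.

Theorem theorem3p13 (R : realType) (k : scalar_kind)
    (X : completeNormedModType (scalars R k)) (sepX : separable X) :
  M_ideal (@compact_operators R k X X) <->
  [/\ ~ contains_copy X (ell1 R k), property_M X &
      metric_compact_approximation_property X].
Proof.
split=> [[_ _ [V [[V0 VP] [Vdec Vnorm]]]]|[nX hM mX]].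
  have dec (f : bop (bop X X) (scalars R k)^o) : exists j v : bop (bop X X) (scalars R k)^o,
      [/\ forall S, compact_operators S -> j S = 0, V v & f = j + v].
    by have [[j v] [[j0 Vv ->] _]] := Vdec f; exists j, v.
  have norm (j v : bop (bop X X) (scalars R k)^o) :
      (forall S, compact_operators S -> j S = 0) -> V v -> rnorm (j + v) = rnorm j + rnorm v.
    move=> j0 Vv; apply: (can_inj (@of_realK R k)); rewrite of_realD !rnormE.
    exact: Vnorm.
  split.
  - have [B hB] := dual_sequence sepX (M_ideal_monotone_M_star V0 VP dec norm).
    exact: separable_dual_no_ell1 hB.
  - exact/property_M_monotone/(M_ideal_monotone_M V0 VP dec norm).
  - exact: (M_ideal_compact_approximation V0 VP dec norm).
have hM' := monotone_M_star_of_M nX ((property_M_monotone X).1 hM).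
have [Ks [nK K1 Kx]] := compact_sequence sepX mX.
have [U [UU oU]] := ultraFilterLemma eventually_filter.
exact: (compact_operators_M_ideal hM' sepX nK K1 Kx UU oU).
Qed.
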